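(* Let $B$ be a fractional Brownian motion with Hurst index $H\in(0,3/4]$. For $n\geq 1$ and $t\geq 0$ set $$Z_n(t)=\frac{1}{\sigma_n}\sum_{k=0}^{\lfloor nt\rfloor-1}\big[(B_{k+1}-B_k)^2-1\big],$$ where $\sigma_n>0$ is such that $E\big(Z_n(1)^2\big)=1$. Fix $d\geq 1$ and consider $0=t_0<t_1<\ldots<t_d$. Let $N\sim\mathscr{N}_d(0,I_d)$. Then there exists a constant $c$ (depending only on $d$, $H$ and $t_1,\ldots,t_d$) such that, for every $n\geq 1$, $$\sup_{\varphi}\left|E\left[\varphi\left(\left(\frac{Z_n(t_i)-Z_n(t_{i-1})}{\sqrt{t_i-t_{i-1}}}\right)_{1\leq i\leq d}\right)\right]-E[\varphi(N)]\right|\leq c\times\begin{cases}\dfrac{1}{\sqrt n}&\text{if }H\in(0,\tfrac12],\\[2mm] n^{2H-\frac32}&\text{if }H\in[\tfrac12,\tfrac34),\\[2mm] \dfrac{1}{\sqrt{\log n}}&\text{if }H=\tfrac34,\end{cases}$$ where the supremum is taken over all functions $\varphi:\mathbb{R}^d\to\mathbb{R}$ of class $C^2$ such that $\|\varphi''\|_\infty\leq 1$.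
   Context: A fractional Brownian motion $B=\{B_t:t\geq 0\}$ with Hurst index $H\in(0,1)$ is a centered Gaussian process started from zero with covariance $E(B_sB_t)=\frac12\left(t^{2H}+s^{2H}-|t-s|^{2H}\right)$, $s,t\geq 0$. $\lfloor\cdot\rfloor$ is the integer part, and an empty sum is zero. $\mathscr{N}_d(0,I_d)$ is the standard Gaussian law on $\mathbb{R}^d$. For $\varphi:\mathbb{R}^d\to\mathbb{R}$ of class $C^2$, $\|\varphi''\|_\infty=\max_{i,j=1,\ldots,d}\sup_{z\in\mathbb{R}^d}\left|\frac{\partial^2\varphi}{\partial x_i\partial x_j}(z)\right|$. When $H=3/4$ and $n=1$, the right-hand side $1/\sqrt{\log n}$ is read as $+\infty$. *)

(* Defs.v *)
From HB Require Import structures.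
From mathcomp Require Import all_boot all_order all_algebra.
From mathcomp Require Import all_classical all_reals all_analysis.

Set Implicit Arguments.
Unset Strict Implicit.
Unset Printing Implicit Defensive.

Import Order.TTheory GRing.Theory Num.Theory numFieldNormedType.Exports.

Local Open Scope classical_set_scope.
Local Open Scope ring_scope.

(* The law N(m, s^2).  The case s = 0 is treated separately because, for a null
   standard deviation, normal_prob is the uniform law on [0, 1]. *)
Definition gaussian_law (R : realType) (m s : R) (A : set R) : \bar R :=
  if s == 0 then \d_m A else normal_prob m s A.

Definition gaussian_variable disp (T : measurableType disp) (R : realType)
    (P : probability T R) (X : T -> R) : Prop :=
  exists m s : R, 0 <= s /\
    forall A : set R, measurable A -> P (X @^-1` A) = gaussian_law m s A.

(* The processes below are indexed by time t >= 0; the values B t at t < 0 are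
   irrelevant. *)
Definition gaussian_process disp (T : measurableType disp) (R : realType)
    (P : probability T R) (B : R -> {RV P >-> R}) : Prop :=
  forall (k : nat) (a t : 'I_k -> R), (forall i, 0 <= t i) ->
    gaussian_variable P (fun w => \sum_(i < k) a i * B (t i) w).

Definition is_fBm disp (T : measurableType disp) (R : realType)
    (P : probability T R) (H : R) (B : R -> {RV P >-> R}) : Prop :=
  [/\ gaussian_process B,
      {ae P, forall w, B 0 w = 0},
      forall t : R, 0 <= t -> ('E_P[B t] = 0)%E
    & forall s t : R, 0 <= s -> 0 <= t ->
        'E_P[fun w => (B s w * B t w)%R]%E =
        (2^-1 * (t `^ (2 * H) + s `^ (2 * H) - `|t - s| `^ (2 * H)))%:E].

Definition Zn disp (T : measurableType disp) (R : realType)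
    (P : probability T R) (B : R -> {RV P >-> R}) (sigma : nat -> R)
    (n : nat) (t : R) (w : T) : R :=
  (sigma n)^-1 *
  \sum_(0 <= k < Num.truncn (n%:R * t)) ((B k.+1%:R w - B k%:R w) ^+ 2 - 1).

Definition Zn_increments disp (T : measurableType disp) (R : realType)
    (P : probability T R) (B : R -> {RV P >-> R}) (sigma : nat -> R)
    (d : nat) (t : 'I_d.+1 -> R) (n : nat) (w : T) : 'rV[R]_d :=
  \row_(i < d)
    let t1 := t (lift ord0 i) in let t0 := t (widen_ord (leqnSn d) i) in
    (Zn B sigma n t1 w - Zn B sigma n t0 w) / Num.sqrt (t1 - t0).

(* The standard Gaussian law on R^d is the d-fold product of N(0, 1). *)
Definition std_gaussian_vector disp (T : measurableType disp) (R : realType)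
    (P : probability T R) (d : nat) (N : T -> 'rV[R]_d) : Prop :=
  (forall i, measurable_fun [set: T] (fun w => N w ord0 i)) /\
  forall A : 'I_d -> set R, (forall i, measurable (A i)) ->
    P [set w | forall i, A i (N w ord0 i)] =
    (\prod_(i < d) normal_prob 0 1 (A i))%E.

Definition partial (R : realType) (d : nat) (i : 'I_d) (f : 'rV[R]_d -> R)
    : 'rV[R]_d -> R :=
  fun x => 'D_(delta_mx ord0 i) f x.

Definition C1 (R : realType) (d : nat) (f : 'rV[R]_d -> R) : Prop :=
  continuous f /\ forall i : 'I_d,
    (forall x, derivable f x (delta_mx ord0 i)) /\ continuous (partial i f).

Definition C2 (R : realType) (d : nat) (f : 'rV[R]_d -> R) : Prop :=
  C1 f /\ forall i : 'I_d, C1 (partial i f).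

Definition hessian_norm (R : realType) (d : nat) (f : 'rV[R]_d -> R) : \bar R :=
  \big[maxe/0%E]_(i < d) \big[maxe/0%E]_(j < d)
    ereal_sup (range (fun z => `|partial i (partial j f) z|%:E)).

Definition rate (R : realType) (H : R) (n : nat) : \bar R :=
  if H <= 2^-1 then ((Num.sqrt n%:R)^-1)%:E
  else if H < 3 / 4 then (n%:R `^ (2 * H - 3 / 2))%:E
  else if n == 1%N then +oo%E
  else ((Num.sqrt (ln n%:R))^-1)%:E.

(* Main.v *)
(** Let X be the stationary Gaussian sequence of increments of B, r its covariance and
    F the vector of its normalised centered quadratic sums.  Along the rotation
    psi(a) = E phi(cos a F + sin a N) of F into an independent copy of N, Gaussian
    integration by parts in X and in N gives
      psi'(a) = sin a cos a sum_ij E[d_ij phi(cos a F + sin a N) (delta_ij - T_ij)],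
    where T_ij is a quadratic form in X.  As the second derivatives are bounded by 1,
    the distance is at most 2 sum_ij E|delta_ij - T_ij|, and Wick's formula reduces
    E(delta_ij - T_ij)^2 to deterministic sums of r(k, l) = rho(|k - l|).
    Its bias is controlled by V(m) = sum_(k, l < m) rho(|k - l|)^2, which is linear in m
    up to O(1 + W), W = sum_m m rho(m)^2, and its variance by a sum over four-cycles,
    at most V (sum_m |rho(m)|)^2.  Bernoulli's inequality gives
    m |rho(m)| <= m^(2H-1) / 2, the sum of rho telescopes, and V(n) >= n, improved to
    V(n) >= (2/25) n log n when H = 3/4.

    Integration by parts in X_k conditionally on the rest needs X_k to be independent
    of the residuals X_l - r(k, l) X_k.  The hypothesis only concerns laws of linear
    combinations; it makes the cosines of linear forms of X_k and of the residuals
    uncorrelated, and uncorrelation passes to bounded limits of linear combinations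
    of cosines, among which all indicators of events are found. *)

Require Import Defs.
From HB Require Import structures.
From mathcomp Require Import all_boot all_order all_algebra.
From mathcomp Require Import all_classical all_reals all_analysis.
From mathcomp Require Import measurable_realfun ring lra.

Set Implicit Arguments.
Unset Strict Implicit.
Unset Printing Implicit Defensive.

Import Order.TTheory GRing.Theory Num.Theory numFieldNormedType.Exports.

Local Open Scope classical_set_scope.
Local Open Scope ring_scope.

(** * Gaussian laws on the line *)

(** One inequality covers the three regimes: with [b = max (2H - 1, 0)] and [q] the rate,
    [n^(2b) <= Q q^2 V(n)]. The row sums of [|r|] are O(n^b) and W is O(n^(2b)). After division by
    [sigma_n^2 = 2 V(n)], the bias of T_ij and its variance are therefore both O(n^(2b) / V(n)) =
    O(q^2), and the standard deviation decides the rate. F is normalised only through Z_n(1), so its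
    covariance matrix is not the identity. Instead of passing through an intermediate Gaussian
    vector with that covariance, the covariance error is kept inside the same quadratic form, as the
    bias of T_ij. Only laws of scalar linear combinations are given, and nothing is assumed on the
    invertibility of r, so no joint density is at hand. Everything starts from Stein's identity on
    the line. Applied to a trigonometric function it yields the characteristic function, in real
    form, as cosines with a phase; applied with the residuals frozen it yields integration by parts
    for the vector. *)

Section normal_integral.
Context {R : realType}.
Local Notation mu := lebesgue_measure.

Local Open Scope ereal_scope.

(** The normal law and the measure of density [normal_pdf] agree on all events, so the Radon-Nikodym
    derivative is [normal_pdf] almost everywhere, and the general change of variables applies. *)
Lemma ge0_integral_normal_prob (m s : R) (f : R -> \bar R) :
  measurable_fun [set: R] f -> (forall x, 0 <= f x) ->
  \int[normal_prob m s]_x f x = \int[mu]_x (f x * (normal_pdf m s x)%:E).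
Proof.
move=> mf f0.
have dom := @normal_prob_dominates R m s.
rewrite -(Radon_Nikodym_SigmaFinite.change_of_variables dom)//.
have mpdf : measurable_fun [set: R] (fun x => (normal_pdf m s x)%:E).
  by apply/measurable_EFinP; exact: measurable_normal_pdf.
have iRN := Radon_Nikodym_SigmaFinite.f_integrable dom.
apply: ae_eq_integral => //.
- by apply: emeasurable_funM => //; exact: measurable_int iRN.
- by apply: emeasurable_funM.
- apply: ae_eqe_mul2l; apply: integral_ae_eq => //= E _ mE.
  by rewrite -Radon_Nikodym_SigmaFinite.f_integral.
Qed.

Lemma integrable_normal_prob (m s : R) (f : R -> \bar R) :
  measurable_fun [set: R] f ->
  mu.-integrable [set: R] (fun x => f x * (normal_pdf m s x)%:E) ->
  (normal_prob m s).-integrable [set: R] f.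
Proof.
move=> mf /integrableP[_ fi]; apply/integrableP; split => //.
rewrite ge0_integral_normal_prob//; last exact: measurableT_comp.
apply: le_lt_trans fi; apply: ge0_le_integral => //=.
- by move=> x _; rewrite mule_ge0// lee_fin normal_pdf_ge0.
- apply: emeasurable_funM; first exact: measurableT_comp.
  by apply/measurable_EFinP; exact: measurable_normal_pdf.
- apply: measurableT_comp => //; apply: emeasurable_funM => //.
  by apply/measurable_EFinP; exact: measurable_normal_pdf.
- by move=> x _; rewrite abseM (@gee0_abs _ (normal_pdf m s x)%:E)// lee_fin normal_pdf_ge0.
Qed.

Lemma integral_normal_prob (m s : R) (f : R -> \bar R) :
  (normal_prob m s).-integrable [set: R] f ->
  \int[normal_prob m s]_x f x = \int[mu]_x (f x * (normal_pdf m s x)%:E).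
Proof.
move=> fi.
have mf : measurable_fun [set: R] f by exact: measurable_int fi.
have mfp : measurable_fun [set: R] (f^\+)%E by exact: measurable_funepos.
have mfn : measurable_fun [set: R] (f^\-)%E by exact: measurable_funeneg.
rewrite integralE !ge0_integral_normal_prob// [RHS]integralE.
have p0 x : 0 <= (normal_pdf m s x)%:E by rewrite lee_fin normal_pdf_ge0.
congr (_ - _); apply: eq_integral => x _.
- by rewrite !funeposE maxe_pMl// mul0e.
- by rewrite !funenegE -mulNe maxe_pMl// mul0e.
Qed.

End normal_integral.

(** * Stein's identity for one-dimensional Gaussian laws *)

Section normal_stein.
Context {R : realType}.
Local Notation mu := lebesgue_measure.

Lemma normal_pdfE_fun (m s x : R) : s != 0 ->
  normal_pdf m s x = normal_peak s * normal_fun m s x.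
Proof. by move=> s0; rewrite normal_pdfE. Qed.

Lemma expR_ge_cube (u : R) : 0 <= u -> u ^+ 3 <= 27 * expR u.
Proof.
move=> u0.
have h : u / 3 <= expR (u / 3).
  by apply: le_trans (expR_ge1Dx _); rewrite lerDr.
have -> : expR u = expR (u / 3) ^+ 3.
  by rewrite -expRM_natl; congr expR; field.
have : (u / 3) ^+ 3 <= expR (u / 3) ^+ 3.
  by rewrite lerXn2r// ?nnegrE ?expR_ge0// divr_ge0.
rewrite expr_div_n => h2; lra.
Qed.

(* Splitting the Gaussian exponent in two absorbs the polynomial factor. *)
Lemma poly_normal_pdf_le (m s : R) : s != 0 ->
  exists2 C, 0 <= C & forall x : R,
    (1 + x ^+ 6) * normal_pdf m s x <= C * normal_pdf m (s * Num.sqrt 2) x.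
Proof.
move=> s0.
have s20 : 0 < s ^+ 2 by rewrite exprn_even_gt0.
have q0 : s * Num.sqrt 2 != 0 by rewrite mulf_neq0// gt_eqF// sqrtr_gt0.
have [p1 p2] := (normal_peak_gt0 s0, normal_peak_gt0 q0).
(* With this [a] the Gaussian exponents are [4 a (x - m)^2] for [s] and [2 a (x - m)^2] for
   [s sqrt 2]. As [x^2 <= y], the factor [x^6] costs a multiple of [exp (a y)], that is of
   [exp (2 a (x - m)^2)], which is exactly the gap. *)
pose a : R := (8 * s ^+ 2)^-1.
have a0 : 0 < a by rewrite invr_gt0 mulr_gt0.
pose D := (1 + 27 / a ^+ 3) * expR (a * (2 * m ^+ 2)).
have D0 : 0 <= D.
  by rewrite mulr_ge0 ?expR_ge0// addr_ge0// divr_ge0// exprn_ge0// ltW.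
exists (normal_peak s * D / normal_peak (s * Num.sqrt 2)) => [|x].
  by apply: divr_ge0; [exact: mulr_ge0 (ltW p1) D0|exact: ltW].
rewrite !normal_pdfE_fun// [leRHS]mulrA divfK ?gt_eqF//.
rewrite [leLHS]mulrCA -mulrA ler_pM2l//.
pose y := 2 * (x - m) ^+ 2 + 2 * m ^+ 2.
have y0 : 0 <= y by rewrite addr_ge0// mulr_ge0// sqr_ge0.
have xy : x ^+ 2 <= y.
  by rewrite /y -subr_ge0 (_ : _ - _ = (x - 2 * m) ^+ 2) ?sqr_ge0//; ring.
have x6 : x ^+ 6 <= 27 / a ^+ 3 * expR (a * y).
  have h : x ^+ 6 <= y ^+ 3.
    by rewrite (exprM x 2 3) lerXn2r// ?nnegrE ?sqr_ge0.
  apply: (le_trans h).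
  have := @expR_ge_cube (a * y) (mulr_ge0 (ltW a0) y0).
  rewrite exprMn => h3.
  by rewrite mulrAC ler_pdivlMr ?exprn_gt0// mulrC.
have h1 : 1 <= expR (a * y) by rewrite -expR0 ler_expR mulr_ge0// ltW.
have -> : normal_fun m s x = expR (- (a * (4 * (x - m) ^+ 2))).
  rewrite /normal_fun; congr expR; rewrite /a -mulr_natr.
  by field.
have -> : normal_fun m (s * Num.sqrt 2) x = expR (- (a * (2 * (x - m) ^+ 2))).
  rewrite /normal_fun; congr expR; rewrite /a exprMn sqr_sqrtr// -mulr_natr.
  by field.
apply: (@le_trans _ _ ((1 + 27 / a ^+ 3) * expR (a * y) *
   expR (- (a * (4 * (x - m) ^+ 2))))).
  rewrite ler_wpM2r ?expR_ge0//; lra.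
rewrite /D -!mulrA -!expRD ler_pM2l; last first.
  by rewrite addr_gt0// divr_gt0// exprn_gt0.
rewrite ler_expR /y; lra.
Qed.

(** The exponent is doubled so that the envelope is nonnegative without absolute values. In Stein's
    identity [f] and [df] have order 2 and [x f(x)] has order 3, the largest order that
    [poly_normal_pdf_le] absorbs. *)
Definition even_growth (n : nat) (f : R -> R) :=
  exists C, forall x, `|f x| <= C * (1 + x ^+ n.*2).

Lemma even_growth_trans (n p : nat) (f : R -> R) : (n <= p)%N ->
  even_growth n f -> even_growth p f.
Proof.
move=> np [C fC]; exists (2 * `|C|) => x; apply: (le_trans (fC x)).
have pos k : 0 <= x ^+ k.*2 by rewrite -mul2n exprM exprn_ge0// sqr_ge0.
apply: (@le_trans _ _ (`|C| * (1 + x ^+ n.*2))).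
  by rewrite ler_wpM2r ?ler_norm// addr_ge0.
rewrite [2 * _]mulrC -mulrA ler_wpM2l//.
suff : x ^+ n.*2 <= 1 + x ^+ p.*2 by have := pos p; lra.
have [h|h] := leP (x ^+ 2) 1.
  have : x ^+ n.*2 <= 1 by rewrite -mul2n exprM exprn_ile1// sqr_ge0.
  by have := pos p; lra.
have : x ^+ n.*2 <= x ^+ p.*2.
  by rewrite -!mul2n !exprM ler_weXn2l// ltW.
lra.
Qed.

Lemma integrable_normal_pdf_growth (m s : R) (f : R -> R) : s != 0 ->
  measurable_fun [set: R] f -> even_growth 3 f ->
  mu.-integrable [set: R] (fun x => (f x * normal_pdf m s x)%:E).
Proof.
move=> s0 mf [C fC]; have [D D0 hD] := poly_normal_pdf_le m s0.
have := integrableZl measurableT (`|C| * D) (integrable_normal_pdf m (s * Num.sqrt 2)).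
apply: le_integrable => //.
  by apply/measurable_EFinP/measurable_funM => //; exact: measurable_normal_pdf.
move=> x _ /=; rewrite lee_fin normrM (ger0_norm (normal_pdf_ge0 _ _ _)).
rewrite [leRHS]ger0_norm ?mulr_ge0 ?normal_pdf_ge0// -mulrA.
apply: le_trans (ler_wpM2l (normr_ge0 C) (hD x)).
rewrite mulrA ler_wpM2r ?normal_pdf_ge0// (le_trans (fC x))//.
by rewrite ler_wpM2r ?ler_norm// addr_ge0// (exprM x 2 3) exprn_ge0// sqr_ge0.
Qed.

Lemma integrable_normal_prob_growth (m s : R) (f : R -> R) : s != 0 ->
  measurable_fun [set: R] f -> even_growth 3 f ->
  (normal_prob m s).-integrable [set: R] (EFin \o f).
Proof.
move=> s0 mf gf; apply: integrable_normal_prob; first exact/measurable_EFinP.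
exact: integrable_normal_pdf_growth.
Qed.

(** These are the boundary terms of the integration by parts. An [f] of order [x^4] leaves a spare
    factor [x^2] under the bound of [poly_normal_pdf_le], hence a decay like [1 / (n + 1)]. *)
Lemma growth_normal_pdf_cvg0 (m s : R) (f : R -> R) (u : nat -> R) : s != 0 ->
  even_growth 2 f -> (forall n, n.+1%:R <= `|u n|) ->
  f (u n) * normal_pdf m s (u n) @[n --> \oo] --> 0.
Proof.
move=> s0 [C fC] un; have [D D0 hD] := poly_normal_pdf_le m s0.
have q0 : s * Num.sqrt 2 != 0 by rewrite mulf_neq0// gt_eqF// sqrtr_gt0.
pose K := 2 * `|C| * (D * normal_peak (s * Num.sqrt 2)).
have hK n : `|f (u n) * normal_pdf m s (u n)| <= K * n.+1%:R^-1.
  have u1 : 1 <= u n ^+ 2.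
    rewrite -[_ ^+ 2]ger0_norm ?sqr_ge0// normrX exprn_ege1//.
    by apply: le_trans (un n); rewrite ler1n.
  have nu : n.+1%:R <= u n ^+ 2.
    rewrite -[_ ^+ 2]ger0_norm ?sqr_ge0// normrX.
    by apply: (le_trans (un n)); rewrite expr2 ler_peMr// (le_trans _ (un n))// ler1n.
  rewrite ler_pdivlMr// normrM (ger0_norm (normal_pdf_ge0 _ _ _)).
  apply: (@le_trans _ _ (2 * `|C| * ((1 + u n ^+ 6) * normal_pdf m s (u n)))); last first.
    rewrite /K ler_wpM2l ?mulr_ge0//; apply: le_trans (hD _) _.
    by rewrite ler_wpM2l// normal_pdf_ub.
  rewrite [leRHS]mulrA [leLHS]mulrAC ler_wpM2r ?normal_pdf_ge0//.
  apply: (@le_trans _ _ (`|C| * (1 + u n ^+ 4) * u n ^+ 2)).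
    apply: ler_pM => //.
    by apply: (le_trans (fC _)); rewrite ler_wpM2r ?ler_norm// addr_ge0// exprn_even_ge0.
  rewrite [2 * _]mulrC -!mulrA ler_wpM2l//.
  rewrite mulrDl mul1r -exprD.
  have : u n ^+ 2 <= u n ^+ 6.
    by rewrite (exprD _ 2 4) ler_peMr ?sqr_ge0// (exprM _ 2 2) exprn_ege1.
  lra.
apply/norm_cvg0P/(@squeeze_cvgr _ _ _ _ (cst 0) (fun n => K * n.+1%:R^-1)).
- by apply: nearW => n; rewrite /= normr_ge0 hK.
- exact: cvg_cst.
- rewrite -[X in _ --> X](mulr0 K); apply: cvgMr; exact: cvg_harmonic.
Qed.

End normal_stein.

Section stein_lemma.
Context {R : realType}.
Local Notation mu := lebesgue_measure.

Lemma even_growthX n k f : (@even_growth R n f) -> (k <= 1)%N ->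
  even_growth n.+1 (fun x : R => x ^+ k * f x).
Proof.
move=> [C fC]; case: k => [_|[|//] _].
  by under eq_fun do rewrite expr0 mul1r; apply: (@even_growth_trans _ n) => //; exists C.
have pos x : 0 <= x ^+ n.*2 :> R by rewrite -mul2n exprM exprn_ge0// sqr_ge0.
exists (4 * `|C|) => x; rewrite normrM expr1.
apply: (@le_trans _ _ (`|x| * (`|C| * (1 + x ^+ n.*2)))).
  by rewrite ler_wpM2l// (le_trans (fC x))// ler_wpM2r ?ler_norm// addr_ge0.
rewrite mulrCA [4 * _]mulrC -!mulrA ler_wpM2l// doubleS !exprS.
have : `|x| <= 1 + x ^+ 2 by rewrite -(real_normK (num_real x)); nra.
move=> h; apply: (@le_trans _ _ ((1 + x ^+ 2) * (1 + x ^+ n.*2))).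
  by rewrite ler_wpM2r// addr_ge0.
rewrite mulrA -expr2 mulrDl mul1r mulrDr mulr1.
suff : x ^+ 2 <= 1 + x ^+ 2 * x ^+ n.*2 /\ x ^+ n.*2 <= 1 + x ^+ 2 * x ^+ n.*2.
  by have := mulr_ge0 (sqr_ge0 x) (pos x); lra.
have p := pos x.
have [h1|h1] := leP (x ^+ 2) 1.
  have p1 : x ^+ n.*2 <= 1 by rewrite -mul2n exprM exprn_ile1// sqr_ge0.
  have := mulr_ge0 (sqr_ge0 x) (pos x); lra.
have p1 : 1 <= x ^+ n.*2 by rewrite -mul2n exprM exprn_ege1// ltW.
have := sqr_ge0 x; split; nra.
Qed.

(** Integration by parts against [p' = - (x - m) p / s^2]: [F = - s^2 f p] is a primitive of [G],
    the difference of the two integrands. The integral of [G] over [I n] is a boundary term tending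
    to 0, and by dominated convergence it also tends to the integral over the line. *)
Lemma normal_stein (m s : R) (f df : R -> R) : s != 0 ->
  (forall x : R, is_derive x 1 f (df x)) -> continuous df ->
  even_growth 2 f -> even_growth 2 df ->
  \int[normal_prob m s]_x ((x - m) * f x) =
  s ^+ 2 * \int[normal_prob m s]_x (df x).
Proof.
move=> s0 fdf cdf gf gdf.
have s20 : s ^+ 2 != 0 by rewrite expf_neq0.
have cf : continuous f.
  by move=> x; apply: differentiable_continuous; apply/derivable1_diffP; have [] := fdf x.
have mf : measurable_fun [set: R] f by exact: continuous_measurable_fun.
have mdf : measurable_fun [set: R] df by exact: continuous_measurable_fun.
have mXf : measurable_fun [set: R] (fun x => (x - m) * f x).
  by apply: measurable_funM => //; exact: measurable_funB.
have gXf : even_growth 3 (fun x => (x - m) * f x).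
  have [C1 h1] := even_growthX gf (leqnn 1).
  have [C2 h2] := even_growthX gf (leq0n 1).
  exists (C1 + `|m| * C2) => x.
  have -> : (x - m) * f x = x ^+ 1 * f x - m * (x ^+ 0 * f x) by ring.
  apply: (le_trans (ler_normB _ _)); rewrite mulrDl lerD// normrM -mulrA.
  by rewrite ler_wpM2l.
have gdf3 : even_growth 3 df by exact: even_growth_trans gdf.
have iXf := integrable_normal_pdf_growth m s0 mXf gXf.
have idf := integrable_normal_pdf_growth m s0 mdf gdf3.
pose p := normal_pdf m s.
pose G x := (x - m) * f x * p x - s ^+ 2 * (df x * p x).
pose F x := - s ^+ 2 * (f x * p x).
have dp (x : R) : is_derive x 1 p (- (x - m) / s ^+ 2 * p x).
  have -> : p = fun x => normal_peak s * expR ((- (2 * s ^+ 2)^-1) * (x - m) ^+ 2).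
    apply/funext => y; rewrite /p normal_pdfE_fun// /normal_fun; congr (_ * expR _).
    by rewrite -mulr_natr; field.
  apply: is_derive_eq; rewrite /GRing.scale/=.
  by field.
have FG (x : R) : is_derive x 1 F (G x).
  apply: is_derive_eq; rewrite /GRing.scale/= /G.
  by field.
have cp : continuous p by exact: continuous_normal_pdf.
have cG : continuous G.
  move=> x; apply: cvgB; apply: cvgM.
  - apply: cvgM; last exact: cf.
    by apply: cvgB; [exact: cvg_id|exact: cvg_cst].
  - exact: cp.
  - exact: cvg_cst.
  - by apply: cvgM; [exact: cdf|exact: cp].
have iZdf : mu.-integrable [set: R] (fun x => (s ^+ 2 * (df x * p x))%:E).
  by under eq_fun do rewrite EFinM; exact: integrableZl.
have mG : measurable_fun [set: R] G by exact: continuous_measurable_fun.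
have iG : mu.-integrable [set: R] (fun x => (G x)%:E).
  by under eq_fun do rewrite EFinB; exact: integrableB.
pose I n : set R := (`[- n.+1%:R, n.+1%:R])%classic.
have intI n : (\int[mu]_x ((EFin \o G) \_ (I n)) x)%E = (F n.+1%:R - F (- n.+1%:R))%:E.
  rewrite -integral_mkcond (@continuous_FTC2 _ G F)//.
  - by rewrite gtrN.
  - exact: continuous_subspaceT.
  - have cF : continuous F.
      move=> x; apply: differentiable_continuous.
      by apply/derivable1_diffP; have [] := FG x.
    split.
    + by move=> x _; have [] := FG x.
    + exact/cvg_at_right_filter/cF.
    + exact/cvg_at_left_filter/cF.
  - by move=> x _; rewrite derive1E; have [] := FG x.
have cI : (\int[mu]_x ((EFin \o G) \_ (I n)) x)%E @[n --> \oo] --> (\int[mu]_x (G x)%:E)%E.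
  have mI n : measurable (I n : set (measurableTypeR R)) by exact: measurable_itv.
  have := @dominated_convergence _ _ _ mu _ measurableT
    (fun n => (EFin \o G) \_ (I n)) (EFin \o G) (abse \o (EFin \o G)).
  case => //.
  - move=> n; apply/(measurable_restrictT _ _).1 => //.
    by apply: measurable_funTS; exact/measurable_EFinP.
  - exact/measurable_EFinP.
  - apply: aeW => x _; apply: cvg_near_cst; near=> n.
    rewrite patchE ifT//; apply/mem_set; rewrite /I/= in_itv/= -ler_norml.
    have : `|x| <= n%:R by near: n; exact: nbhs_infty_ger.
    by move=> h; rewrite (le_trans h)// ler_nat.
  - exact: integrable_abse.
  - apply: aeW => x n _; rewrite patchE; case: ifP => //= _.
    by rewrite normr0 lee_fin.
have c0 : (\int[mu]_x ((EFin \o G) \_ (I n)) x)%E @[n --> \oo] --> 0%E.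
  under eq_fun do rewrite intI.
  apply: cvg_EFin; first exact: nearW.
  rewrite (_ : 0 = - s ^+ 2 * 0 - - s ^+ 2 * 0); last by ring.
  apply: cvgB; apply: cvgMr; apply: growth_normal_pdf_cvg0 => // k.
    by rewrite ger0_norm.
  by rewrite normrN ger0_norm.
have int0 : (\int[mu]_x (G x)%:E)%E = 0%E.
  exact: (@cvg_unique _ (@ereal_hausdorff R) _ _ _ _ cI c0).
have {}int0 : \int[mu]_x G x = 0 by rewrite /Rintegral int0.
move: int0; rewrite RintegralB//.
rewrite RintegralZl// => /eqP; rewrite subr_eq0 => /eqP h.
rewrite /Rintegral !integral_normal_prob.
- exact: h.
- by apply: integrable_normal_prob_growth.
- by apply: integrable_normal_prob_growth.
Unshelve. all: by end_near. Qed.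

End stein_lemma.

Section gaussian_stein.
Context d (T : measurableType d) (R : realType) (P : probability T R).

Lemma Rintegral_cst_prob (c : R) : \int[P]_w c = c.
Proof.
by rewrite Rintegral_cst//= probability_setT mulr1.
Qed.

(* A random variable behaving under polynomial integrands like N(0, v). *)
Definition stein_variable (Y : T -> R) (v : R) :=
  [/\ measurable_fun [set: T] Y,
      forall f : R -> R, measurable_fun [set: R] f -> even_growth 3 f ->
        P.-integrable [set: T] (fun w => (f (Y w))%:E)
    & forall f df : R -> R, (forall x : R, is_derive x 1 f (df x)) ->
        continuous df -> even_growth 2 f -> even_growth 2 df ->
        \int[P]_w (Y w * f (Y w)) = v * \int[P]_w df (Y w)].

Lemma integrable_law (mu : {measure set (measurableTypeR R) -> \bar R}) (Y : T -> R)
    (f : R -> R) :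
  measurable_fun [set: T] Y -> measurable_fun [set: R] f ->
  (forall A : set R, measurable A -> P (Y @^-1` A) = mu A) ->
  mu.-integrable [set: R] (EFin \o f) ->
  P.-integrable [set: T] (fun w => (f (Y w))%:E) /\
  \int[P]_w f (Y w) = \int[mu]_x f x.
Proof.
move=> mY mf law fi.
have mY1 : measurable_fun [set: T] (Y : T -> measurableTypeR R) by exact: mY.
pose Y' : {mfun T >-> measurableTypeR R} := @mfun_Sub _ _ T (measurableTypeR R) Y (mem_set mY1).
have EY : forall A : set (measurableTypeR R), measurable A -> A `<=` setT -> distribution P Y' A = mu A.
  by move=> A mA _; rewrite -law.
have mf' : measurable_fun [set: measurableTypeR R] (EFin \o f) by exact/measurable_EFinP.
have i1 : P.-integrable [set: T] (fun w => (f (Y w))%:E).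
  apply/integrableP; split.
    by apply/measurable_EFinP; exact: measurableT_comp.
  have mabs : measurable_fun [set: measurableTypeR R] (abse \o (EFin \o f)) by exact: measurableT_comp.
  rewrite -(ge0_integral_distribution Y' mabs (fun y => abse_ge0 _)).
  by rewrite (eq_measure_integral _ EY); have /integrableP[] := fi.
split => //.
rewrite /Rintegral -(eq_measure_integral _ EY); congr fine.
by rewrite (@integral_distribution _ _ _ _ _ P Y' (EFin \o f)).
Qed.

(** [gaussian_variable] only provides some [m] and [s], and Stein's identity itself identifies them:
    [f = 1] forces [m = 0] and [f = id] gives [s^2 = E Y^2]. For [s = 0] the law is a Dirac mass, at
    0 because of the mean, and both sides vanish. *)
Lemma gaussian_stein (Y : T -> R) : measurable_fun [set: T] Y ->
  gaussian_variable P Y -> \int[P]_w Y w = 0 ->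
  stein_variable Y (\int[P]_w Y w ^+ 2).
Proof.
move=> mY [m [s [s0 law]]] EY; rewrite /gaussian_law in law.
have gX1 : even_growth 2 (fun=> 1 : R).
  by exists 1 => x; rewrite mul1r normr1 lerDl exprn_even_ge0.
have gX : even_growth 2 (@id R).
  apply: (@even_growth_trans _ 1) => //; exists 1 => x.
  by rewrite mul1r -(real_normK (num_real x)); have := normr_ge0 x; nra.
have [s00|s_neq0] := eqVneq s 0.
  rewrite s00 eqxx in law.
  have fint (f : R -> R) : measurable_fun [set: R] f ->
      P.-integrable [set: T] (fun w => (f (Y w))%:E) /\ \int[P]_w f (Y w) = f m.
    move=> mf; have mEf : measurable_fun [set: measurableTypeR R] (EFin \o f) by exact/measurable_EFinP.
    have := @integrable_law (\d_(m : measurableTypeR R)) Y f mY mf law; case.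
      apply/integrableP; split => //.
      have mabs : measurable_fun [set: measurableTypeR R] (abse \o (EFin \o f)) by exact: measurableT_comp.
      by rewrite (integral_dirac _ measurableT mabs)/= diracT mul1e ltry.
    move=> i1 ->; split => //.
    by rewrite /Rintegral (integral_dirac _ measurableT mEf) diracT mul1e.
  have m0 : m = 0 by rewrite -EY; have [_ ->] := fint id (@measurable_id _ _ _).
  split => // [f mf _|f df fdf _ _ _]; first by have [] := fint f mf.
  have mf : measurable_fun [set: R] f.
    apply: continuous_measurable_fun => x; apply: differentiable_continuous.
    by apply/derivable1_diffP; have [] := fdf x.
  have [_ ->] := fint (fun x => x * f x) (measurable_funM (@measurable_id _ _ _) mf).
  have [_ ->] := fint (fun x => x ^+ 2) (measurable_funX 2 (@measurable_id _ _ _)).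
  by rewrite m0 expr0n !mul0r.
rewrite (negbTE s_neq0) in law.
have fint (f : R -> R) : measurable_fun [set: R] f -> even_growth 3 f ->
    P.-integrable [set: T] (fun w => (f (Y w))%:E) /\
    \int[P]_w f (Y w) = \int[normal_prob m s]_x f x.
  move=> mf gf; apply: (@integrable_law (normal_prob m s) Y f) => //.
  exact: integrable_normal_prob_growth.
have m0 : m = 0.
  have := @normal_stein _ m s (fun=> 1) (fun=> 0) s_neq0 _ _ gX1 _.
  rewrite Rintegral_cst// mul0r mulr0; under eq_Rintegral do rewrite mulr1.
  rewrite -(fint (fun x => x - m) _ _).2; last 2 first.
  - exact: measurable_funB.
  - apply: (@even_growth_trans _ 2) => //.
    have [C hC] := gX; exists (C + `|m|) => x.
    rewrite (le_trans (ler_normB _ _))// mulrDl lerD// ler_peMr//.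
    by rewrite lerDl exprn_even_ge0.
  rewrite RintegralB//; last 2 first.
  - by apply: (fint id _ _).1 => //; exact: even_growth_trans gX.
  - exact: finite_measure_integrable_cst.
  rewrite EY Rintegral_cst_prob sub0r => h.
  apply/eqP; rewrite -oppr_eq0; apply/eqP; apply: h.
  - by move=> x; exact: cvg_cst.
  - by exists 0 => x; rewrite normr0 mul0r.
have stein f df : (forall x : R, is_derive x 1 f (df x)) ->
    continuous df -> even_growth 2 f -> even_growth 2 df ->
    \int[P]_w (Y w * f (Y w)) = s ^+ 2 * \int[P]_w df (Y w).
  move=> fdf cdf gf gdf.
  have mf : measurable_fun [set: R] f.
    apply: continuous_measurable_fun => x; apply: differentiable_continuous.
    by apply/derivable1_diffP; have [] := fdf x.
  have mdf : measurable_fun [set: R] df by exact: continuous_measurable_fun.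
  rewrite (fint df mdf _).2 ?(fint (fun x => x * f x) _ _).2.
  - by rewrite -(normal_stein m s_neq0 fdf cdf gf gdf) m0; under [RHS]eq_Rintegral do rewrite subr0.
  - exact: measurable_funM.
  - by have := even_growthX gf (leqnn 1); under eq_fun do rewrite expr1.
  - exact: even_growth_trans gdf.
split => // [f mf gf|f df fdf cdf gf gdf]; first exact: (fint f mf gf).1.
rewrite (stein f df)//; congr (_ * _).
transitivity (\int[P]_w (Y w * id (Y w))); last first.
  by apply: eq_Rintegral => w _; rewrite expr2.
rewrite (stein id (fun=> 1))//.
- by rewrite Rintegral_cst_prob !mulr1.
- by move=> x; exact: cvg_cst.
Qed.

End gaussian_stein.

Section gaussian_cosine.
Context d (T : measurableType d) (R : realType) (P : probability T R).

Lemma bounded_even_growth n (f : R -> R) (C : R) :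
  (forall x, `|f x| <= C) -> even_growth n f.
Proof.
move=> fC; exists C => x; rewrite (le_trans (fC x))// ler_peMr//.
  by rewrite (le_trans _ (fC 0)).
by rewrite lerDl -mul2n exprM exprn_ge0// sqr_ge0.
Qed.

(* The left-hand side, as a function c(u) of a dilation u of Y, solves
   c'(u) = - v u c(u). *)
Lemma stein_cos (Y : T -> R) (v b : R) : stein_variable P Y v ->
  \int[P]_w cos (Y w + b) = expR (- (v / 2)) * cos b.
Proof.
move=> [mY iY sY].
pose c u := \int[P]_w cos (u * Y w + b).
have i1 u : P.-integrable [set: T] (fun w => (cos (u * Y w + b))%:E).
  apply: (iY (fun x => cos (u * x + b))).
    apply: measurableT_comp; first exact: continuous_measurable_fun (@continuous_cos R).
    by apply: measurable_funD => //; exact: measurable_funM.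
  by apply: (@bounded_even_growth _ _ 1) => x; rewrite ler_norml cos_geN1 cos_le1.
have di (u : R) : is_derive u 1 c (- v * u * c u).
  have df w (x : R) : is_derive x 1 (fun x => cos (x * Y w + b)) (- sin (x * Y w + b) * Y w).
    by apply: is_derive_eq; rewrite /GRing.scale/=; ring.
  have Iu : (`]u - 1, u + 1[)%classic u by rewrite /= in_itv/= gtrBl ltrDl ltr01.
  have cond1 (x : R) : (`]u - 1, u + 1[)%classic x ->
      P.-integrable [set: T] (EFin \o (fun w => cos (x * Y w + b))) by move=> _; exact: i1.
  have cond2 (x : R) w : (`]u - 1, u + 1[)%classic x -> [set: T] w ->
      derivable (fun x : R => cos (x * Y w + b)) x 1.
    by move=> _ _; have [] := df w x.
  have p1E (x : R) w : partial1of2 (fun (x : R) w => cos (x * Y w + b)) x w = - sin (x * Y w + b) * Y w.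
    by rewrite /partial1of2 derive1E; have [] := df w x.
  have iG : P.-integrable [set: T] (EFin \o (fun w => `|Y w|)).
    apply: (iY (fun x => `|x|)) => //; apply: (@even_growth_trans _ 1) => //.
    by exists 1 => x; rewrite mul1r normr_id -(real_normK (num_real x)); have := normr_ge0 x; nra.
  have cond3 (x : R) w : (`]u - 1, u + 1[)%classic x -> [set: T] w ->
      `|partial1of2 (fun (x : R) w => cos (x * Y w + b)) x w| <= `|Y w|.
    move=> _ _; rewrite p1E normrM normrN ler_piMl//.
    by rewrite ler_norml sin_geN1 sin_le1.
  have D := derivable_under_integral measurableT Iu cond1 cond2 (fun w => normr_ge0 (Y w)) iG cond3.
  have E := differentiation_under_integral measurableT Iu cond1 cond2 (fun w => normr_ge0 (Y w)) iG cond3.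
  apply: DeriveDef; first exact: D.
  rewrite -derive1E E.
  have bnd k (g : R -> R) : (forall x, `|g x| <= 1) -> even_growth 2 (fun x => k * g (u * x + b)).
    move=> g1; apply: (@bounded_even_growth _ _ `|k|) => x.
    by rewrite normrM ler_piMr.
  have := sY (fun x => - 1 * sin (u * x + b)) (fun x => - u * cos (u * x + b)).
  rewrite RintegralZl //; last exact: i1.
  move=> sY'.
  have d1 (x : R) : is_derive x 1 (fun x => - 1 * sin (u * x + b)) (- u * cos (u * x + b)).
    by apply: is_derive_eq; rewrite /GRing.scale/=; ring.
  transitivity (v * (- u * \int[P]_w cos (u * Y w + b))).
    rewrite -(sY' d1).
    - by apply: eq_Rintegral => w _; rewrite p1E; ring.
    - move=> x; apply: cvgM; first exact: cvg_cst.
      apply: (@continuous_comp _ _ _ (fun x => u * x + b) cos); last exact: continuous_cos.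
      by apply: cvgD; [apply: cvgM; [exact: cvg_cst|exact: cvg_id]|exact: cvg_cst].
    - by apply: bnd => x; rewrite ler_norml sin_geN1 sin_le1.
    - by apply: bnd => x; rewrite ler_norml cos_geN1 cos_le1.
  by rewrite -/(c u); ring.
(* The exponential is the integrating factor of the equation satisfied by [c]; the constant [h] is
   then read at 1 and at 0. *)
pose h u := c u * expR (v / 2 * u ^+ 2).
have dh (u : R) : is_derive u 1 h 0.
  by apply: is_derive_eq; rewrite /GRing.scale/=; field.
have := is_derive_0_is_cst 1 0 dh.
rewrite /h expr1n mulr1 expr0n/= mulr0 expR0 mulr1.
have -> : c 1 = \int[P]_w cos (Y w + b) by apply: eq_Rintegral => w _; rewrite mul1r.
have -> : c 0 = cos b.
  by rewrite /c; under eq_Rintegral do rewrite mul0r add0r; rewrite Rintegral_cst_prob.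
move=> <-; rewrite expRN mulrC -mulrA mulfV ?mulr1//.
by rewrite gt_eqF ?expR_gt0.
Qed.

End gaussian_cosine.

(** * Functions with bounded second derivatives *)

Lemma cvg_sumr (R : realType) (T I : Type) (F : set_system T) (FF : Filter F)
    (s : seq I) (u : I -> T -> R) (l : I -> R) :
  (forall i, u i @ F --> l i) ->
  (fun x => \sum_(i <- s) u i x) @ F --> \sum_(i <- s) l i.
Proof.
move=> ul; elim: s => [|i s IH].
  by rewrite big_nil; under eq_fun do rewrite big_nil; exact: cvg_cst.
rewrite big_cons; under eq_fun do rewrite big_cons.
by apply: cvgD; [exact: ul|exact: IH].
Qed.

Section C1_calculus.
Context (R : realType) (d : nat).
Implicit Types (f : 'rV[R]_d -> R) (x y a : 'rV[R]_d).

Lemma is_derive_line f (i : 'I_d) y (s : R) :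
  (forall x, derivable f x (delta_mx ord0 i)) ->
  is_derive s 1 (fun s : R => f (y + s *: delta_mx ord0 i))
    (partial i f (y + s *: delta_mx ord0 i)).
Proof.
move=> df; have := df (y + s *: delta_mx ord0 i).
have E : (fun h : R => h^-1 *: (((fun s : R => f (y + s *: delta_mx ord0 i)) \o shift s) (h *: 1) -
    f (y + s *: delta_mx ord0 i))) =
  (fun h : R => h^-1 *: ((f \o shift (y + s *: delta_mx ord0 i)) (h *: delta_mx ord0 i) -
    f (y + s *: delta_mx ord0 i))).
  apply/funext => h /=; congr (_ *: (f _ - _)).
  by rewrite [h *: 1]mulr1 scalerDl addrCA addrA.
rewrite /derivable -E => D; apply: DeriveDef; first exact: D.
by rewrite /partial /derive E.
Qed.

Lemma mean_value_coord f (i : 'I_d) y (t : R) :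
  (forall x, derivable f x (delta_mx ord0 i)) ->
  exists2 xi : R, `|xi| <= `|t| &
    f (y + t *: delta_mx ord0 i) - f y =
    partial i f (y + xi *: delta_mx ord0 i) * t.
Proof.
move=> df; pose g s := f (y + s *: delta_mx ord0 i).
have dg (s : R) : is_derive s 1 g (partial i f (y + s *: delta_mx ord0 i)).
  exact: is_derive_line.
have cg (A : set R) : {within A, continuous g}.
  apply: continuous_subspaceT => s; apply: differentiable_continuous.
  by apply/derivable1_diffP; have [] := dg s.
have g0 : g 0 = f y by rewrite /g scale0r addr0.
have [t0|t0] := leP 0 t.
  have [xi] := MVT_segment t0 (fun s _ => dg s) (cg _).
  rewrite in_itv/= => /andP[x0 xt] E; exists xi; first by rewrite !ger0_norm.
  by rewrite -g0 -/(g t) E subr0.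
have [xi] := MVT_segment (ltW t0) (fun s _ => dg s) (cg _).
rewrite in_itv/= => /andP[xt x0] E; exists xi.
  by rewrite (ler0_norm x0) (ler0_norm (ltW t0)) lerN2.
by rewrite -g0 -/(g t) -[LHS]opprB E sub0r mulrN opprK.
Qed.

(** [C1] speaks only of derivatives along the axes, so total differentiability has to be built. The
    way from [a] to [y] is cut into edges parallel to the axes ([p j] has the first [j] coordinates
    of [y]), with the mean value theorem on each edge and continuity of the partial derivatives at
    [a]. *)
Lemma C1_differentiable f a (e : R) : C1 f -> 0 < e ->
  exists2 del : R, 0 < del & forall y, (forall i, `|y ord0 i - a ord0 i| < del) ->
    `|f y - f a - \sum_i partial i f a * (y ord0 i - a ord0 i)| <=
    e * \sum_i `|y ord0 i - a ord0 i|.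
Proof.
move=> [cf df] e0.
have : \forall y \near a, forall i : 'I_d, `|partial i f a - partial i f y| <= e.
  apply: (@filter_forall _ _ (fun i y => `|partial i f a - partial i f y| <= e) (nbhs a) (@nbhs_filter _ a)) => i.
  have := (df i).2 a.
  by move/cvgrPdist_le; exact.
move=> /nbhs_ballP[del /= del0 hdel]; exists del => // y ya.
pose p j : 'rV[R]_d := \row_i (if (i < j)%N then y ord0 i else a ord0 i).
have pS (j : 'I_d) : p j.+1 = p j + (y ord0 j - a ord0 j) *: delta_mx ord0 j.
  apply/rowP => i; rewrite !mxE eqxx/=.
  have [->|ij] := eqVneq i j; first by rewrite ltnSn ltnn mulr1 subrKC.
  by rewrite mulr0 addr0 ltnS leq_eqVlt (_ : (i == j :> nat) = false)//; exact/negbTE.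
have E : f y - f a = \sum_(j < d) (f (p j.+1) - f (p j)).
  rewrite -(big_mkord xpredT (fun j => f (p j.+1) - f (p j))) telescope_sumr//.
  congr (f _ - f _); apply/rowP => i; rewrite !mxE ?ltn_ord//.
rewrite E -sumrB big_distrr/=; apply: (le_trans (ler_norm_sum _ _ _)).
apply: ler_sum => j _; rewrite pS.
have [xi xit ->] := mean_value_coord (p j) (y ord0 j - a ord0 j) (df j).1.
rewrite -mulrBl normrM ler_wpM2r// distrC; apply: hdel.
split => // i k; rewrite ord1 /ball/= !mxE eqxx/=.
have [->|kj] := eqVneq k j.
  rewrite ltnn mulr1 opprD addNKr normrN.
  exact: le_lt_trans xit (ya j).
rewrite mulr0 addr0; case: ifP => _; first by rewrite distrC ya.
by rewrite subrr normr0.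
Qed.

(** The remainder of [C1_differentiable] is at most [ek] times the sum of the increments of the
    coordinates of [g]. Near [x] their quotients [q i h] stay below [|dg i| + 1], so at most [ek K]
    remains after division by [h]. *)
Lemma is_derive_C1 f (g : R -> 'rV[R]_d) (dg : 'I_d -> R) (x : R) : C1 f ->
  (forall i, is_derive x 1 (fun s => g s ord0 i) (dg i)) ->
  is_derive x 1 (fun s => f (g s)) (\sum_i partial i f (g x) * dg i).
Proof.
move=> f1 hg; set L := \sum_i _.
have quot (u : R -> R) (l : R) : is_derive x 1 u l ->
    (fun h => h^-1 * (u (h + x) - u x)) @ 0^' --> l.
  move=> [du <-]; rewrite /derive; move: du.
  rewrite /derivable /cvg_to.
  have -> : (fun h : R => h^-1 *: ((u \o shift x) (h *: 1) - u x)) =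
    (fun h : R => h^-1 * (u (h + x) - u x)).
    by apply/funext => h /=; rewrite /GRing.scale/= mulr1.
  by [].
suff lim : (fun h => h^-1 * (f (g (h + x)) - f (g x))) @ 0^' --> L.
  have E : (fun h : R => h^-1 *: (((fun s => f (g s)) \o shift x) (h *: 1) - f (g x))) =
      (fun h => h^-1 * (f (g (h + x)) - f (g x))).
    by apply/funext => h /=; rewrite /GRing.scale/= mulr1.
  apply: DeriveDef; first by rewrite /derivable E; apply/cvg_ex; exists L.
  by rewrite /derive E; exact/cvg_lim.
pose q i h := h^-1 * (g (h + x) ord0 i - g x ord0 i).
have hq i : q i @ 0^' --> dg i by exact: quot.
pose K := \sum_i (`|dg i| + 1).
have K0 : 0 <= K by apply: sumr_ge0 => i _; rewrite addr_ge0.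
have lin : (fun h => \sum_i partial i f (g x) * q i h) @ 0^' --> L.
  by apply: cvg_sumr => i; apply: cvgMr; exact: hq.
apply/cvgrPdist_le => e e0.
have e2 : 0 < e / 2 by rewrite divr_gt0.
(* [K] vanishes when [d = 0], hence the division by [K + 1]. *)
have ek : 0 < e / 2 / (K + 1) by rewrite divr_gt0// ltr_wpDl.
have [del del0 hdel] := C1_differentiable (g x) f1 ek.
have cg i : (fun h => g (h + x) ord0 i) @ 0^' --> g x ord0 i.
  have ci : {for x, continuous (fun s => g s ord0 i)}.
    by apply: differentiable_continuous; apply/derivable1_diffP; have [] := hg i.
  apply: cvg_within_filter.
  apply: (@cvg_comp _ _ _ (fun h : R => h + x) (fun s => g s ord0 i) _ (nbhs x)); last exact: ci.
  have : (fun h : R => h + x) @ (0 : R) --> 0 + x by apply: cvgD; [exact: cvg_id|exact: cvg_cst].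
  by rewrite add0r.
near=> h.
have h0 : h != 0 by near: h; exact: nbhs_dnbhs_neq.
have near1 : forall i, `|g (h + x) ord0 i - g x ord0 i| < del.
  near: h; apply: (@filter_forall _ _ (fun i h => `|g (h + x) ord0 i - g x ord0 i| < del)) => i; have := cg i.
  by move/cvgrPdist_lt => /(_ _ del0); apply: filterS => h; rewrite distrC.
have near2 : forall i, `|q i h| <= `|dg i| + 1.
  near: h; apply: (@filter_forall _ _ (fun i h => `|q i h| <= `|dg i| + 1)) => i; have := hq i.
  move/cvgrPdist_le => /(_ _ ltr01); apply: filterS => h hh.
  rewrite -[q i h](subrK (dg i)); apply: (le_trans (ler_normD _ _)).
  by rewrite addrC lerD2l distrC.
have near3 : `|L - \sum_i partial i f (g x) * q i h| <= e / 2.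
  by near: h; move/cvgrPdist_le : lin; exact.
have := hdel _ near1; set S := \sum_i _ * (_ - _) => hS.
have E : \sum_i partial i f (g x) * q i h = h^-1 * S.
  by rewrite /S big_distrr/=; apply: eq_bigr => i _; rewrite /q mulrCA.
have -> : L - h^-1 * (f (g (h + x)) - f (g x)) =
    (L - \sum_i partial i f (g x) * q i h) - h^-1 * (f (g (h + x)) - f (g x) - S).
  by rewrite E; ring.
apply: (le_trans (ler_normB _ _)); rewrite [leRHS](splitr e) lerD//.
rewrite normrM; apply: (@le_trans _ _ (`|h^-1| * (e / 2 / (K + 1) * \sum_i `|g (h + x) ord0 i - g x ord0 i|))).
  by rewrite ler_wpM2l.
rewrite mulrCA big_distrr/=.
have -> : \sum_i `|h^-1| * `|g (h + x) ord0 i - g x ord0 i| = \sum_i `|q i h|.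
  by apply: eq_bigr => i _; rewrite -normrM.
apply: (@le_trans _ _ (e / 2 / (K + 1) * K)).
  by rewrite ler_wpM2l ?(ltW ek)//; apply: ler_sum => i _.
by rewrite mulrAC ler_pdivrMr ?ltr_wpDl// ler_wpM2l ?(ltW e2)// lerDl.
Unshelve. all: by end_near. Qed.

End C1_calculus.

Section C2_growth.
Context (R : realType) (d : nat).
Implicit Types (f : 'rV[R]_d -> R) (x y a : 'rV[R]_d).

Lemma mean_value_segment f x y : C1 f -> exists2 s : R, 0 <= s <= 1 &
  f x - f y = \sum_i partial i f (y + s *: (x - y)) * (x ord0 i - y ord0 i).
Proof.
move=> f1; pose g (s : R) := y + s *: (x - y).
have dg (s : R) : is_derive s 1 (fun s => f (g s))
    (\sum_i partial i f (g s) * (x ord0 i - y ord0 i)).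
  apply: is_derive_C1 => // i.
  rewrite (_ : (fun s => _) = fun s : R => y ord0 i + s * (x ord0 i - y ord0 i)).
    by apply: is_derive_eq; rewrite /GRing.scale/=; ring.
  by apply/funext => u; rewrite !mxE.
have cg (A : set R) : {within A, continuous (fun s => f (g s))}.
  apply: continuous_subspaceT => s; apply: differentiable_continuous.
  by apply/derivable1_diffP; have [] := dg s.
have [s s01 E] := MVT_segment ler01 (fun s _ => dg s) (cg _).
exists s; first by move: s01; rewrite in_itv.
move: E; rewrite /g scale1r scale0r addr0 subr0 mulr1 => <-.
by rewrite [y + _]addrC subrK.
Qed.

Lemma C1_lipschitz f (K : R) x y : C1 f -> (forall i z, `|partial i f z| <= K) ->
  `|f x - f y| <= K * \sum_i `|x ord0 i - y ord0 i|.
Proof.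
move=> f1 fK; have [s _ ->] := mean_value_segment x y f1.
rewrite big_distrr/=; apply: (le_trans (ler_norm_sum _ _ _)); apply: ler_sum => i _.
by rewrite normrM ler_wpM2r.
Qed.

Lemma hessian_norm_le1 f i j z : (hessian_norm f <= 1)%E ->
  `|partial i (partial j f) z| <= 1.
Proof.
move=> h; rewrite -lee_fin; apply: le_trans h; rewrite /hessian_norm.
apply: le_trans (le_bigmax _ _ i); apply: le_trans (le_bigmax _ _ j).
by apply: ereal_sup_ubound; exists z.
Qed.

(** Bounded second derivatives make the partial derivatives 1-Lipschitz for the l1 norm, hence of
    linear growth, and [f] of quadratic growth by the mean value theorem. Second moments of the
    argument then control [f] and the product of its gradient with a coordinate. *)
Lemma C2_growth f : C2 f -> (hessian_norm f <= 1)%E ->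
  exists2 C : R, 0 <= C & forall x,
    (forall i, `|partial i f x| <= C + \sum_k `|x ord0 k|) /\
    `|f x| <= C * (1 + (\sum_k `|x ord0 k|) ^+ 2).
Proof.
move=> [f1 f2] h; pose m := \sum_i `|partial i f 0|.
have m0 : 0 <= m by apply: sumr_ge0.
have pf x i : `|partial i f x| <= m + \sum_k `|x ord0 k|.
  have L := @C1_lipschitz (partial i f) 1 x 0 (f2 i) (fun j z => hessian_norm_le1 j i z h).
  rewrite -[partial i f x](subrK (partial i f 0)) (le_trans (ler_normD _ _))// addrC.
  apply: lerD; first by rewrite /m (bigD1 i)//= lerDl sumr_ge0.
  apply: (le_trans L); rewrite mul1r; apply: ler_sum => k _; by rewrite mxE subr0.
exists (`|f 0| + m + 1); first by rewrite addr_ge0// addr_ge0.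
move=> x; split => [i|].
  apply: (le_trans (pf x i)); rewrite lerD2r.
  have := normr_ge0 (f 0); lra.
set S := \sum_k _; have S0 : 0 <= S by apply: sumr_ge0.
have [s /andP[s0 s1] E] := mean_value_segment x 0 f1.
have fx : `|f x - f 0| <= (m + S) * S.
  rewrite E big_distrr/=; apply: (le_trans (ler_norm_sum _ _ _)); apply: ler_sum => i _.
  rewrite normrM; have -> : x ord0 i - (0 : 'rV[R]_d) ord0 i = x ord0 i by rewrite mxE subr0.
  apply: ler_wpM2r => //.
  apply: (le_trans (pf _ i)); rewrite lerD2l; apply: ler_sum => k _.
  by rewrite !mxE add0r subr0 normrM ger0_norm// ler_piMl.
have : `|f x| <= `|f x - f 0| + `|f 0|.
  by rewrite -[X in `|X| <= _](subrK (f 0)) ler_normD.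
have mS : m * S <= m * (1 + S ^+ 2) by rewrite ler_wpM2l//; nra.
have fS : 0 <= `|f 0| * S ^+ 2 by rewrite mulr_ge0// sqr_ge0.
lra.
Qed.

(** Cauchy-Schwarz, from [u k u l <= (u k^2 + u l^2) / 2] summed over all pairs. *)
Lemma sqr_sum_le (n : nat) (u : 'I_n -> R) :
  (\sum_k u k) ^+ 2 <= n%:R * \sum_k u k ^+ 2.
Proof.
have -> : n%:R * \sum_k u k ^+ 2 = \sum_(k < n) \sum_(l < n) (u k ^+ 2 + u l ^+ 2) / 2.
  under [RHS]eq_bigr do rewrite -mulr_suml big_split/= sumr_const card_ord.
  rewrite -mulr_suml big_split/= sumr_const card_ord sumrMnl -mulr_natl.
  by field.
rewrite expr2 big_distrl/=; apply: ler_sum => k _; rewrite big_distrr/=.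
by apply: ler_sum => l _; have := sqr_ge0 (u k - u l); nra.
Qed.

End C2_growth.

(** Only the coordinates of [Y] are known to be measurable. Rounding them down to multiples of
    [1 / (n + 1)] gives a function with countably many values, each taken on a measurable event, and
    continuity of [f] carries measurability to the limit. *)
Lemma measurable_comp_continuous (R : realType) (d : nat) disp (T : measurableType disp)
    (f : 'rV[R]_d -> R) (Y : T -> 'rV[R]_d) : continuous f ->
  (forall i, measurable_fun [set: T] (fun w => Y w ord0 i)) ->
  measurable_fun [set: T] (fun w => f (Y w)).
Proof.
move=> cf mY.
pose q n w : 'rV[int]_d := \row_i Num.floor (n.+1%:R * Y w ord0 i).
pose g n (z : 'rV[int]_d) : 'rV[R]_d := \row_i ((z ord0 i)%:~R / n.+1%:R).
apply: (@measurable_fun_cvg _ _ _ _ (fun n w => f (g n (q n w)))).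
- move=> n _ B mB; rewrite setTI.
  have mq z : measurable [set w | q n w = z].
    rewrite (_ : [set _ | _] = \bigcap_(i in [set: 'I_d])
        ((fun w => Num.floor (n.+1%:R * Y w ord0 i)) @^-1` [set z ord0 i])).
      apply: fin_bigcap_measurable => // i _.
      rewrite (_ : _ @^-1` _ = (fun w => n.+1%:R * Y w ord0 i) @^-1`
          `[(z ord0 i)%:~R, (z ord0 i + 1)%:~R[).
        rewrite -[_ @^-1` _]setTI; apply: measurable_funM => //.
      apply/seteqP; split => w /=; rewrite in_itv/=.
        by move=> <-; exact: floor_itv.
      by move=> h; apply/floor_def.
    apply/seteqP; split => w /=.
      by move=> qz i _ /=; rewrite -qz mxE.
    by move=> h; apply/rowP => i; rewrite mxE; exact: (h i).
  (* Integer rows are enumerated by [unpickle], which turns the preimage into a countable union of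
     level sets. *)
  rewrite (_ : _ @^-1` _ = \bigcup_k (if unpickle k is Some z then
      [set w | q n w = z /\ B (f (g n z))] else set0)).
    apply: bigcupT_measurable => k; case: unpickle => [z|]//.
    have [Bz|Bz] := pselect (B (f (g n z))).
      by rewrite (_ : [set _ | _] = [set w | q n w = z])//; apply/seteqP; split => w //= [].
    by rewrite (_ : [set _ | _] = set0)//; apply/seteqP; split => w //= [].
  apply/seteqP; split => w /=.
    by move=> Bw; exists (pickle (q n w)) => //; rewrite pickleK.
  by move=> [k _]; case: unpickle => //= z [->].
- move=> w _; suff h : g n (q n w) @[n --> \oo] --> Y w by exact: cvg_comp h (cf (Y w)).
  apply/cvg_ballP => e e0; near=> n; split => // i j; rewrite ord1 /ball/= !mxE.
  have n0 : n.+1%:R^-1 < e by near: n; exact: (near_infty_natSinv_lt (PosNum e0)).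
  apply: le_lt_trans n0; set x := Y w ord0 j.
  have /andP[h1 h2] := floor_itv (n.+1%:R * x).
  have np : (0 : R) < n.+1%:R by [].
  have -> : x - (Num.floor (n.+1%:R * x))%:~R / n.+1%:R =
      (n.+1%:R * x - (Num.floor (n.+1%:R * x))%:~R) / n.+1%:R by field.
  rewrite normrM (@ger0_norm _ n.+1%:R^-1) ?invr_ge0// ler_piMl ?invr_ge0//.
  by rewrite ger0_norm ?subr_ge0// lerBlDr addrC; move: h2; rewrite intrD => /ltW.
Unshelve. all: by end_near. Qed.

(** * Independence from uncorrelated cosines *)

Section bounded_closure.
Context (T : Type) (R : realType).

(** A functional monotone class, inductive so that an identity between integrals spreads from [gen]
    by induction. The constant [C] of [bc_lim] does not depend on [n], as dominated convergence
    requires. *)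
Inductive bounded_closure (gen : set (T -> R)) : (T -> R) -> Prop :=
| bc_gen f : gen f -> bounded_closure gen f
| bc_add f g : bounded_closure gen f -> bounded_closure gen g ->
    bounded_closure gen (fun w => f w + g w)
| bc_scale k f : bounded_closure gen f -> bounded_closure gen (fun w => k * f w)
| bc_lim (f_ : nat -> T -> R) (f : T -> R) (C : R) : (forall n, bounded_closure gen (f_ n)) ->
    (forall n w, `|f_ n w| <= C) -> (forall w, f_ n w @[n --> \oo] --> f w) ->
    bounded_closure gen f.

Variable gen : set (T -> R).
Hypothesis gen_bounded : forall f, gen f -> exists C : R, forall w, `|f w| <= C.

Lemma bounded_closure_bounded f : bounded_closure gen f ->
  exists C : R, forall w, `|f w| <= C.
Proof.
elim => {f} [f /gen_bounded//|f g _ [C1 h1] _ [C2 h2]|k f _ [C h]|f_ f C _ _ fC ff].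
- by exists (C1 + C2) => w; rewrite (le_trans (ler_normD _ _))// lerD.
- by exists (`|k| * C) => w; rewrite normrM ler_wpM2l.
- exists C => w; have cn : `|f_ n w| @[n --> \oo] --> `|f w| by apply: cvg_norm; exact: ff.
  rewrite -(cvg_lim (@Rhausdorff R) cn).
  by apply: limr_le; [exact: cvgP cn|exact: nearW].
Qed.

Hypothesis gen_mul : forall f g, gen f -> gen g ->
  bounded_closure gen (fun w => f w * g w).

(** Double induction: on [f] with [g] fixed and, when [f] is a generator, on [g]. Boundedness of the
    fixed factor bounds the products in the limit cases. *)
Lemma bounded_closure_mul f g : bounded_closure gen f ->
  bounded_closure gen g -> bounded_closure gen (fun w => f w * g w).
Proof.
move=> bf bg; elim: bf => {f} [f gf|f1 f2 _ h1 _ h2|k f _ h|f_ f C _ h fC ff].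
- elim: bg => {g} [g gg|g1 g2 _ h1 _ h2|k g _ h|g_ g C _ h gC g_g].
  + exact: gen_mul.
  + rewrite (_ : (fun _ => _) = fun w => f w * g1 w + f w * g2 w); first exact: bc_add.
    by apply/funext => w; rewrite mulrDr.
  + rewrite (_ : (fun _ => _) = fun w => k * (f w * g w)); first exact: bc_scale.
    by apply/funext => w; rewrite mulrCA.
  + have [D fD] := gen_bounded gf.
    apply: (@bc_lim _ (fun n w => f w * g_ n w) _ (D * C)) => // [n w|w].
      by rewrite normrM ler_pM.
    by apply: cvgMr; exact: g_g.
- rewrite (_ : (fun _ => _) = fun w => f1 w * g w + f2 w * g w); first exact: bc_add.
  by apply/funext => w; rewrite mulrDl.
- rewrite (_ : (fun _ => _) = fun w => k * (f w * g w)); first exact: bc_scale.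
  by apply/funext => w; rewrite mulrA.
- have [D gD] := bounded_closure_bounded bg.
  apply: (@bc_lim _ (fun n w => f_ n w * g w) _ (C * D)) => // [n w|w].
    by rewrite normrM ler_pM.
  by apply: cvgMl; exact: ff.
Qed.

Hypothesis gen_1 : gen (fun=> 1).

Lemma bounded_closure_cst c : bounded_closure gen (fun=> c).
Proof.
rewrite (_ : (fun=> c) = fun=> c * 1); first exact/bc_scale/bc_gen.
by apply/funext => w; rewrite mulr1.
Qed.

Definition closure_events : set (set T) :=
  [set B | bounded_closure gen (\1_B : T -> R)].

Lemma closure_eventsC B : closure_events B -> closure_events (~` B).
Proof.
move=> cB; rewrite /closure_events/=.
rewrite (_ : \1_(~` B) = fun w => 1 + -1 * \1_B w).
  by apply: bc_add; [exact: bounded_closure_cst|exact: bc_scale].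
apply/funext => w; rewrite indicC indicE.
by case: (w \in B); rewrite /= ?mulr1 ?mulr0 ?subrr ?addr0.
Qed.

Lemma closure_eventsU A B : closure_events A -> closure_events B ->
  closure_events (A `|` B).
Proof.
move=> /closure_eventsC cA /closure_eventsC cB.
rewrite -[_ `|` _]setCK setCU; apply: closure_eventsC.
by rewrite /closure_events/= indicI; exact: bounded_closure_mul.
Qed.

(** Products of indicators give intersections, and complements then give unions. A countable union
    is the pointwise limit of finite unions, whose indicators are all bounded by 1. *)
Lemma sigma_algebra_closure_events : sigma_algebra setT closure_events.
Proof.
have c0 : closure_events set0.
  by rewrite /closure_events/= indic0; exact: bounded_closure_cst.
split => // [A cA|A cA]; first by rewrite setTD; exact: closure_eventsC.
pose F n := \big[setU/set0]_(i < n) A i.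
have cF n : closure_events (F n).
  rewrite /F; elim: n => [|n IH]; first by rewrite big_ord0.
  by rewrite big_ord_recr; exact: closure_eventsU.
apply: (@bc_lim _ (fun n => \1_(F n)) _ 1) => // [n w|w].
  by rewrite indicE; case: (_ \in _); rewrite ?normr1 ?normr0.
apply: cvg_near_cst.
have [[k _ Akw]|h] := pselect ((\bigcup_k A k) w).
  near=> n; rewrite !indicE (mem_set _ : w \in \bigcup_k A k); last by exists k.
  rewrite (mem_set _ : w \in F n)// /F -bigcup_mkord; exists k => //=.
  by near: n; exact: nbhs_infty_gt.
near=> n; rewrite !indicE (memNset h) memNset//.
by rewrite /F -bigcup_mkord => -[k _ Akw]; apply: h; exists k.
Unshelve. all: by end_near. Qed.

End bounded_closure.

Section sign_iteration.
Context {R : realType}.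

(* Iterating y |-> y (3 - y^2) / 2 approximates the sign on [-1, 1] by polynomials. *)
Definition sgn_step (y : R) := y * (3 - y ^+ 2) / 2.

Lemma sgn_stepN y : sgn_step (- y) = - sgn_step y.
Proof. by rewrite /sgn_step sqrrN !mulNr. Qed.

Lemma iter_sgn_step_norm_le1 n (y : R) : `|y| <= 1 -> `|iter n sgn_step y| <= 1.
Proof.
elim: n => //= n IH y1; have := IH y1; rewrite /sgn_step; set z := iter _ _ _.
rewrite !ler_norml => /andP[z1 z2].
have h1 : 0 <= (1 - z) ^+ 2 * (2 + z) by rewrite mulr_ge0 ?sqr_ge0//; lra.
have h2 : 0 <= (1 + z) ^+ 2 * (2 - z) by rewrite mulr_ge0 ?sqr_ge0//; lra.
by apply/andP; split; lra.
Qed.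

(** One step multiplies the distance to 1 by [(1 - z)(2 + z) / 2], which is at most [1 - y / 2] as
    long as the iterate [z] stays above its start [y]. *)
Lemma iter_sgn_step_ge n (y : R) : 0 <= y <= 1 ->
  y <= iter n sgn_step y <= 1 /\ 1 - iter n sgn_step y <= (1 - y / 2) ^+ n.
Proof.
move=> /andP[y0 y1]; elim: n => [|n [/andP[h1 h2] h3]] /=; first by rewrite lexx y1 expr0; split => //; lra.
rewrite /sgn_step; move: h1 h2 h3; set z := iter _ _ _ => h1 h2 h3.
have E : 1 - z * (3 - z ^+ 2) / 2 = (1 - z) * ((1 - z) * (2 + z) / 2) by field.
have z0 : 0 <= z by exact: le_trans h1.
have b1 : (1 - z) * (2 + z) / 2 <= 1 - y / 2 by nra.
have b0 : 0 <= (1 - z) * (2 + z) / 2 by nra.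
split; last first.
  by rewrite E exprSr ler_pM// subr_ge0.
apply/andP; split.
  apply: (le_trans h1); nra.
by rewrite -subr_ge0 E mulr_ge0// subr_ge0.
Qed.

Lemma iter_sgn_step_cvg (y : R) : `|y| <= 1 ->
  iter n sgn_step y @[n --> \oo] --> Num.sg y.
Proof.
have pos (x : R) : 0 < x <= 1 -> iter n sgn_step x @[n --> \oo] --> (1 : R).
  move=> /andP[x0 x1].
  have c : (1 - x / 2) ^+ n @[n --> \oo] --> (0 : R).
    by apply: cvg_expr; rewrite ger0_norm; lra.
  apply: (@squeeze_cvgr _ _ _ _ (fun n => 1 - (1 - x / 2) ^+ n) (fun=> 1)).
  - apply: nearW => n; have [/andP[h1 h2] h3] := @iter_sgn_step_ge n x (introT andP (conj (ltW x0) x1)).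
    by rewrite h2 andbT lerBlDr -lerBlDl.
  - by rewrite -[X in _ --> X](subr0 1); apply: cvgB => //; exact: cvg_cst.
  - exact: cvg_cst.
rewrite ler_norml => /andP[y1 y2].
have [y0|y0|y0] := ltgtP y 0.
- rewrite ltr0_sg//.
  rewrite (_ : (fun n => _) = fun n => - iter n sgn_step (- y)).
    by apply: cvgN; apply: pos; apply/andP; split; lra.
  apply/funext; elim => [|n /= ->]; first by rewrite /= opprK.
  by rewrite sgn_stepN.
- by rewrite gtr0_sg//; apply: pos; rewrite y0.
- rewrite y0 sgr0; apply: cvg_near_cst; apply: nearW.
  by elim => //= n ->; rewrite /sgn_step mul0r mul0r.
Qed.

End sign_iteration.

Section cosine_events.
Context (T : Type) (R : realType) (n : nat) (Z : 'I_n -> T -> R).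

(** The phase [b] puts the sines in the family and lets the product-to-sum formula stay within its
    span. *)
Definition cosines : set (T -> R) :=
  [set f | exists v b, f = fun w => cos (\sum_(l < n) v l * Z l w + b)].

Lemma cosines_bounded f : cosines f -> exists C : R, forall w, `|f w| <= C.
Proof.
by move=> [v [b ->]]; exists 1 => w; rewrite ler_norml cos_geN1 cos_le1.
Qed.

Lemma cosines_1 : cosines (fun=> 1).
Proof.
exists (fun=> 0), 0; apply/funext => w.
by rewrite big1 ?addr0 ?cos0// => l _; rewrite mul0r.
Qed.

Lemma cosines_mul f g : cosines f -> cosines g ->
  bounded_closure cosines (fun w => f w * g w).
Proof.
move=> [v [b ->]] [v' [b' ->]].
pose A s w := cos (\sum_(l < n) (v l + s * v' l) * Z l w + (b + s * b')).
rewrite (_ : (fun _ => _) = fun w => 2^-1 * A 1 w + 2^-1 * A (-1) w).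
  by apply: bc_add; apply: bc_scale; apply: bc_gen; eexists; eexists; reflexivity.
apply/funext => w.
have E s : \sum_(l < n) (v l + s * v' l) * Z l w + (b + s * b') =
  (\sum_(l < n) v l * Z l w + b) + s * (\sum_(l < n) v' l * Z l w + b').
  rewrite mulrDr big_distrr/= addrACA -big_split/=; congr (_ + _).
  by apply: eq_bigr => l _; ring.
rewrite /A !E; move: (\sum_(_ < n) _ + b) (\sum_(_ < n) _ + b') => x y.
by rewrite mul1r mulN1r cosD cosB; field.
Qed.

Local Notation bc := (bounded_closure cosines).

(** For [N] large [(Z l w - c) / (N + 1)] lies between [- pi] and [pi], where the sine has the sign
    of its argument. The sign of the sine is in turn the bounded limit of the polynomials
    [iter k sgn_step] in the sine. *)
Lemma bounded_closure_sgn_affine l (c : R) : bc (fun w => Num.sg (Z l w - c)).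
Proof.
have bsin N : bc (fun w => sin ((Z l w - c) / N.+1%:R)).
  apply: bc_gen; exists (fun k => (k == l)%:R / N.+1%:R), (- c / N.+1%:R - pi / 2).
  apply/funext => w; rewrite addrA cosBpihalf (bigD1 l)//= eqxx.
  rewrite big1 ?addr0; first by congr sin; rewrite /=; field.
  by move=> k /negbTE ->; rewrite !mul0r.
have sin1 x : `|sin x| <= 1 :> R by rewrite ler_norml sin_geN1 sin_le1.
have bmul f g : bc f -> bc g -> bc (fun w => f w * g w).
  exact: bounded_closure_mul cosines_bounded cosines_mul _ _.
have bsgsin N : bc (fun w => Num.sg (sin ((Z l w - c) / N.+1%:R))).
  apply: (@bc_lim _ _ _ (fun k w => iter k sgn_step (sin ((Z l w - c) / N.+1%:R))) _ 1).
  - elim => [|k IH] /=; first exact: bsin.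
    rewrite (_ : (fun _ => _) = fun w => let z := iter k sgn_step (sin ((Z l w - c) / N.+1%:R)) in
       3 / 2 * z + - 2^-1 * (z * (z * z))).
      by apply: bc_add; apply: bc_scale => //; exact: (bmul _ _ IH (bmul _ _ IH IH)).
    by apply/funext => w/=; rewrite /sgn_step; field.
  - by move=> k w; exact: iter_sgn_step_norm_le1.
  - by move=> w; exact: iter_sgn_step_cvg.
apply: (@bc_lim _ _ _ (fun N w => Num.sg (sin ((Z l w - c) / N.+1%:R))) _ 1) => //.
  by move=> k w; rewrite normr_sg; case: (_ != _); rewrite ?lexx ?ler01.
have sgp (x : R) : 0 < x -> \forall N \near \oo, Num.sg (sin (x / N.+1%:R)) = 1.
  move=> x0; near=> N; apply: gtr0_sg; apply: sin_gt0_pi.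
  rewrite divr_gt0//= ltr_pdivrMr//.
  have xN : x < N%:R by near: N; exact: nbhs_infty_gtr.
  apply: (lt_le_trans xN); rewrite -natr1; have := pi_ge2 R; have := ler0n R N; nra.
move=> w; apply: cvg_near_cst.
have [x0|x0|x0] := ltgtP (Z l w - c) 0.
- have := sgp (- (Z l w - c)); rewrite oppr_gt0 => /(_ x0); apply: filterS => N.
  by rewrite mulNr sinN sgrN (ltr0_sg x0) => /eqP; rewrite eqr_oppLR => /eqP.
- by rewrite (gtr0_sg x0); exact: sgp.
- by apply: nearW => N; rewrite x0 mul0r sin0.
Unshelve. all: by end_near. Qed.

Lemma ray_closure_events l (c : R) :
  closure_events cosines (Z l @^-1` `]-oo, c[).
Proof.
have bg : bc (fun w => if Z l w < c then -1 else 1).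
  (* The threshold is approached from below because the sign vanishes at 0: with [c - 1 / (k + 1)]
     the limit at [Z l w = c] is 1, as it is above [c]. *)
  apply: (@bc_lim _ _ _ (fun k w => Num.sg (Z l w - (c - k.+1%:R^-1))) _ 1).
  - by move=> k; exact: bounded_closure_sgn_affine.
  - by move=> k w; rewrite normr_sg; case: (_ != _); rewrite ?lexx ?ler01.
  move=> w; apply: cvg_near_cst; case: ltP => h; last first.
    apply: nearW => k; rewrite gtr0_sg// opprB addrA subr_gt0.
    by rewrite ltr_pwDr// invr_gt0.
  have h' : 0 < c - Z l w by rewrite subr_gt0.
  have := near_infty_natSinv_lt (PosNum h'); apply: filterS => k /= hk.
  by rewrite ltr0_sg// subr_lt0 ltrBrDr -ltrBrDl.
rewrite /closure_events/=.
rewrite (_ : \1_ _ = fun w => 2^-1 + - 2^-1 * (if Z l w < c then -1 else 1)).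
  by apply: bc_add; [exact: (bounded_closure_cst cosines_1)|exact: bc_scale].
apply/funext => w; rewrite indicE; case: ifPn => h.
  by rewrite mem_set/= ?in_itv//=; field.
by rewrite memNset/= ?in_itv//=; [field|exact/negP].
Unshelve. all: by end_near. Qed.

End cosine_events.

Section bounded_convergence.
Context d (T : measurableType d) (R : realType) (P : probability T R).

Lemma integrable_bounded (f : T -> R) (C : R) : measurable_fun [set: T] f ->
  (forall w, `|f w| <= C) -> P.-integrable [set: T] (fun w => (f w)%:E).
Proof.
move=> mf fC; have := finite_measure_integrable_cst P C measurableT.
apply: le_integrable => //; first exact/measurable_EFinP.
by move=> w _; rewrite /= lee_fin (le_trans (fC w))// ler_norm.
Qed.

Lemma dominated_Rintegral_cvg (f_ : nat -> T -> R) (f g : T -> R) :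
  (forall n, measurable_fun [set: T] (f_ n)) ->
  (forall w, f_ n w @[n --> \oo] --> f w) ->
  P.-integrable [set: T] (fun w => (g w)%:E) ->
  (forall n w, `|f_ n w| <= g w) ->
  \int[P]_w f_ n w @[n --> \oo] --> \int[P]_w f w.
Proof.
move=> mf ff ig fg.
have mlim : measurable_fun [set: T] f by apply: measurable_fun_cvg (fun w _ => ff w).
have [|||//||_ _ C] := @dominated_convergence _ _ _ P _ measurableT
  (fun n w => (f_ n w)%:E) (fun w => (f w)%:E) (fun w => (g w)%:E).
- by move=> n; exact/measurable_EFinP.
- exact/measurable_EFinP.
- by apply: aeW => w _; apply: cvg_EFin; [exact: nearW|exact: ff].
- by apply: aeW => w n _; rewrite /= lee_fin.
have ifin : (\int[P]_w (f w)%:E)%E \is a fin_num.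
  apply: integrable_fin_num => //; apply: le_integrable ig => //; first exact/measurable_EFinP.
  move=> w _; rewrite /= lee_fin.
  have cn : `|f_ n w| @[n --> \oo] --> `|f w| by apply: cvg_norm; exact: ff.
  rewrite -(cvg_lim (@Rhausdorff R) cn); apply: limr_le; first exact: cvgP cn.
  by apply: nearW => n; rewrite (le_trans (fg n w))// ler_norm.
by apply: fine_cvg; rewrite /Rintegral fineK.
Qed.

Lemma bounded_closure_measurable (gen : set (T -> R)) f :
  (forall f, gen f -> measurable_fun [set: T] f) ->
  bounded_closure gen f -> measurable_fun [set: T] f.
Proof.
move=> mgen; elim => {f} [f /mgen//|f g _ h1 _ h2|k f _ h|f_ f C _ h _ ff].
- exact: measurable_funD.
- exact: measurable_funM.
- exact: measurable_fun_cvg (fun w _ => ff w).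
Qed.

(** The identity is linear in each factor and passes to bounded pointwise limits by dominated
    convergence, so the double induction of [bounded_closure_mul] brings it back to generators. *)
Lemma bounded_closure_uncorrelated (gen1 gen2 : set (T -> R)) f g :
  (forall f, gen1 f -> measurable_fun [set: T] f) ->
  (forall f, gen2 f -> measurable_fun [set: T] f) ->
  (forall f, gen1 f -> exists C : R, forall w, `|f w| <= C) ->
  (forall f, gen2 f -> exists C : R, forall w, `|f w| <= C) ->
  (forall f g, gen1 f -> gen2 g ->
    \int[P]_w (f w * g w) = \int[P]_w f w * \int[P]_w g w) ->
  bounded_closure gen1 f -> bounded_closure gen2 g ->
  \int[P]_w (f w * g w) = \int[P]_w f w * \int[P]_w g w.
Proof.
move=> m1 m2 b1 b2 gen12 bf bg.
have mbd1 h : bounded_closure gen1 h -> measurable_fun [set: T] h /\ exists C : R, forall w, `|h w| <= C.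
  by move=> bh; split; [exact: bounded_closure_measurable bh|exact: bounded_closure_bounded bh].
have mbd2 h : bounded_closure gen2 h -> measurable_fun [set: T] h /\ exists C : R, forall w, `|h w| <= C.
  by move=> bh; split; [exact: bounded_closure_measurable bh|exact: bounded_closure_bounded bh].
have int1 (h : T -> R) : (measurable_fun [set: T] h /\ exists C : R, forall w, `|h w| <= C) ->
    P.-integrable [set: T] (fun w => (h w)%:E).
  by move=> [mh [C hC]]; exact: integrable_bounded hC.
have int2 (h k : T -> R) : (measurable_fun [set: T] h /\ exists C : R, forall w, `|h w| <= C) ->
    (measurable_fun [set: T] k /\ exists C : R, forall w, `|k w| <= C) ->
    P.-integrable [set: T] (fun w => (h w * k w)%:E).
  move=> [mh [C hC]] [mk [D kD]]; apply: (@integrable_bounded _ (C * D)).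
    exact: measurable_funM.
  by move=> w; rewrite normrM ler_pM.
have lim (f_ : nat -> T -> R) (h k : T -> R) (C D : R) :
    (forall n, measurable_fun [set: T] (f_ n)) -> (forall n w, `|f_ n w| <= C) ->
    (forall w, f_ n w @[n --> \oo] --> h w) ->
    measurable_fun [set: T] k -> (forall w, `|k w| <= D) ->
    (forall n, \int[P]_w (f_ n w * k w) = \int[P]_w f_ n w * \int[P]_w k w) ->
    \int[P]_w (h w * k w) = \int[P]_w h w * \int[P]_w k w.
  move=> mf fC fh mk kD eqn.
  have c1 : \int[P]_w (f_ n w * k w) @[n --> \oo] --> \int[P]_w (h w * k w).
    apply: (@dominated_Rintegral_cvg _ _ (fun=> C * D)).
    - by move=> n; exact: measurable_funM.
    - by move=> w; apply: cvgMl; exact: fh.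
    - exact: finite_measure_integrable_cst.
    - by move=> n w; rewrite normrM ler_pM.
  have c2 : \int[P]_w f_ n w * \int[P]_w k w @[n --> \oo] --> \int[P]_w h w * \int[P]_w k w.
    apply: cvgMl; apply: (@dominated_Rintegral_cvg _ _ (fun=> C)) => //.
    exact: finite_measure_integrable_cst.
  have c1' : \int[P]_w f_ n w * \int[P]_w k w @[n --> \oo] --> \int[P]_w (h w * k w).
    by move: c1; under eq_fun do rewrite eqn.
  exact: (@cvg_unique _ (@Rhausdorff R) _ _ _ _ c1' c2).
elim: bf => {f} [f gf|f1 f2 bf1 h1 bf2 h2|k f bf h|f_ f C bf h fC ff].
- elim: bg => {g} [g gg|g1 g2 bg1 h1 bg2 h2|k g bg h|g_ g C bg h gC gg].
  + exact: gen12.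
  + have bf : bounded_closure gen1 f by exact: bc_gen.
    under eq_Rintegral do rewrite mulrDr.
    rewrite (RintegralD measurableT (int2 _ _ (mbd1 _ bf) (mbd2 _ bg1)) (int2 _ _ (mbd1 _ bf) (mbd2 _ bg2))).
    by rewrite (RintegralD measurableT (int1 _ (mbd2 _ bg1)) (int1 _ (mbd2 _ bg2))) h1 h2 mulrDr.
  + have bf : bounded_closure gen1 f by exact: bc_gen.
    under eq_Rintegral do rewrite mulrCA.
    rewrite (RintegralZl k measurableT (int2 _ _ (mbd1 _ bf) (mbd2 _ bg))).
    by rewrite (RintegralZl k measurableT (int1 _ (mbd2 _ bg))) h mulrCA.
  + have [D fD] := b1 _ gf.
    under eq_Rintegral do rewrite mulrC.
    rewrite [RHS]mulrC; apply: (lim g_ _ _ C D) => // [n||n].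
    * by have [] := mbd2 _ (bg n).
    * exact: m1.
    * by under eq_Rintegral do rewrite mulrC; rewrite h mulrC.
- under eq_Rintegral do rewrite mulrDl.
  rewrite (RintegralD measurableT (int2 _ _ (mbd1 _ bf1) (mbd2 _ bg)) (int2 _ _ (mbd1 _ bf2) (mbd2 _ bg))).
  by rewrite (RintegralD measurableT (int1 _ (mbd1 _ bf1)) (int1 _ (mbd1 _ bf2))) h1 h2 mulrDl.
- under eq_Rintegral do rewrite -mulrA.
  rewrite (RintegralZl k measurableT (int2 _ _ (mbd1 _ bf) (mbd2 _ bg))).
  by rewrite (RintegralZl k measurableT (int1 _ (mbd1 _ bf))) h mulrA.
- have [mg [D gD]] := mbd2 _ bg.
  by apply: (lim f_ _ _ C D) => // n; have [] := mbd1 _ (bf n).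
Qed.

End bounded_convergence.

(** * Stein's identity conditionally on an independent variable *)

Section independent_stein.
Context d (T : measurableType d) (R : realType) (P : probability T R).
Context d' (T' : measurableType d').
Variables (Z : T -> T') (G : T -> R).
Hypotheses (mZ : measurable_fun [set: T] Z) (mG : measurable_fun [set: T] G).

Definition independent_pair :=
  forall (B : set T') (A : set R), measurable B -> measurable A ->
    P (Z @^-1` B `&` G @^-1` A) = (P (Z @^-1` B) * P (G @^-1` A))%E.

Hypothesis ZG : independent_pair.

(** Independence says that the law of the pair and the product of the two laws agree on rectangles;
    they are therefore equal, and Fubini's theorem applies on the image space. *)
Lemma independent_Fubini (f : T' * R -> R) :
  measurable_fun [set: T' * R] f ->
  P.-integrable [set: T] (fun w => (f (Z w, G w))%:E) ->
  (forall y, P.-integrable [set: T] (fun w => (f (y, G w))%:E)) ->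
  P.-integrable [set: T] (fun w => \int[P]_w' (f (Z w, G w'))%:E)%E /\
  (\int[P]_w (f (Z w, G w))%:E = \int[P]_w \int[P]_w' (f (Z w, G w'))%:E)%E.
Proof.
move=> mf fi fyi.
have mG1 : measurable_fun [set: T] (G : T -> measurableTypeR R) by exact: mG.
pose G' : {mfun T >-> measurableTypeR R} := @mfun_Sub _ _ T (measurableTypeR R) G (mem_set mG1).
pose Z' : {mfun T >-> T'} := mfun_Sub (mem_set mZ).
have mZG : measurable_fun [set: T] (fun w => (Z w, G w) : T' * measurableTypeR R).
  exact: measurable_fun_pair.
pose ZG' : {mfun T >-> (T' * measurableTypeR R)%type} :=
  @mfun_Sub _ _ T (T' * measurableTypeR R)%type (fun w => (Z w, G w)) (mem_set mZG).
have mEf : measurable_fun [set: T' * measurableTypeR R] (EFin \o f).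
  exact/measurable_EFinP.
have law A : measurable A -> A `<=` setT ->
    (distribution P Z' \x distribution P G')%E A = distribution P ZG' A.
  by move=> mA _; apply: product_measure_unique.
have i1 : (distribution P ZG').-integrable setT (EFin \o f).
  by apply: integrable_pushforward => //; exact: fi.
have i2 : (distribution P Z' \x distribution P G')%E.-integrable setT (EFin \o f).
  apply/integrableP; split => //; rewrite (eq_measure_integral _ law).
  by have /integrableP[] := i1.
have E y : (\int[distribution P G']_x (EFin \o f) (y, x) = \int[P]_w' (f (y, G w'))%:E)%E.
  rewrite (@integral_distribution _ _ _ _ _ P G' (fun x => (EFin \o f) (y, x)))//.
  - by apply: measurableT_comp mEf _; exact: measurable_pair1.
  - exact: fyi.
have iF := integrable_fubini_F i2.
have iFZ : P.-integrable [set: T] (fubini_F (distribution P G') (EFin \o f) \o Z).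
  apply/integrableP; split.
    by apply: measurableT_comp mZ; exact: measurable_int iF.
  have mabs : measurable_fun [set: T'] (fun y => `|fubini_F (distribution P G') (EFin \o f) y|)%E.
    by apply: measurableT_comp => //; exact: measurable_int iF.
  have := @ge0_integral_distribution _ _ _ _ _ P Z' _ mabs (fun y => abse_ge0 _).
  by move=> /= <-; have /integrableP[] := iF.
have FE : fubini_F (distribution P G') (EFin \o f) \o Z =
    fun w => (\int[P]_w' (f (Z w, G w'))%:E)%E.
  by apply/funext => w; rewrite /= /fubini_F E.
split; first by rewrite -FE.
transitivity (\int[distribution P ZG']_x (f x)%:E)%E.
  by rewrite (@integral_distribution _ _ _ _ _ P ZG' (EFin \o f)).
rewrite -(eq_measure_integral _ law) -(integral12_prod_meas1 i2).
rewrite (@integral_distribution _ _ _ _ _ P Z').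
- by rewrite FE.
- exact: measurable_int iF.
- exact: iFZ.
Qed.

(** With [Z] frozen at [y], Stein's identity holds for [h y]; [independent_Fubini] integrates it
    over the law of [Z]. *)
Lemma independent_stein (v : R) (h dh : T' -> R -> R) : stein_variable P G v ->
  measurable_fun [set: T' * R] (fun z => h z.1 z.2) ->
  measurable_fun [set: T' * R] (fun z => dh z.1 z.2) ->
  (forall y (x : R), is_derive x 1 (h y) (dh y x)) ->
  (forall y, continuous (dh y)) ->
  (forall y, even_growth 2 (h y)) -> (forall y, even_growth 2 (dh y)) ->
  P.-integrable [set: T] (fun w => (G w * h (Z w) (G w))%:E) ->
  P.-integrable [set: T] (fun w => (dh (Z w) (G w))%:E) ->
  \int[P]_w (G w * h (Z w) (G w)) = v * \int[P]_w dh (Z w) (G w).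
Proof.
move=> [_ iG sG] mh mdh hdh cdh gh gdh ih idh.
have mhy y : measurable_fun [set: R] (h y).
  apply: continuous_measurable_fun => x; apply: differentiable_continuous.
  by apply/derivable1_diffP; have [] := hdh y x.
have mdhy y : measurable_fun [set: R] (dh y) by exact: continuous_measurable_fun.
have i1 y : P.-integrable [set: T] (fun w => (G w * h y (G w))%:E).
  apply: (iG (fun x => x * h y x)); first exact: measurable_funM.
  by have := even_growthX (gh y) (leqnn 1); under eq_fun do rewrite expr1.
have i2 y : P.-integrable [set: T] (fun w => (dh y (G w))%:E).
  by apply: (iG (dh y)) => //; exact: even_growth_trans (gdh y).
have mXh : measurable_fun [set: T' * R] (fun z => z.2 * h z.1 z.2).
  by apply: measurable_funM => //; exact: measurable_snd.
have [j1 F1] := independent_Fubini mXh ih i1.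
have [j2 F2] := independent_Fubini mdh idh i2.
rewrite /Rintegral F1 F2 /=.
rewrite -[in RHS](_ : fine v%:E = v)// -fineM//; last exact: integrable_fin_num.
congr fine; rewrite -integralZl//; apply: eq_integral => w _.
have e := sG (h (Z w)) (dh (Z w)) (hdh (Z w)) (cdh _) (gh _) (gdh _).
rewrite /Rintegral in e.
rewrite -[LHS]fineK; last exact: integrable_fin_num (i1 _).
by rewrite e EFinM fineK//; exact: integrable_fin_num (i2 _).
Qed.

End independent_stein.

(** The sets whose preimage lies in [ev] form a sigma-algebra, and cylinders generate the one of
    tuples. *)
Lemma sigma_algebra_tuple (T : Type) (R : realType) (n : nat) (Z : 'I_n -> T -> R)
    (ev : set (set T)) : sigma_algebra setT ev ->
  (forall l (A : set R), measurable A -> ev (Z l @^-1` A)) ->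
  forall B : set (n.-tuple R), measurable B ->
    ev ((fun w => [tuple Z i w | i < n]) @^-1` B).
Proof.
move=> sev evZ B mB; set f := fun w => _.
have h : sigma_algebra setT (image_set_system setT f ev) by exact: sigma_algebra_image.
suff : \big[setU/set0]_(i < n) preimage_set_system setT (fun x : n.-tuple R => tnth x i) measurable
    `<=` image_set_system setT f ev.
  by move=> /(smallest_sub h)/(_ B mB); rewrite /image_set_system/= setTI.
apply: (@big_ind _ (fun S => S `<=` _)) => [|A A' hA hA'|i _]; first exact: sub0set.
  by rewrite subUset.
move=> _ [A mA <-]; rewrite /image_set_system/= !setTI.
rewrite (_ : _ @^-1` _ = Z i @^-1` A); first exact: evZ.
by apply/seteqP; split => w /=; rewrite tnth_mktuple.
Qed.

Section closure_events_generated.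
Context (T : Type) (R : realType) (n : nat) (Z : 'I_n -> T -> R).

Let sigma_ev : sigma_algebra setT (closure_events (cosines Z)).
Proof.
apply: sigma_algebra_closure_events; first exact: cosines_bounded.
- exact: cosines_mul.
- exact: cosines_1.
Qed.

Lemma borel_closure_events l (A : set R) : measurable A ->
  closure_events (cosines Z) (Z l @^-1` A).
Proof.
move=> mA; have {}mA : <<s @RGenInftyO.G R >> A.
  have mA1 : (@ocitv R).-sigma.-measurable A by exact: mA.
  by rewrite RGenInftyO.measurableE in mA1.
have h : sigma_algebra setT (image_set_system setT (Z l) (closure_events (cosines Z))).
  exact: sigma_algebra_image.
suff : @RGenInftyO.G R `<=` image_set_system setT (Z l) (closure_events (cosines Z)).
  by move=> /(smallest_sub h)/(_ A mA); rewrite /image_set_system/= setTI.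
by move=> _ [x ->]; rewrite /image_set_system/= setTI; exact: ray_closure_events.
Qed.

Lemma tuple_closure_events (B : set (n.-tuple R)) : measurable B ->
  closure_events (cosines Z) ((fun w => [tuple Z i w | i < n]) @^-1` B).
Proof. by apply: sigma_algebra_tuple => // l A; exact: borel_closure_events. Qed.

End closure_events_generated.

(** * Independence of one coordinate of a Gaussian vector from the residuals of the others *)

Section gaussian_vector.
Context d (T : measurableType d) (R : realType) (P : probability T R).
Context (M : nat) (X : 'I_M -> T -> R) (r : 'I_M -> 'I_M -> R).

Definition quad (a : 'I_M -> R) := \sum_k \sum_l a k * a l * r k l.

(** The law is encoded by all linear forms, in the spirit of the Cramer-Wold device, which leaves
    room for a singular [r]. *)
Definition gaussian_vector :=
  forall a, stein_variable P (fun w => \sum_k a k * X k w) (quad a).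

Hypothesis gX : gaussian_vector.
Hypothesis r_sym : forall k l, r k l = r l k.
Hypothesis r_diag : forall k, r k k = 1.

Lemma sum_pick (k : 'I_M) (F : 'I_M -> R) : \sum_l (l == k)%:R * F l = F k.
Proof.
rewrite (bigD1 k)//= eqxx mul1r big1 ?addr0// => l /negbTE ->.
by rewrite mul0r.
Qed.

Lemma stein_coord k : stein_variable P (X k) 1.
Proof.
have := gX (fun l => (l == k)%:R).
rewrite (_ : (fun w => _) = X k); last by apply/funext => w; rewrite sum_pick.
rewrite /quad (_ : \sum_i _ = 1)// -[RHS](r_diag k) -[RHS](sum_pick k (fun j => r j k)).
apply: eq_bigr => i _; rewrite -[in RHS](sum_pick k (r i)) big_distrr/=.
by apply: eq_bigr => j _; rewrite mulrA.
Qed.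

Definition residual k l w := X l w - r l k * X k w.

(** Pythagoras: subtracting [s] at the index [k] makes the form [c] uncorrelated with [X k] (this is
    [cs]), so the cross terms vanish and only the variance [u^2] of [u X k] is added. *)
Lemma quad_resid (k : 'I_M) (u : R) (v : 'I_M -> R) :
  let s := \sum_l v l * r l k in
  quad (fun l => (v l - (l == k)%:R * s) + u * (l == k)%:R) =
  quad (fun l => v l - (l == k)%:R * s) + u ^+ 2.
Proof.
move=> s; pose c l := v l - (l == k)%:R * s.
have cs : \sum_l c l * r l k = 0.
  rewrite /c; under eq_bigr do rewrite mulrBl -mulrA.
  by rewrite sumrB sum_pick r_diag mulr1 subrr.
change (quad (fun l => c l + u * (l == k)%:R) = quad c + u ^+ 2).
clearbody c; rewrite /quad; transitivity (\sum_i (\sum_j c i * c j * r i j +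
    (u * (i == k)%:R * \sum_j c j * r j i + u * (c i * r i k) + u ^+ 2 * ((i == k)%:R * r i k)))).
  apply: eq_bigr => i _; rewrite -[r i k](sum_pick k (fun j => r i j)).
  rewrite !big_distrr/= -!big_split/=.
  apply: eq_bigr => j _; rewrite (r_sym j i).
  ring.
rewrite big_split/=; congr (_ + _); rewrite !big_split/= -!big_distrr/= cs mulr0 addr0.
under eq_bigr do rewrite -mulrA.
by rewrite -big_distrr/= !sum_pick cs mulr0 add0r r_diag mulr1.
Qed.

Lemma residual_cos (k : 'I_M) (u : R) (v : 'I_M -> R) (b : R) :
  \int[P]_w cos (u * X k w + \sum_l v l * residual k l w + b) =
  expR (- (u ^+ 2 / 2)) *
  expR (- (quad (fun l => v l - (l == k)%:R * \sum_l v l * r l k) / 2)) * cos b.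
Proof.
pose s := \sum_l v l * r l k.
pose c l := (v l - (l == k)%:R * s) + u * (l == k)%:R.
transitivity (\int[P]_w cos (\sum_l c l * X l w + b)).
  apply: eq_Rintegral => w _; congr (cos (_ + _)).
  rewrite /c /residual; under [RHS]eq_bigr do rewrite mulrDl mulrBl -!mulrA.
  rewrite big_split/= sumrB -big_distrr/= !sum_pick addrC; congr (_ + _).
  rewrite /s big_distrl/= -sumrB; apply: eq_bigr => l _; ring.
rewrite (stein_cos b (gX c)) quad_resid -expRD; congr (expR _ * _).
by field.
Qed.

End gaussian_vector.

Section gaussian_independent.
Context d (T : measurableType d) (R : realType) (P : probability T R).
Context (M : nat) (X : 'I_M -> T -> R) (r : 'I_M -> 'I_M -> R).
Hypothesis gX : gaussian_vector P X r.
Hypothesis r_sym : forall k l, r k l = r l k.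
Hypothesis r_diag : forall k, r k k = 1.

Lemma measurable_coord k : measurable_fun [set: T] (X k).
Proof. by have [] := stein_coord gX r_diag k. Qed.

Lemma measurable_residual k l : measurable_fun [set: T] (residual X r k l).
Proof.
apply: measurable_funB; first exact: measurable_coord.
by apply: measurable_funM => //; exact: measurable_coord.
Qed.

Lemma measurable_cosines n (Z : 'I_n -> T -> R) :
  (forall l, measurable_fun [set: T] (Z l)) ->
  forall f, cosines Z f -> measurable_fun [set: T] f.
Proof.
move=> mZ f [v [b ->]].
apply: measurableT_comp; first exact: continuous_measurable_fun (@continuous_cos R).
apply: measurable_funD => //; apply: measurable_sum => l.
exact: measurable_funM.
Qed.

(** The product-to-sum formula gives the frequencies [u] and [- u] with phases [b + b'] and
    [b - b']. By [residual_cos] both terms carry the same Gaussian factor, even in [u] and split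
    between [u] and [v], and the phases recombine through [cos (b + b') + cos (b - b') = 2 cos b cos
    b']. *)
Lemma cosines_uncorrelated k f g : cosines (residual X r k) f ->
  cosines (fun _ : 'I_1 => X k) g ->
  \int[P]_w (f w * g w) = \int[P]_w f w * \int[P]_w g w.
Proof.
move=> [v [b ->]] [u' [b' ->]]; pose u := u' ord0.
pose S w := \sum_l v l * residual X r k l w.
have E w : cos (\sum_l v l * residual X r k l w + b) *
    cos (\sum_(l < 1) u' l * X k w + b') =
    2^-1 * cos (u * X k w + S w + (b + b')) + 2^-1 * cos (- u * X k w + S w + (b - b')).
  rewrite big_ord1 -/(S w) -/u.
  have -> : u * X k w + S w + (b + b') = (S w + b) + (u * X k w + b') by ring.
  have -> : - u * X k w + S w + (b - b') = (S w + b) - (u * X k w + b') by ring.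
  by move: (S w + b) (u * X k w + b') => x y; rewrite cosD cosB; field.
have iC (u0 b0 : R) : P.-integrable [set: T] (fun w => (cos (u0 * X k w + S w + b0))%:E).
  apply: (@integrable_bounded _ _ _ _ _ 1).
    apply: measurableT_comp; first exact: continuous_measurable_fun (@continuous_cos R).
    apply: measurable_funD => //; apply: measurable_funD.
      by apply: measurable_funM => //; exact: measurable_coord.
    by apply: measurable_sum => l; apply: measurable_funM => //; exact: measurable_residual.
  by move=> w; rewrite ler_norml cos_geN1 cos_le1.
have iC2 (u0 b0 : R) : P.-integrable [set: T] (fun w => (2^-1 * cos (u0 * X k w + S w + b0))%:E).
  by under eq_fun do rewrite EFinM; exact: integrableZl.
under eq_Rintegral do rewrite E.
rewrite (RintegralD measurableT (iC2 _ _) (iC2 _ _)).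
rewrite !(RintegralZl _ measurableT (iC _ _)) !(residual_cos gX r_sym r_diag).
have -> : \int[P]_w cos (\sum_l v l * residual X r k l w + b) =
    \int[P]_w cos (0 * X k w + \sum_l v l * residual X r k l w + b).
  by apply: eq_Rintegral => w _; rewrite mul0r add0r.
have -> : \int[P]_w cos (\sum_(l < 1) u' l * X k w + b') =
    \int[P]_w cos (u * X k w + \sum_l 0 * residual X r k l w + b').
  apply: eq_Rintegral => w _; rewrite big_ord1 big1 ?addr0//.
  by move=> l _; rewrite mul0r.
rewrite (residual_cos gX r_sym r_diag k 0 v) (residual_cos gX r_sym r_diag k u (fun=> 0)).
rewrite [X in _ * expR (- (X / 2)) * cos b'](_ : quad _ _ = 0); last first.
  rewrite /quad big1// => i _; rewrite big1// => j _.
  by rewrite big1 ?mulr0 ?subrr ?mul0r// => l _; rewrite mul0r.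
rewrite sqrrN expr0n/= !mul0r !oppr0 expR0 cosD cosB.
by field.
Qed.

Lemma gaussian_independent k :
  independent_pair P (fun w => [tuple residual X r k l w | l < M]) (X k).
Proof.
move=> B A mB mA.
set Z := fun w => _.
have mZ : measurable_fun [set: T] Z.
  by apply/measurable_fun_tnthP => l; apply: eq_measurable_fun (measurable_residual k l) => w _ /=; rewrite tnth_mktuple.
have mZB : measurable (Z @^-1` B) by rewrite -[_ @^-1` _]setTI; exact: mZ.
have mXA : measurable (X k @^-1` A).
  by rewrite -[_ @^-1` _]setTI; exact: measurable_coord.
have h := @bounded_closure_uncorrelated _ _ _ P _ _ _ _
  (measurable_cosines (measurable_residual k))
  (measurable_cosines (fun _ : 'I_1 => measurable_coord k))
  (@cosines_bounded _ _ _ _) (@cosines_bounded _ _ _ _)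
  (@cosines_uncorrelated k)
  (tuple_closure_events (residual X r k) mB)
  (borel_closure_events (fun _ : 'I_1 => X k) ord0 mA).
have ind (C : set T) : measurable C -> P C = (\int[P]_w (\1_C w : R))%:E.
  move=> mC; rewrite /Rintegral integral_indic// setIT fineK//.
  exact: fin_num_measure.
rewrite (ind _ mZB) (ind _ mXA) (ind _ (measurableI _ _ mZB mXA)) -EFinM -h.
by congr (_%:E); apply: eq_Rintegral => w _; rewrite indicI.
Qed.

End gaussian_independent.

(** * Gaussian integration by parts *)

Section poly_dominated.
Context (R : realType) (U : Type) (s : U -> R).
Hypothesis s_ge0 : forall u, 0 <= s u.

(** The degree is recorded because integrability is established up to degree 4, which is reached by
    the square of [gram] and by the products [X k X k g(F)] with [g] Lipschitz. *)
Definition poly_dominated (n : nat) (f : U -> R) :=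
  exists2 C, 0 <= C & forall u, `|f u| <= C * (1 + s u) ^+ n.

Let s1 u : 1 <= 1 + s u. Proof. by rewrite lerDl. Qed.

Let s1n u n : 0 <= (1 + s u) ^+ n.
Proof. by rewrite exprn_ge0// (le_trans ler01). Qed.

Lemma poly_dominated_le n m f : (n <= m)%N -> poly_dominated n f -> poly_dominated m f.
Proof.
move=> nm [C C0 fC]; exists C => // u; rewrite (le_trans (fC u))// ler_wpM2l//.
by rewrite ler_weXn2l.
Qed.

Lemma poly_dominated_cst c : poly_dominated 0 (fun=> c).
Proof. by exists `|c| => // u; rewrite expr0 mulr1. Qed.

Lemma poly_dominated_base f : (forall u, `|f u| <= s u) -> poly_dominated 1 f.
Proof.
move=> fs; exists 1 => // u; rewrite mul1r expr1 (le_trans (fs u))//.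
by rewrite lerDr.
Qed.

Lemma poly_dominatedD n f g : poly_dominated n f -> poly_dominated n g ->
  poly_dominated n (fun u => f u + g u).
Proof.
move=> [C C0 fC] [D D0 gD]; exists (C + D) => [|u]; first exact: addr_ge0.
by rewrite (le_trans (ler_normD _ _))// mulrDl lerD.
Qed.

Lemma poly_dominatedM n m f g : poly_dominated n f -> poly_dominated m g ->
  poly_dominated (n + m) (fun u => f u * g u).
Proof.
move=> [C C0 fC] [D D0 gD]; exists (C * D) => [|u]; first exact: mulr_ge0.
by rewrite normrM exprD mulrACA ler_pM.
Qed.

Lemma poly_dominatedZ n c f : poly_dominated n f -> poly_dominated n (fun u => c * f u).
Proof. exact: poly_dominatedM (poly_dominated_cst c). Qed.

Lemma poly_dominated_sum (I : Type) (r : seq I) n (f : I -> U -> R) :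
  (forall i, poly_dominated n (f i)) -> poly_dominated n (fun u => \sum_(i <- r) f i u).
Proof.
move=> fi; elim: r => [|i r IH].
  under eq_fun do rewrite big_nil.
  by apply: (@poly_dominated_le 0) => //; exact: poly_dominated_cst.
by under eq_fun do rewrite big_cons; exact: poly_dominatedD.
Qed.

Lemma poly_dominated_norm n f : poly_dominated n f -> poly_dominated n (fun u => `|f u|).
Proof. by move=> [C C0 fC]; exists C => // u; rewrite normr_id. Qed.

Lemma poly_dominated_bound n f g : (forall u, `|f u| <= `|g u|) ->
  poly_dominated n g -> poly_dominated n f.
Proof. by move=> fg [C C0 gC]; exists C => // u; exact: le_trans (gC u). Qed.

End poly_dominated.

Lemma exp4_le (R : realType) (x : R) : (1 + x) ^+ 4 <= 8 * (1 + x ^+ 4).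
Proof.
have h1 : (1 + x) ^+ 2 <= 2 * (1 + x ^+ 2) by have := sqr_ge0 (1 - x); nra.
have h2 : (1 + x ^+ 2) ^+ 2 <= 2 * (1 + x ^+ 4).
  by have := sqr_ge0 (1 - x ^+ 2); rewrite (exprM x 2 2); nra.
have h3 : (1 + x) ^+ 4 <= (2 * (1 + x ^+ 2)) ^+ 2.
  by rewrite (exprM _ 2 2) lerXn2r// ?nnegrE ?sqr_ge0// mulr_ge0// addr_ge0// sqr_ge0.
by move: h3; rewrite exprMn; lra.
Qed.

Lemma poly_dominated_even_growth (R : realType) (f : R -> R) n : (n <= 4)%N ->
  poly_dominated (fun x : R => `|x|) n f -> even_growth 2 f.
Proof.
move=> n4 /(poly_dominated_le (fun x => normr_ge0 x) n4) [C C0 fC].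
exists (8 * C) => x; rewrite (le_trans (fC x))// [8 * C]mulrC -mulrA ler_wpM2l//.
have := exp4_le `|x|; suff -> : `|x| ^+ 4 = x ^+ 4 by [].
by rewrite (exprM _ 2 2) real_normK ?num_real// -exprM.
Qed.

Section integrable_coord.
Context d (T : measurableType d) (R : realType) (P : probability T R).
Context (M : nat) (X : 'I_M -> T -> R).
Hypothesis sX : forall l, stein_variable P (X l) 1.

Local Notation norm1 := (fun x : 'I_M -> R => \sum_l `|x l|).

Lemma norm1_ge0 (x : 'I_M -> R) : 0 <= norm1 x.
Proof. exact: sumr_ge0. Qed.

(* Functions of the coordinates that stay measurable on any measurable space. *)
Definition coord_measurable (h : ('I_M -> R) -> R) :=
  forall d' (U : measurableType d') (x : 'I_M -> U -> R),
    (forall l, measurable_fun [set: U] (x l)) ->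
    measurable_fun [set: U] (fun u => h (x^~ u)).

(** The envelope is brought down to fourth moments of the coordinates: [(1 + S)^4 <= 8 (1 + S^4)]
    and, by Cauchy-Schwarz twice, [S^4] is at most [M^3] times the sum of the fourth powers. This is
    the origin of [K]. *)
Lemma integrable_poly_dominated n (h : ('I_M -> R) -> R) : (n <= 4)%N ->
  coord_measurable h -> poly_dominated norm1 n h ->
  P.-integrable [set: T] (fun w => (h (X^~ w))%:E).
Proof.
move=> n4 mh /(poly_dominated_le norm1_ge0 n4) [C C0 hC].
have mX l : measurable_fun [set: T] (X l) by have [] := sX l.
have i4 l : P.-integrable [set: T] (fun w => (X l w ^+ 4)%:E).
  have [_ iX _] := sX l.
  apply: (iX (fun x => x ^+ 4)); first exact: measurable_funX.
  apply: (@even_growth_trans _ 2) => //; exists 1 => x.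
  by rewrite mul1r ger0_norm ?lerDr// (exprM x 2 2) sqr_ge0.
have is4 : P.-integrable [set: T] (fun w => (\sum_l X l w ^+ 4)%:E).
  by under eq_fun do rewrite -sumEFin; apply: integrable_sum.
pose K := C * (8 * (1 + M%:R * (M%:R * M%:R))).
have iD : P.-integrable [set: T] (fun w => (K * (1 + \sum_l X l w ^+ 4))%:E).
  under eq_fun do rewrite EFinM EFinD.
  apply: integrableZl => //; apply: integrableD => //.
  exact: finite_measure_integrable_cst.
apply: le_integrable iD => //; first by apply/measurable_EFinP; exact: mh.
move=> w _; rewrite /= lee_fin (le_trans (hC _))// /K.
have S0 : 0 <= \sum_l X l w ^+ 4.
  by apply: sumr_ge0 => l _; rewrite (exprM _ 2 2) sqr_ge0.
rewrite ger0_norm; last first.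
  by rewrite !mulr_ge0// !addr_ge0// !mulr_ge0.
rewrite -!mulrA ler_wpM2l// (le_trans (exp4_le _))// ler_wpM2l//.
set S := \sum_l `|_|.
have SS : S ^+ 4 <= M%:R * (M%:R * M%:R) * \sum_l X l w ^+ 4.
  have h1 : S ^+ 2 <= M%:R * \sum_l X l w ^+ 2.
    apply: (le_trans (sqr_sum_le _)); rewrite ler_wpM2l//; apply: ler_sum => l _.
    by rewrite real_normK ?num_real.
  have h2 := sqr_sum_le (fun l => X l w ^+ 2).
  rewrite (exprM S 2 2); apply: (@le_trans _ _ ((M%:R * \sum_l X l w ^+ 2) ^+ 2)).
    rewrite lerXn2r// ?nnegrE ?sqr_ge0// mulr_ge0// sumr_ge0// => l _.
    exact: sqr_ge0.
  rewrite exprMn expr2 -!mulrA ler_wpM2l// ler_wpM2l//.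
  apply: (le_trans h2); rewrite ler_wpM2l//; apply: ler_sum => l _.
  by rewrite -exprM.
have M3 : 0 <= (M%:R * (M%:R * M%:R) : R) by rewrite !mulr_ge0.
nra.
Qed.

End integrable_coord.

Section gaussian_ibp.
Context d (T : measurableType d) (R : realType) (P : probability T R).
Context (M : nat) (X : 'I_M -> T -> R) (r : 'I_M -> 'I_M -> R).
Hypothesis gX : gaussian_vector P X r.
Hypothesis r_sym : forall k l, r k l = r l k.
Hypothesis r_diag : forall k, r k k = 1.

Local Notation norm1 := (fun x : 'I_M -> R => \sum_l `|x l|).

(** Since [X l = residual k l + r l k X k], [h] becomes a function of [X k] and of an independent
    tuple, to which [independent_stein] applies. For smooth [h], [dh] is the sum over [l] of [r l k]
    times the [l]-th partial derivative; stating it along lines avoids partial derivatives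
    altogether. *)
Lemma gaussian_ibp k (h dh : ('I_M -> R) -> R) :
  (forall (z : 'I_M -> R) (x : R),
    is_derive x 1 (fun x => h (fun l => z l + r l k * x)) (dh (fun l => z l + r l k * x))) ->
  (forall z : 'I_M -> R, continuous (fun x => dh (fun l => z l + r l k * x))) ->
  coord_measurable h -> coord_measurable dh ->
  poly_dominated norm1 3 h -> poly_dominated norm1 4 dh ->
  \int[P]_w (X k w * h (X^~ w)) = \int[P]_w dh (X^~ w).
Proof.
move=> hdh cdh mh mdh bh bdh.
pose Z w := [tuple residual X r k l w | l < M].
have mZ : measurable_fun [set: T] Z.
  by apply/measurable_fun_tnthP => l; apply: eq_measurable_fun (measurable_residual gX r_diag k l) => w _ /=; rewrite tnth_mktuple.
pose rec (z : M.-tuple R) (x : R) := fun l => tnth z l + r l k * x.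
have recX w : rec (Z w) (X k w) = X^~ w.
  by apply/funext => l; rewrite /rec /Z tnth_mktuple /residual subrK.
have mrec l : measurable_fun [set: M.-tuple R * R] (fun z => rec z.1 z.2 l).
  apply: measurable_funD.
    exact: (measurableT_comp (measurable_tnth l) measurable_fst).
  by apply: measurable_funM => //; exact: measurable_snd.
have growth n f y : (n <= 4)%N -> poly_dominated norm1 n f -> even_growth 2 (fun x => f (rec y x)).
  move=> n4 [C C0 fC].
  apply: (@poly_dominated_even_growth _ _ n n4).
  pose a := 1 + \sum_l (`|tnth y l| + `|r l k|).
  have s0 : 0 <= \sum_l (`|tnth y l| + `|r l k|).
    by apply: sumr_ge0 => l _; exact: addr_ge0.
  exists (C * a ^+ n) => [|x].
    by rewrite mulr_ge0// exprn_ge0// /a addr_ge0.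
  rewrite (le_trans (fC _))// -mulrA ler_wpM2l// -exprMn lerXn2r// ?nnegrE.
  - by rewrite addr_ge0// norm1_ge0.
  - by rewrite mulr_ge0// addr_ge0.
  rewrite /a mulrDl mul1r -addrA lerD2l.
  apply: (@le_trans _ _ (\sum_l (`|tnth y l| + `|r l k|) * (1 + `|x|))).
    apply: ler_sum => l _; rewrite (le_trans (ler_normD _ _))// normrM.
    by have := normr_ge0 (tnth y l); have := normr_ge0 (r l k); have := normr_ge0 x; nra.
  by rewrite mulr_suml lerDr.
have := @independent_stein _ _ _ P _ _ Z (X k) mZ (measurable_coord gX r_diag k)
  (gaussian_independent gX r_sym r_diag k) 1
  (fun z x => h (rec z x)) (fun z x => dh (rec z x)) (stein_coord gX r_diag k).
rewrite mul1r => ibp.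
transitivity (\int[P]_w (X k w * h (rec (Z w) (X k w)))).
  by apply: eq_Rintegral => w _; rewrite recX.
transitivity (\int[P]_w (dh (rec (Z w) (X k w)))); last first.
  by apply: eq_Rintegral => w _; rewrite recX.
apply: ibp.
- exact: mh.
- exact: mdh.
- by move=> y; exact: cdh.
- by move=> y; exact: growth bh.
- by move=> y; exact: growth bdh.
- under eq_fun do rewrite recX.
  apply: (integrable_poly_dominated (stein_coord gX r_diag) (n := 4) (h := fun x => x k * h x)) => //.
    by move=> d' U x mx; apply: measurable_funM => //; exact: mh.
  apply: (@poly_dominatedM _ _ _ 1 3) => //.
  apply: poly_dominated_base => // x.
  by rewrite (bigD1 k)//= lerDl sumr_ge0.
- under eq_fun do rewrite recX.
  exact: (integrable_poly_dominated (stein_coord gX r_diag) (n := 4) (h := dh)).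
Qed.

End gaussian_ibp.

Lemma Rintegral_sum d (T : measurableType d) (R : realType)
    (mu : {measure set T -> \bar R}) (I : Type) (s : seq I) (f : I -> T -> R) :
  (forall i, mu.-integrable [set: T] (fun w => (f i w)%:E)) ->
  \int[mu]_w (\sum_(i <- s) f i w) = \sum_(i <- s) \int[mu]_w f i w.
Proof.
move=> fi; have fs (s' : seq I) : mu.-integrable [set: T] (fun w => (\sum_(i <- s') f i w)%:E).
  by under eq_fun do rewrite -sumEFin; exact: integrable_sum.
elim: s => [|i s IH].
  by under eq_Rintegral do rewrite big_nil; rewrite big_nil /Rintegral integral0.
under eq_Rintegral do rewrite big_cons.
by rewrite big_cons (RintegralD measurableT (fi i) (fs s)) IH.
Qed.

(** * Wick's formula and second moments of quadratic forms *)

Section wick.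
Context d (T : measurableType d) (R : realType) (P : probability T R).
Context (M : nat) (X : 'I_M -> T -> R) (r : 'I_M -> 'I_M -> R).
Hypothesis gX : gaussian_vector P X r.
Hypothesis r_sym : forall k l, r k l = r l k.
Hypothesis r_diag : forall k, r k k = 1.

Local Notation norm1 := (fun x : 'I_M -> R => \sum_l `|x l|).
Local Notation pd := (poly_dominated norm1).

Let n0 := @norm1_ge0 R M.

Lemma poly_dominated_coord k : pd 1 (fun x => x k).
Proof.
by apply: poly_dominated_base => // x; rewrite (bigD1 k)//= lerDl sumr_ge0.
Qed.

Lemma coord_measurable_coord k : coord_measurable (fun x : 'I_M -> R => x k).
Proof. by move=> d' U x mx; exact: mx. Qed.

Lemma coord_measurable_cst c : coord_measurable (fun _ : 'I_M -> R => c).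
Proof. by move=> d' U x mx. Qed.

Lemma coord_measurableM f g : @coord_measurable R M f -> coord_measurable g ->
  coord_measurable (fun x => f x * g x).
Proof.
by move=> mf mg d' U x mx; apply: measurable_funM; [exact: mf|exact: mg].
Qed.

Lemma coord_measurableD f g : @coord_measurable R M f -> coord_measurable g ->
  coord_measurable (fun x => f x + g x).
Proof.
by move=> mf mg d' U x mx; apply: measurable_funD; [exact: mf|exact: mg].
Qed.

Lemma coord_measurable_sum (I : Type) (s : seq I) (f : I -> ('I_M -> R) -> R) :
  (forall i, coord_measurable (f i)) -> coord_measurable (fun x => \sum_(i <- s) f i x).
Proof. by move=> mf d' U x mx; apply: measurable_sum => i; exact: mf. Qed.

Lemma continuous_affine (a b : R) : continuous (fun x : R => a + b * x).
Proof.
move=> x; apply: cvgD; first exact: cvg_cst.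
by apply: cvgM; [exact: cvg_cst|exact: cvg_id].
Qed.

Lemma gaussian_cov k l : \int[P]_w (X k w * X l w) = r k l.
Proof.
have dd (z : 'I_M -> R) (x : R) : is_derive x 1 (fun x => z l + r l k * x) (r l k).
  by apply: is_derive_eq; rewrite /GRing.scale/=; ring.
rewrite (gaussian_ibp gX r_sym r_diag (h := fun x => x l) (dh := fun=> r l k) dd).
- by rewrite Rintegral_cst_prob r_sym.
- by move=> z x; exact: cvg_cst.
- exact: coord_measurable_coord.
- exact: coord_measurable_cst.
- by apply: (poly_dominated_le n0 (n := 1)) => //; exact: poly_dominated_coord.
- by apply: (poly_dominated_le n0 (n := 0)) => //; exact: poly_dominated_cst.
Qed.

Lemma integrable_coord2 k l : P.-integrable [set: T] (fun w => (X k w * X l w)%:E).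
Proof.
apply: (integrable_poly_dominated (stein_coord gX r_diag) (n := 2) (h := fun x => x k * x l)) => //.
  by apply: coord_measurableM; exact: coord_measurable_coord.
by apply: (poly_dominatedM (n := 1) (m := 1)); exact: poly_dominated_coord.
Qed.

(** One integration by parts in [X k] leaves covariances only, one term for each partner of [k]. *)
Lemma gaussian_wick4 k a b c : \int[P]_w (X k w * (X a w * (X b w * X c w))) =
  r k a * r b c + r k b * r a c + r k c * r a b.
Proof.
pose dh (x : 'I_M -> R) := r k a * (x b * x c) + (r k b * (x a * x c) + r k c * (x a * x b)).
have dd (z : 'I_M -> R) (x : R) : is_derive x 1
    (fun x => (z a + r a k * x) * ((z b + r b k * x) * (z c + r c k * x)))
    (dh (fun l => z l + r l k * x)).
  apply: is_derive_eq; rewrite /GRing.scale/= /dh (r_sym k a) (r_sym k b) (r_sym k c).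
  by ring.
rewrite (gaussian_ibp gX r_sym r_diag (h := fun x => x a * (x b * x c)) (dh := dh) dd).
- have i2 e k1 l1 : P.-integrable [set: T] (fun w => (e * (X k1 w * X l1 w))%:E).
    by under eq_fun do rewrite EFinM; apply: integrableZl => //; exact: integrable_coord2.
  have i3 : P.-integrable [set: T] (fun w => (r k b * (X a w * X c w) + r k c * (X a w * X b w))%:E).
    by under eq_fun do rewrite EFinD; apply: integrableD; [by []|exact: i2|exact: i2].
  rewrite (RintegralD measurableT (i2 _ _ _) i3) (RintegralD measurableT (i2 _ _ _) (i2 _ _ _)).
  by rewrite !(RintegralZl _ measurableT (integrable_coord2 _ _)) !gaussian_cov addrA.
- move=> z x; rewrite /dh; do ?apply: cvgD; apply: cvgM; try exact: cvg_cst;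
  by apply: cvgM; exact: continuous_affine.
- by do ?apply: coord_measurableM; exact: coord_measurable_coord.
- by do ?apply: coord_measurableD; (apply: coord_measurableM; first exact: coord_measurable_cst);
    apply: coord_measurableM; exact: coord_measurable_coord.
- by apply: (poly_dominatedM (n := 1) (m := 2)); [|apply: (poly_dominatedM (n := 1) (m := 1))];
    exact: poly_dominated_coord.
- apply: (poly_dominated_le n0 (n := 2)) => //.
  by do ?apply: poly_dominatedD; apply: poly_dominatedZ; apply: (poly_dominatedM (n := 1) (m := 1));
    exact: poly_dominated_coord.
Qed.

(** Of the three pairings in Wick's formula, the one matching [k] with [l] and [k'] with [l']
    factors into the squared mean and completes the square of the bias; the two crossed ones make up
    the variance. *)
Lemma quadratic_deviation (be : 'I_M -> 'I_M -> R) (c : R) :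
  \int[P]_w (c - \sum_k \sum_l be k l * (X k w * X l w)) ^+ 2 =
  (c - \sum_k \sum_l be k l * r k l) ^+ 2 +
  \sum_k \sum_l \sum_k' \sum_l' be k l * be k' l' * (r k k' * r l l' + r k l' * r l k').
Proof.
pose Q w := \sum_k \sum_l be k l * (X k w * X l w).
have iX2 k l : P.-integrable [set: T] (fun w => (be k l * (X k w * X l w))%:E).
  by under eq_fun do rewrite EFinM; apply: integrableZl => //; exact: integrable_coord2.
have iX2s k : P.-integrable [set: T] (fun w => (\sum_l be k l * (X k w * X l w))%:E).
  by under eq_fun do rewrite -sumEFin; apply: integrable_sum => // l _; exact: iX2.
have iQ : P.-integrable [set: T] (fun w => (Q w)%:E).
  by rewrite /Q; under eq_fun do rewrite -sumEFin; apply: integrable_sum => // l _; exact: iX2s.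
have EQ : \int[P]_w Q w = \sum_k \sum_l be k l * r k l.
  rewrite Rintegral_sum//; apply: eq_bigr => k _.
  rewrite Rintegral_sum//; apply: eq_bigr => l _.
  by rewrite RintegralZl ?gaussian_cov//; exact: integrable_coord2.
have i4 k a b e : P.-integrable [set: T] (fun w => (X k w * (X a w * (X b w * X e w)))%:E).
  apply: (integrable_poly_dominated (stein_coord gX r_diag) (n := 4) (h := fun x => x k * (x a * (x b * x e)))) => //.
    by do ?apply: coord_measurableM; exact: coord_measurable_coord.
  by apply: (poly_dominatedM (n := 1) (m := 3)); [|apply: (poly_dominatedM (n := 1) (m := 2));
    [|apply: (poly_dominatedM (n := 1) (m := 1))]]; exact: poly_dominated_coord.
have i4b k l k' l' : P.-integrable [set: T]
    (fun w => (be k l * be k' l' * (X k w * (X l w * (X k' w * X l' w))))%:E).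
  by under eq_fun do rewrite EFinM; apply: integrableZl => //; exact: i4.
have QQ w : Q w ^+ 2 = \sum_k \sum_l \sum_k' \sum_l'
    be k l * be k' l' * (X k w * (X l w * (X k' w * X l' w))).
  rewrite expr2 {1}/Q mulr_suml; apply: eq_bigr => k _.
  rewrite mulr_suml; apply: eq_bigr => l _.
  rewrite /Q mulr_sumr; apply: eq_bigr => k' _.
  by rewrite mulr_sumr; apply: eq_bigr => l' _; ring.
have is1 k l k' : P.-integrable [set: T] (fun w => (\sum_l'
    be k l * be k' l' * (X k w * (X l w * (X k' w * X l' w))))%:E).
  by under eq_fun do rewrite -sumEFin; apply: integrable_sum => // l' _; exact: i4b.
have is2 k l : P.-integrable [set: T] (fun w => (\sum_k' \sum_l'
    be k l * be k' l' * (X k w * (X l w * (X k' w * X l' w))))%:E).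
  by under eq_fun do rewrite -sumEFin; apply: integrable_sum => // k' _; exact: is1.
have is3 k : P.-integrable [set: T] (fun w => (\sum_l \sum_k' \sum_l'
    be k l * be k' l' * (X k w * (X l w * (X k' w * X l' w))))%:E).
  by under eq_fun do rewrite -sumEFin; apply: integrable_sum => // l _; exact: is2.
have iQQ : P.-integrable [set: T] (fun w => (Q w ^+ 2)%:E).
  under eq_fun do rewrite QQ -sumEFin.
  by apply: integrable_sum => // k _; exact: is3.
have EQQ : \int[P]_w Q w ^+ 2 = (\sum_k \sum_l be k l * r k l) ^+ 2 +
  \sum_k \sum_l \sum_k' \sum_l' be k l * be k' l' * (r k k' * r l l' + r k l' * r l k').
  under eq_Rintegral do rewrite QQ.
  rewrite Rintegral_sum// expr2 mulr_suml -big_split/=; apply: eq_bigr => k _.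
  rewrite Rintegral_sum// mulr_suml -big_split/=; apply: eq_bigr => l _.
  rewrite Rintegral_sum// mulr_sumr -big_split/=; apply: eq_bigr => k' _.
  rewrite Rintegral_sum// mulr_sumr -big_split/=; apply: eq_bigr => l' _.
  rewrite RintegralZl ?gaussian_wick4//; first by ring.
  exact: i4.
have icQ : P.-integrable [set: T] (fun w => (- 2 * c * Q w)%:E).
  by under eq_fun do rewrite EFinM; apply: integrableZl.
transitivity (\int[P]_w ((c ^+ 2 + - 2 * c * Q w) + Q w ^+ 2)).
  by apply: eq_Rintegral => w _; rewrite -/(Q w); ring.
have icst : P.-integrable [set: T] (fun w => (c ^+ 2)%:E) by exact: finite_measure_integrable_cst.
have i12 : P.-integrable [set: T] (fun w => (c ^+ 2 + - 2 * c * Q w)%:E).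
  by under eq_fun do rewrite EFinD; exact: integrableD.
rewrite (RintegralD measurableT i12 iQQ) (RintegralD measurableT icst icQ).
rewrite Rintegral_cst_prob (RintegralZl _ measurableT iQ) EQ EQQ.
by ring.
Qed.

End wick.

Lemma is_derive_sumr (R : realType) (I : Type) (s : seq I) (f : I -> R -> R)
    (df : I -> R) (x : R) :
  (forall i, is_derive x 1 (f i) (df i)) ->
  is_derive x 1 (fun y => \sum_(i <- s) f i y) (\sum_(i <- s) df i).
Proof.
move=> h; elim: s => [|i s IH].
  by under eq_fun do rewrite big_nil; rewrite big_nil; exact: is_derive_cst.
by under eq_fun do rewrite big_cons; rewrite big_cons; apply: is_deriveD.
Qed.

Lemma cvg_rV (R : realType) (d : nat) (T : Type) (F : set_system T) (FF : Filter F)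
    (u : T -> 'rV[R]_d) (l : 'rV[R]_d) :
  (forall i, (fun x => u x ord0 i) @ F --> l ord0 i) -> u @ F --> l.
Proof.
move=> h; apply/cvg_ballP => e e0.
have : \forall x \near F, forall i, `|l ord0 i - u x ord0 i| < e.
  apply: (@filter_forall _ _ (fun i x => `|l ord0 i - u x ord0 i| < e) F) => i.
  by have /cvgrPdist_lt := h i; exact.
by apply: filterS => x hx; split => // i j; rewrite ord1; exact: hx.
Qed.

Lemma C1_lipschitz0 (R : realType) (d : nat) (f : 'rV[R]_d -> R) (K : R) x : C1 f ->
  (forall i z, `|partial i f z| <= K) -> `|f x - f 0| <= K * \sum_i `|x ord0 i|.
Proof.
move=> f1 fK; apply: (le_trans (C1_lipschitz x 0 f1 fK)).
by under eq_bigr do rewrite mxE subr0.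
Qed.

(** * Vectors in the second Wiener chaos *)

Section chaos.
Context d (T : measurableType d) (R : realType) (P : probability T R).
Context (M n : nat) (X : 'I_M -> T -> R) (r : 'I_M -> 'I_M -> R) (al : 'I_n -> 'I_M -> R).
Hypothesis gX : gaussian_vector P X r.
Hypothesis r_sym : forall k l, r k l = r l k.
Hypothesis r_diag : forall k, r k k = 1.

Local Notation norm1 := (fun x : 'I_M -> R => \sum_l `|x l|).
Local Notation pd := (poly_dominated norm1).
Let n0 := @norm1_ge0 R M.

Definition chaos (x : 'I_M -> R) : 'rV[R]_n := \row_j \sum_l al j l * (x l ^+ 2 - 1).

Lemma chaosE x j : chaos x ord0 j = \sum_l al j l * (x l ^+ 2 - 1).
Proof. by rewrite /chaos mxE. Qed.

Lemma chaos_funE (V : Type) (u : V -> 'I_M -> R) j :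
  (fun v => chaos (u v) ord0 j) = fun v => \sum_l al j l * (u v l ^+ 2 - 1).
Proof. by apply/funext => v; rewrite chaosE. Qed.

(** These coefficients make [gram] half the scalar product of the Malliavin derivatives of the
    components [i] and [j]. Each derivative brings a factor 2, and the half is the inverse of the
    eigenvalue 2 of the number operator on the second chaos. *)
Definition gram_coef i j k l := 2 * al i k * al j l * r k l.

Definition gram i j (x : 'I_M -> R) := \sum_k \sum_l gram_coef i j k l * (x k * x l).

Lemma poly_dominated_chaos j : pd 2 (fun x => chaos x ord0 j).
Proof.
rewrite (chaos_funE id).
apply: poly_dominated_sum => // l; apply: poly_dominatedZ.
apply: poly_dominatedD; last by apply: (poly_dominated_le n0 (n := 0)) => //; exact: poly_dominated_cst.
by apply: (poly_dominatedM (n := 1) (m := 1)); exact: poly_dominated_coord.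
Qed.

Lemma coord_measurable_chaos j : coord_measurable (fun x => chaos x ord0 j).
Proof.
rewrite (chaos_funE id).
apply: coord_measurable_sum => l; apply: coord_measurableM; first exact: coord_measurable_cst.
apply: coord_measurableD; last exact: coord_measurable_cst.
by apply: coord_measurableM; exact: coord_measurable_coord.
Qed.

Lemma poly_dominated_gram i j : pd 2 (gram i j).
Proof.
apply: poly_dominated_sum => // k; apply: poly_dominated_sum => // l; apply: poly_dominatedZ.
by apply: (poly_dominatedM (n := 1) (m := 1)); exact: poly_dominated_coord.
Qed.

Lemma coord_measurable_gram i j : coord_measurable (gram i j).
Proof.
apply: coord_measurable_sum => k; apply: coord_measurable_sum => l.
apply: coord_measurableM; first exact: coord_measurable_cst.
by apply: coord_measurableM; exact: coord_measurable_coord.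
Qed.

Lemma coord_measurable_comp_chaos (g : 'rV[R]_n -> R) : continuous g ->
  coord_measurable (fun x => g (chaos x)).
Proof.
move=> cg d' U x mx; apply: (measurable_comp_continuous (Y := fun u => chaos (x^~ u))) => // j.
exact: (coord_measurable_chaos j).
Qed.

Lemma poly_dominated_comp_chaos (g : 'rV[R]_n -> R) (K : R) : C1 g ->
  (forall j y, `|partial j g y| <= K) -> pd 2 (fun x => g (chaos x)).
Proof.
move=> g1 gK.
apply: (@poly_dominated_bound _ _ _ _ _ (fun x => `|g 0| + K * \sum_j `|chaos x ord0 j|)).
  move=> x; have L := C1_lipschitz0 (chaos x) g1 gK.
  rewrite [leRHS]ger0_norm; last by rewrite addr_ge0// (le_trans _ L).
  by rewrite -[g (chaos x)](subrK (g 0)) (le_trans (ler_normD _ _))// addrC lerD2l.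
apply: poly_dominatedD; first by apply: (poly_dominated_le n0 (n := 0)) => //; exact: poly_dominated_cst.
apply: poly_dominatedZ; apply: poly_dominated_sum => // j.
exact/poly_dominated_norm/poly_dominated_chaos.
Qed.

Lemma chaos_ibp_coord (g : 'rV[R]_n -> R) (K : R) k : C1 g ->
  (forall j y, `|partial j g y| <= K) ->
  \int[P]_w (X k w * (X k w * g (chaos (X^~ w)))) =
  \int[P]_w (g (chaos (X^~ w)) +
    X k w * \sum_j partial j g (chaos (X^~ w)) * (2 * \sum_l al j l * (r l k * X l w))).
Proof.
move=> g1 gK; have [cg dg] := g1.
(* [D] is the derivative of [g(F)] in the direction [l |-> r l k], the one in which [X k] moves the
   vector when the residuals are frozen. *)
pose D (x : 'I_M -> R) := \sum_j partial j g (chaos x) * (2 * \sum_l al j l * (r l k * x l)).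
pose dh (x : 'I_M -> R) := g (chaos x) + x k * D x.
pose line (z : 'I_M -> R) (x : R) := fun l => z l + r l k * x.
have dchaos z j (x : R) : is_derive x 1 (fun x => chaos (line z x) ord0 j)
    (2 * \sum_l al j l * (r l k * line z x l)).
  rewrite (chaos_funE (line z)).
  rewrite mulr_sumr; apply: is_derive_sumr => l.
  by apply: is_derive_eq; rewrite /GRing.scale/= /line; ring.
have dgc z (x : R) : is_derive x 1 (fun x => g (chaos (line z x))) (D (line z x)).
  by apply: is_derive_C1 => // j; exact: dchaos.
have dd z (x : R) : is_derive x 1
    (fun x => line z x k * g (chaos (line z x))) (dh (line z x)).
  have dl : is_derive x 1 (fun x => line z x k) 1.
    by rewrite /line r_diag; apply: is_derive_eq; rewrite /GRing.scale/=; ring.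
  by apply: is_derive_eq; rewrite /GRing.scale/= /dh; ring.
have cline z : continuous (fun x => chaos (line z x)).
  move=> x; apply: cvg_rV => j; apply: differentiable_continuous.
  by apply/derivable1_diffP; have [] := dchaos z j x.
apply: (gaussian_ibp gX r_sym r_diag (h := fun x => x k * g (chaos x)) (dh := dh) dd).
- move=> z x; apply: cvgD.
    exact: (@continuous_comp _ _ _ (fun x => chaos (line z x)) g _ (cline z x) (cg _)).
  apply: cvgM; first exact: continuous_affine.
  apply: cvg_sumr => j; apply: cvgM.
    exact: (@continuous_comp _ _ _ (fun x => chaos (line z x)) (partial j g) _ (cline z x) ((dg j).2 _)).
  apply: cvgMr; apply: cvg_sumr => l; apply: cvgMr; apply: cvgMr; exact: continuous_affine.
- by apply: coord_measurableM; [exact: coord_measurable_coord|exact: coord_measurable_comp_chaos].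
- apply: coord_measurableD; first exact: coord_measurable_comp_chaos.
  apply: coord_measurableM; first exact: coord_measurable_coord.
  apply: coord_measurable_sum => j; apply: coord_measurableM.
    by apply: coord_measurable_comp_chaos; exact: (dg j).2.
  apply: coord_measurableM; first exact: coord_measurable_cst.
  apply: coord_measurable_sum => l; do ![apply: coord_measurableM; first exact: coord_measurable_cst].
  exact: coord_measurable_coord.
- apply: (poly_dominatedM (n := 1) (m := 2)); first exact: poly_dominated_coord.
  exact: poly_dominated_comp_chaos gK.
- apply: (poly_dominated_le n0 (n := 2)) => //; apply: poly_dominatedD.
    exact: poly_dominated_comp_chaos gK.
  apply: (poly_dominatedM (n := 1) (m := 1)); first exact: poly_dominated_coord.
  apply: poly_dominated_sum => // j; apply: (poly_dominatedM (n := 0) (m := 1)).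
    by exists `|K| => // x; rewrite expr0 mulr1 (le_trans (gK _ _))// ler_norm.
  apply: (poly_dominatedZ (n := 1)); apply: poly_dominated_sum => // l; do 2 apply: poly_dominatedZ.
  exact: poly_dominated_coord.
Qed.

(** [X k^2] is read as [X k] times the prefactor [X k]: differentiating the prefactor gives [g(F)],
    which cancels the [- 1] of [X k^2 - 1]. What is left, summed over [k] with the weights [al i k],
    is [gram]. *)
Lemma chaos_ibp (g : 'rV[R]_n -> R) (K : R) i : C1 g ->
  (forall j y, `|partial j g y| <= K) ->
  \int[P]_w (chaos (X^~ w) ord0 i * g (chaos (X^~ w))) =
  \int[P]_w (\sum_j partial j g (chaos (X^~ w)) * gram i j (X^~ w)).
Proof.
move=> g1 gK; have [cg dg] := g1.
pose gc (x : 'I_M -> R) := g (chaos x).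
pose D k (x : 'I_M -> R) := x k * \sum_j partial j g (chaos x) * (2 * \sum_l al j l * (r l k * x l)).
have pdD k : pd 2 (D k).
  apply: (poly_dominatedM (n := 1) (m := 1)); first exact: poly_dominated_coord.
  apply: poly_dominated_sum => // j; apply: (poly_dominatedM (n := 0) (m := 1)).
    by exists `|K| => // x; rewrite expr0 mulr1 (le_trans (gK _ _))// ler_norm.
  apply: poly_dominatedZ; apply: poly_dominated_sum => // l; do 2 apply: poly_dominatedZ.
  exact: poly_dominated_coord.
have mD k : coord_measurable (D k).
  apply: coord_measurableM; first exact: coord_measurable_coord.
  apply: coord_measurable_sum => j; apply: coord_measurableM.
    by apply: coord_measurable_comp_chaos; exact: (dg j).2.
  apply: coord_measurableM; first exact: coord_measurable_cst.
  apply: coord_measurable_sum => l; do ![apply: coord_measurableM; first exact: coord_measurable_cst].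
  exact: coord_measurable_coord.
have pgc : pd 2 gc by exact: poly_dominated_comp_chaos gK.
have mgc : coord_measurable gc by exact: coord_measurable_comp_chaos.
pose h k (x : 'I_M -> R) := x k * (x k * gc x).
have ph k : pd 4 (h k).
  apply: (poly_dominatedM (n := 1) (m := 3)); first exact: poly_dominated_coord.
  by apply: (poly_dominatedM (n := 1) (m := 2)); first exact: poly_dominated_coord.
have mh k : coord_measurable (h k).
  by do 2![apply: coord_measurableM; first exact: coord_measurable_coord].
have int m f : (m <= 4)%N -> coord_measurable f -> pd m f ->
    P.-integrable [set: T] (fun w => (f (X^~ w))%:E).
  exact: (integrable_poly_dominated (stein_coord gX r_diag)).
have igc := int 2 gc isT mgc pgc.
have iD k := int 2 (D k) isT (mD k) (pdD k).
have ih k := int 4 (h k) isT (mh k) (ph k).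
have ihg k : P.-integrable [set: T] (fun w => (h k (X^~ w) - gc (X^~ w))%:E).
  by under eq_fun do rewrite EFinB; exact: integrableB.
have iahg k : P.-integrable [set: T] (fun w => (al i k * (h k (X^~ w) - gc (X^~ w)))%:E).
  by under eq_fun do rewrite EFinM; exact: integrableZl.
have iaD k : P.-integrable [set: T] (fun w => (al i k * D k (X^~ w))%:E).
  by under eq_fun do rewrite EFinM; exact: integrableZl.
transitivity (\int[P]_w (\sum_k al i k * (h k (X^~ w) - gc (X^~ w)))).
  apply: eq_Rintegral => w _; rewrite chaosE mulr_suml; apply: eq_bigr => k _.
  by rewrite /h /gc; ring.
transitivity (\int[P]_w (\sum_k al i k * D k (X^~ w))); last first.
  apply: eq_Rintegral => w _; rewrite /gram /D.
  under [RHS]eq_bigr do rewrite mulr_sumr.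
  rewrite [RHS]exchange_big/=; apply: eq_bigr => k _.
  rewrite mulr_sumr mulr_sumr; apply: eq_bigr => j _.
  rewrite !mulr_sumr; apply: eq_bigr => l _.
  by rewrite /gram_coef (r_sym l k); ring.
rewrite !Rintegral_sum//; apply: eq_bigr => k _.
rewrite (RintegralZl _ measurableT (ihg k)) (RintegralZl _ measurableT (iD k)).
congr (_ * _); rewrite (RintegralB measurableT (ih k) igc).
rewrite (chaos_ibp_coord k g1 gK) (RintegralD measurableT igc (iD k)).
by rewrite addrC addKr.
Qed.

End chaos.

(** * The standard Gaussian vector *)

Section std_gaussian.
Context d (T : measurableType d) (R : realType) (P : probability T R).

Lemma std_normal_stein (Y : T -> R) : measurable_fun [set: T] Y ->
  (forall A : set R, measurable A -> P (Y @^-1` A) = normal_prob 0 1 A) ->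
  stein_variable P Y 1.
Proof.
move=> mY law.
have n1 : (1 : R) != 0 by exact: oner_neq0.
have fint (f : R -> R) : measurable_fun [set: R] f -> even_growth 3 f ->
    P.-integrable [set: T] (fun w => (f (Y w))%:E) /\
    \int[P]_w f (Y w) = \int[normal_prob 0 1]_x f x.
  move=> mf gf; apply: (@integrable_law _ _ _ P (normal_prob 0 1) Y f) => //.
  exact: integrable_normal_prob_growth.
split => // [f mf gf|f df fdf cdf gf gdf]; first by have [] := fint f mf gf.
have mf : measurable_fun [set: R] f.
  apply: continuous_measurable_fun => x; apply: differentiable_continuous.
  by apply/derivable1_diffP; have [] := fdf x.
have mdf : measurable_fun [set: R] df by exact: continuous_measurable_fun.
have gXf : even_growth 3 (fun x => x * f x).
  by have := even_growthX gf (leqnn 1); under eq_fun do rewrite expr1.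
have [_ ->] := fint (fun x => x * f x) (measurable_funM (@measurable_id _ _ _) mf) gXf.
have [_ ->] := fint df mdf (even_growth_trans (isT : (2 <= 3)%N) gdf).
have := normal_stein 0 n1 fdf cdf gf gdf.
by rewrite expr1n => <-; apply: eq_Rintegral => x _; rewrite subr0.
Qed.

Variable n : nat.
Variable N : T -> 'rV[R]_n.
Hypothesis hN : std_gaussian_vector P N.

Lemma std_gaussian_coord i : stein_variable P (fun w => N w ord0 i) 1.
Proof.
have [mN law] := hN; apply: std_normal_stein => // A mA.
have := law (fun l => if l == i then A else setT).
rewrite (bigD1 i)//= eqxx big1 ?mule1; last first.
  by move=> l /negbTE ->; exact: probability_setT.
move=> <-; last by move=> l; case: ifP.
congr (P _); apply/seteqP; split => w /=.
  by move=> Aw l; case: eqP => // ->.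
by move=> /(_ i); rewrite eqxx.
Qed.

(** The coordinate [i] is set to 0 rather than dropped, so that the others keep their indices in an
    [n]-tuple. *)
Definition erase (i l : 'I_n) (w : T) : R := if l == i then 0 else N w ord0 l.

Lemma measurable_erase i l : measurable_fun [set: T] (erase i l).
Proof.
by rewrite /erase; case: (l == i); [exact: measurable_cst|exact: hN.1].
Qed.

Let boxes (Z : 'I_n -> T -> R) : set (T -> R) :=
  [set f | exists B : 'I_n -> set R, (forall l, measurable (B l)) /\
    f = \1_[set w | forall l, B l (Z l w)]].

Lemma measurable_box (Z : 'I_n -> T -> R) (B : 'I_n -> set R) :
  (forall l, measurable_fun [set: T] (Z l)) -> (forall l, measurable (B l)) ->
  measurable [set w | forall l, B l (Z l w)].
Proof.
move=> mZ mB; rewrite (_ : [set _ | _] = \bigcap_(l in [set: 'I_n]) (Z l @^-1` B l)).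
  by apply: fin_bigcap_measurable => // l _; rewrite -[_ @^-1` _]setTI; exact: mZ.
by apply/seteqP; split => w /= h l; [move=> _; exact: h|exact: h].
Qed.

(** The law of [N] is given on boxes only. Indicators of boxes are stable under products, so the
    closure argument already used for cosines extends independence to all events of the tuple. *)
Lemma std_gaussian_independent i :
  independent_pair P (fun w => [tuple erase i l w | l < n]) (fun w => N w ord0 i).
Proof.
have [mN law] := hN.
move=> B A mB mA; set Z := fun w => _; set G := fun w => _.
have mZ : measurable_fun [set: T] Z.
  by apply/measurable_fun_tnthP => l; apply: eq_measurable_fun (measurable_erase i l) => w _ /=; rewrite tnth_mktuple.
have mZB : measurable (Z @^-1` B) by rewrite -[_ @^-1` _]setTI; exact: mZ.
have mGA : measurable (G @^-1` A) by rewrite -[_ @^-1` _]setTI; exact: mN.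
pose gen1 := boxes (erase i); pose gen2 : set (T -> R) := [set \1_(G @^-1` A)].
have ind1 (E : set T) w : `|\1_E w| <= 1 :> R.
  by rewrite indicE; case: (_ \in _); rewrite ?normr1 ?normr0.
have b1 f : gen1 f -> exists C : R, forall w, `|f w| <= C by move=> [C [_ ->]]; exists 1.
have b2 f : gen2 f -> exists C : R, forall w, `|f w| <= C by move=> ->; exists 1.
have m1 f : gen1 f -> measurable_fun [set: T] f.
  move=> [C [mC ->]]; apply: measurable_indic; apply: measurable_box => // l.
  exact: measurable_erase.
have m2 f : gen2 f -> measurable_fun [set: T] f.
  by move=> ->; exact: measurable_indic.
have ind (C : set T) : measurable C -> P C = (\int[P]_w (\1_C w : R))%:E.
  move=> mC; rewrite /Rintegral integral_indic// setIT fineK//.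
  exact: fin_num_measure.
have gen1_1 : gen1 (fun=> 1).
  exists (fun=> setT); split => //; apply/funext => w; rewrite indicE mem_set//.
have gen1_mul f g : gen1 f -> gen1 g -> bounded_closure gen1 (fun w => f w * g w).
  move=> [C [mC ->]] [D [mD ->]]; apply: bc_gen; exists (fun l => C l `&` D l).
  split; first by move=> l; exact: measurableI.
  transitivity (\1_([set w | forall l, C l (erase i l w)] `&` [set w | forall l, D l (erase i l w)]) : T -> R).
    by rewrite indicI.
  congr (\1_ _); apply/seteqP; split => w /=; first by move=> [h1 h2] l; split.
  by move=> h; split => l; have [] := h l.
have sev := sigma_algebra_closure_events b1 gen1_mul gen1_1.
have evZ l (C : set R) : measurable C -> closure_events gen1 (erase i l @^-1` C).
  move=> mC; apply: bc_gen; exists (fun l' => if l' == l then C else setT).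
  split; first by move=> l'; case: ifP.
  congr (\1_ _); apply/seteqP; split => w /=.
    by move=> Cw l'; case: eqP => // ->.
  by move=> /(_ l); rewrite eqxx.
have gen12 f g : gen1 f -> gen2 g ->
    \int[P]_w (f w * g w) = \int[P]_w f w * \int[P]_w g w.
  move=> [C [mC ->]] ->.
  set E := [set w | _].
  have mE : measurable E by apply: measurable_box => // l; exact: measurable_erase.
  have -> : \int[P]_w (\1_E w * \1_(G @^-1` A) w) = \int[P]_w (\1_(E `&` G @^-1` A) w : R).
    by apply: eq_Rintegral => w _; rewrite indicI.
  have mEG : measurable (E `&` G @^-1` A) by exact: measurableI.
  apply: EFin_inj; rewrite EFinM -!ind//.
  (* The erased coordinate is constantly 0: the box is empty if [C i] misses 0, and otherwise puts
     no condition on the coordinate [i]. *)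
  have [C0|C0] := pselect (C i 0); last first.
    have -> : E = set0.
      apply/seteqP; split => w //= /(_ i); rewrite /erase eqxx => h; exact: C0.
    by rewrite set0I measure0 mul0e.
  have EE (A' : set R) : measurable A' -> P (E `&` G @^-1` A') =
      (normal_prob 0 1 A' * \prod_(l < n | l != i) normal_prob 0 1 (C l))%E.
    move=> mA'; have := law (fun l => if l == i then A' else C l).
    rewrite (bigD1 i)//= eqxx (eq_bigr (fun l => normal_prob 0 1 (C l))); last first.
      by move=> l /negbTE ->.
    move=> <-; last by move=> l; case: ifP.
    congr (P _); apply/seteqP; split => w /=.
      move=> [Ew Gw] l; have := Ew l; rewrite /erase; case: eqP => [->|]//.
    move=> h; split; last by have := h i; rewrite eqxx.
    by move=> l; have := h l; rewrite /erase; case: eqP => [->|]//.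
  have GA : P (G @^-1` A) = normal_prob 0 1 A.
    have := law (fun l => if l == i then A else setT).
    rewrite (bigD1 i)//= eqxx big1 ?mule1; last first.
      by move=> l /negbTE ->; exact: probability_setT.
    move=> <-; last by move=> l; case: ifP.
    congr (P _); apply/seteqP; split => w /=.
      by move=> Aw l; case: eqP => // ->.
    by move=> /(_ i); rewrite eqxx.
  have ET : P E = (\prod_(l < n | l != i) normal_prob 0 1 (C l))%E.
    by have := EE setT measurableT; rewrite preimage_setT setIT => ->; rewrite probability_setT mul1e.
  by rewrite EE// ET GA muleC.
have h := @bounded_closure_uncorrelated _ _ _ P _ _ _ _ m1 m2 b1 b2 gen12
  (sigma_algebra_tuple sev evZ mB) (@bc_gen _ _ gen2 _ erefl).
rewrite (ind _ mZB) (ind _ mGA) (ind _ (measurableI _ _ mZB mGA)) -EFinM -h.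
by congr (_%:E); apply: eq_Rintegral => w _; rewrite indicI.
Qed.

Lemma integrable_std_gaussian m (h : ('I_n -> R) -> R) : (m <= 4)%N ->
  coord_measurable h -> poly_dominated (fun x => \sum_l `|x l|) m h ->
  P.-integrable [set: T] (fun w => (h (fun l => N w ord0 l))%:E).
Proof. exact: (integrable_poly_dominated std_gaussian_coord). Qed.

Lemma std_gaussian_ibp (g : 'rV[R]_n -> R) (K : R) i : C1 g ->
  (forall j y, `|partial j g y| <= K) ->
  \int[P]_w (N w ord0 i * g (N w)) = \int[P]_w partial i g (N w).
Proof.
move=> g1 gK; have [cg dg] := g1; have [mN _] := hN.
have K0 : 0 <= K by exact: le_trans (gK i 0).
pose Z w := [tuple erase i l w | l < n].
have mZ : measurable_fun [set: T] Z.
  by apply/measurable_fun_tnthP => l; apply: eq_measurable_fun (measurable_erase i l) => w _ /=; rewrite tnth_mktuple.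
pose row (z : n.-tuple R) (x : R) : 'rV[R]_n := \row_l (if l == i then x else tnth z l).
have rowN w : row (Z w) (N w ord0 i) = N w.
  apply/rowP => l; rewrite mxE /Z tnth_mktuple /erase.
  by case: eqP => [->|].
have mrow l : measurable_fun [set: n.-tuple R * R] (fun z => row z.1 z.2 ord0 l).
  rewrite /row; under eq_fun do rewrite mxE.
  case: (l == i); first exact: measurable_snd.
  exact: (measurableT_comp (measurable_tnth l) measurable_fst).
have drow z l (x : R) : is_derive x 1 (fun x => row z x ord0 l) (l == i)%:R.
  rewrite /row; under eq_fun do rewrite mxE.
  by case: (l == i); [exact: is_derive_id|exact: is_derive_cst].
have crow z : continuous (row z).
  move=> x; apply: cvg_rV => l; apply: differentiable_continuous.
  by apply/derivable1_diffP; have [] := drow z l x.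
have dgr z (x : R) : is_derive x 1 (fun x => g (row z x)) (partial i g (row z x)).
  have -> : partial i g (row z x) = \sum_l partial l g (row z x) * (l == i)%:R.
    rewrite (bigD1 i)//= eqxx mulr1 big1 ?addr0// => l /negbTE ->.
    by rewrite mulr0.
  by apply: is_derive_C1 => // l; exact: drow.
have N0 := @norm1_ge0 R n.
have pdg : poly_dominated (fun x => \sum_l `|x l|) 1 (fun x : 'I_n -> R => g (\row_l x l)).
  apply: (@poly_dominated_bound _ _ _ _ _ (fun x => `|g 0| + K * \sum_j `|x j|)).
    move=> x; have L := C1_lipschitz0 (\row_l x l) g1 gK.
    have L' : `|g (\row_l x l) - g 0| <= K * \sum_j `|x j|.
      by move: L; under eq_bigr do rewrite mxE.
    rewrite [leRHS]ger0_norm; last by rewrite addr_ge0// (le_trans _ L').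
    by rewrite -[g (\row_l x l)](subrK (g 0)) (le_trans (ler_normD _ _))// addrC lerD2l.
  apply: poly_dominatedD; first by apply: (poly_dominated_le N0 (n := 0)) => //; exact: poly_dominated_cst.
  apply: poly_dominatedZ; apply: poly_dominated_sum => // j.
  exact/poly_dominated_norm/poly_dominated_coord.
have cmc (f : 'rV[R]_n -> R) : continuous f -> coord_measurable (fun x : 'I_n -> R => f (\row_l x l)).
  move=> cf d' U x mx; apply: (measurable_comp_continuous (Y := fun u => \row_l x l u)) => // l.
  by under eq_fun do rewrite mxE; exact: mx.
have rN w : \row_l N w ord0 l = N w by apply/rowP => l; rewrite mxE.
have := @independent_stein _ _ _ P _ _ Z (fun w => N w ord0 i) mZ (mN i)
  (std_gaussian_independent i) 1
  (fun z x => g (row z x)) (fun z x => partial i g (row z x)) (std_gaussian_coord i).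
rewrite mul1r => ibp.
transitivity (\int[P]_w (N w ord0 i * g (row (Z w) (N w ord0 i)))).
  by apply: eq_Rintegral => w _; rewrite rowN.
transitivity (\int[P]_w (partial i g (row (Z w) (N w ord0 i)))); last first.
  by apply: eq_Rintegral => w _; rewrite rowN.
apply: ibp.
- by apply: measurable_comp_continuous => //.
- by apply: measurable_comp_continuous => //; exact: (dg i).2.
- move=> z x; exact: (@continuous_comp _ _ _ (row z) (partial i g) _ (crow z x) ((dg i).2 _)).
- move=> z; apply: (@poly_dominated_even_growth _ _ 1) => //.
  pose c := \sum_l `|tnth z l|.
  have c0 : 0 <= c by apply: sumr_ge0.
  exists (`|g 0| + K * (n%:R + c)); first by rewrite addr_ge0// mulr_ge0// addr_ge0.
  move=> x; rewrite -[g (row z x)](subrK (g 0)) (le_trans (ler_normD _ _))//.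
  have L := C1_lipschitz0 (row z x) g1 gK.
  have S : \sum_l `|row z x ord0 l| <= (n%:R + c) * (1 + `|x|).
    apply: (@le_trans _ _ (\sum_(l < n) (1 + `|tnth z l|) * (1 + `|x|))).
      apply: ler_sum => l _; rewrite mxE; have := normr_ge0 x; have := normr_ge0 (tnth z l).
      by case: (l == i); nra.
    by rewrite -mulr_suml big_split/= sumr_const card_ord.
  rewrite expr1 addrC mulrDl lerD//; first by rewrite ler_peMr// lerDl.
  by apply: (le_trans L); rewrite -mulrA ler_wpM2l.
- move=> z; apply: (@poly_dominated_even_growth _ _ 0) => //.
  by exists K => // x; rewrite expr0 mulr1.
- under eq_fun do rewrite rowN.
  have := @integrable_std_gaussian 2 (fun x => x i * g (\row_l x l)).
  under [in X in _ -> _ -> _ -> X]eq_fun do rewrite rN.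
  apply => //.
    by apply: coord_measurableM; [exact: coord_measurable_coord|exact: cmc].
  by apply: (poly_dominatedM (n := 1) (m := 1)) => //; exact: poly_dominated_coord.
- under eq_fun do rewrite rowN.
  apply: (@integrable_bounded _ _ _ _ _ K) => //.
  by apply: measurable_comp_continuous => //; exact: (dg i).2.
Qed.

End std_gaussian.

(** * Interpolation between F and N *)

Section C1_affine.
Context (R : realType) (d : nat).
Implicit Types (f : 'rV[R]_d -> R) (x y : 'rV[R]_d).

Lemma derivable_of_line f i x (L : R) :
  is_derive (0 : R) 1 (fun s : R => f (x + s *: delta_mx ord0 i)) L ->
  derivable f x (delta_mx ord0 i) /\ partial i f x = L.
Proof.
move=> [df DL].
have E : (fun h : R => h^-1 *: (((fun s : R => f (x + s *: delta_mx ord0 i)) \o shift 0) (h *: 1) -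
    f (x + 0 *: delta_mx ord0 i))) =
  (fun h : R => h^-1 *: ((f \o shift x) (h *: delta_mx ord0 i) - f x)).
  apply/funext => h /=; congr (_ *: (f _ - f _)); last by rewrite scale0r addr0.
  by rewrite [h *: 1]mulr1 addr0 addrC.
move: df DL; rewrite /partial /derive /derivable E => df DL.
by split.
Qed.

(** Serves the rotation path when [F] or [N] is frozen: it is then affine in the other variable. *)
Lemma C1_affine f (a : R) y : C1 f ->
  C1 (fun x => f (a *: x + y)) /\
  forall i x, partial i (fun x => f (a *: x + y)) x = a * partial i f (a *: x + y).
Proof.
move=> [cf df].
have ca : continuous (fun x : 'rV[R]_d => a *: x + y).
  move=> x; apply: (@cvg_rV _ _ _ (nbhs x) (nbhs_filter x)) => i; under eq_fun do rewrite !mxE; rewrite !mxE.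
  by apply: cvgD; [apply: cvgMr; exact: coord_continuous|exact: cvg_cst].
have D i x : derivable (fun x => f (a *: x + y)) x (delta_mx ord0 i) /\
    partial i (fun x => f (a *: x + y)) x = a * partial i f (a *: x + y).
  apply: derivable_of_line.
  pose u s := f ((a *: x + y) + s *: delta_mx ord0 i).
  have du (s : R) : is_derive s 1 u (partial i f (a *: x + y + s *: delta_mx ord0 i)).
    by apply: is_derive_line; exact: (df i).1.
  have -> : (fun s : R => f (a *: (x + s *: delta_mx ord0 i) + y)) = u \o (fun s => a * s).
    by apply/funext => s /=; rewrite /u scalerDr scalerA addrAC.
  have d2 : is_derive (0 : R) 1 (fun s => a * s) a.
    by apply: is_derive_eq; rewrite /GRing.scale/=; ring.
  have d1 : is_derive (a * 0) 1 u (partial i f (a *: x + y)).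
    by have := du (a * 0); rewrite mulr0 scale0r addr0.
  by have := @is_derive1_comp _ u (fun s => a * s) 0 _ _ d1 d2; rewrite mulrC.
split; last by move=> i x; have [] := D i x.
split=> [x|i].
  exact: (@continuous_comp _ _ _ (fun x => a *: x + y) f _ (ca x) (cf _)).
split=> [x|x]; first by have [] := D i x.
rewrite (_ : partial i _ = fun x => a * partial i f (a *: x + y)).
  apply: cvgMr; first exact: (nbhs_filter x).
  exact: (@continuous_comp _ _ _ (fun x => a *: x + y) (partial i f) _ (ca x) ((df i).2 _)).
by apply/funext => z; have [] := D i z.
Qed.

End C1_affine.

Section product_expectation.
Context d d' (T : measurableType d) (T' : measurableType d') (R : realType).
Context (P : probability T R) (P' : probability T' R).

Lemma integrable_fst (f : T -> R) : P.-integrable [set: T] (fun w => (f w)%:E) ->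
  (P \x P')%E.-integrable [set: T * T'] (fun z => (f z.1)%:E).
Proof.
move=> /[dup] fi /integrableP[mf foo].
apply/integrable12ltyP; first exact: (measurableT_comp mf measurable_fst).
under eq_integral => x _ do rewrite /= integral_cst//= probability_setT mule1.
exact: foo.
Qed.

Lemma integrable_snd (f : T' -> R) : P'.-integrable [set: T'] (fun w => (f w)%:E) ->
  (P \x P')%E.-integrable [set: T * T'] (fun z => (f z.2)%:E).
Proof.
move=> /[dup] fi /integrableP[mf foo].
apply/integrable21ltyP; first exact: (measurableT_comp mf measurable_snd).
under eq_integral => x _ do rewrite /= integral_cst//= probability_setT mule1.
exact: foo.
Qed.

Lemma Rintegral_prod21 (f : T * T' -> R) :
  (P \x P')%E.-integrable [set: T * T'] (fun z => (f z)%:E) ->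
  (forall y, P.-integrable [set: T] (fun x => (f (x, y))%:E)) ->
  \int[(P \x P')%E]_z f z = \int[P']_y \int[P]_x f (x, y).
Proof.
move=> fi fy; rewrite /Rintegral -(integral21_prod_meas1 fi); congr fine.
apply: eq_integral => y _; rewrite /fubini_G fineK//.
exact: integrable_fin_num (fy y).
Qed.

Lemma Rintegral_prod12 (f : T * T' -> R) :
  (P \x P')%E.-integrable [set: T * T'] (fun z => (f z)%:E) ->
  (forall x, P'.-integrable [set: T'] (fun y => (f (x, y))%:E)) ->
  \int[(P \x P')%E]_z f z = \int[P]_x \int[P']_y f (x, y).
Proof.
move=> fi fx; rewrite /Rintegral -(integral12_prod_meas1 fi); congr fine.
apply: eq_integral => x _; rewrite /fubini_F fineK//.
exact: integrable_fin_num (fx x).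
Qed.

End product_expectation.

Lemma mxE_lincomb (R : pzRingType) (n : nat) (a b : R) (x y : 'rV[R]_n) k :
  (a *: x + b *: y) ord0 k = a * x ord0 k + b * y ord0 k.
Proof. by rewrite !mxE. Qed.

Section interpolation.
Context d d' (T : measurableType d) (T' : measurableType d') (R : realType).
Context (P : probability T R) (P' : probability T' R).
Context (M n : nat) (X : 'I_M -> T -> R) (r : 'I_M -> 'I_M -> R).
Context (al : 'I_n -> 'I_M -> R) (N : T' -> 'rV[R]_n) (phi : 'rV[R]_n -> R).
Hypothesis gX : gaussian_vector P X r.
Hypothesis r_sym : forall k l, r k l = r l k.
Hypothesis r_diag : forall k, r k k = 1.
Hypothesis hN : std_gaussian_vector P' N.
Hypothesis phi2 : C2 phi.
Hypothesis hess : (hessian_norm phi <= 1)%E.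

Let F (w : T) := chaos al (X^~ w).
Let Gr i j (w : T) := gram r al i j (X^~ w).
Let path (th : R) (z : T * T') := cos th *: F z.1 + sin th *: N z.2.
Let PP := (P \x P')%E.
Let A (w : T) := \sum_k `|F w ord0 k|.
Let B (w' : T') := \sum_k `|N w' ord0 k|.

Let mX l : measurable_fun [set: T] (X l).
Proof. exact: measurable_coord gX r_diag l. Qed.

Let mF k : measurable_fun [set: T] (fun w => F w ord0 k).
Proof. exact: (coord_measurable_chaos al k mX). Qed.

Let mN k : measurable_fun [set: T'] (fun w => N w ord0 k).
Proof. exact: hN.1. Qed.

Let iP m (h : ('I_M -> R) -> R) : (m <= 4)%N -> coord_measurable h ->
  poly_dominated (fun x => \sum_l `|x l|) m h ->
  P.-integrable [set: T] (fun w => (h (X^~ w))%:E).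
Proof. exact: (integrable_poly_dominated (stein_coord gX r_diag)). Qed.

Let iA2 : P.-integrable [set: T] (fun w => (A w ^+ 2)%:E).
Proof.
apply: (iP (m := 4) (h := fun x => (\sum_k `|chaos al x ord0 k|) ^+ 2)) => //.
  move=> e U x mx; apply: measurable_funX; apply: measurable_sum => k.
  by apply: measurableT_comp => //; exact: coord_measurable_chaos.
have S : poly_dominated (fun x => \sum_l `|x l|) 2 (fun x : 'I_M -> R => \sum_k `|chaos al x ord0 k|).
  apply: poly_dominated_sum; first exact: norm1_ge0.
  by move=> k; exact/poly_dominated_norm/poly_dominated_chaos.
exact: (poly_dominatedM S S).
Qed.

Let iB2 : P'.-integrable [set: T'] (fun w => (B w ^+ 2)%:E).
Proof.
apply: (integrable_std_gaussian hN (m := 2) (h := fun x => (\sum_k `|x k|) ^+ 2)) => //.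
  move=> e U x mx; apply: measurable_funX; apply: measurable_sum => k.
  by apply: measurableT_comp => //; exact: mx.
have S : poly_dominated (fun x => \sum_l `|x l|) 1 (fun x : 'I_n -> R => \sum_k `|x k|).
  by apply: poly_dominated_base => x; rewrite ger0_norm// sumr_ge0.
exact: (poly_dominatedM S S).
Qed.

Let A_ge0 w : 0 <= A w. Proof. exact: sumr_ge0. Qed.
Let B_ge0 w : 0 <= B w. Proof. exact: sumr_ge0. Qed.

(* Square-integrable envelope for the integrands on the product space. *)
Let env (D : R) (z : T * T') := D * (1 + A z.1 ^+ 2 + B z.2 ^+ 2).

Let iEnv D : PP.-integrable [set: T * T'] (fun z => (env D z)%:E).
Proof.
rewrite /env; under eq_fun do rewrite EFinM !EFinD.
apply: integrableZl => //; apply: integrableD => //; last exact: (integrable_snd P iB2).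
apply: integrableD => //; last exact: (integrable_fst P' iA2).
exact: (integrable_fst P' (f := fun=> 1) (finite_measure_integrable_cst P 1 measurableT)).
Qed.

Let iEnv1 D y : P.-integrable [set: T] (fun x => (env D (x, y))%:E).
Proof.
rewrite /env; under eq_fun do rewrite EFinM !EFinD.
apply: integrableZl => //; apply: integrableD => //.
  by apply: integrableD => //; exact: (finite_measure_integrable_cst P 1 measurableT).
exact: (finite_measure_integrable_cst P (B y ^+ 2) measurableT).
Qed.

Let iEnv2 D x : P'.-integrable [set: T'] (fun y => (env D (x, y))%:E).
Proof.
rewrite /env; under eq_fun do rewrite EFinM !EFinD.
apply: integrableZl => //; apply: integrableD => //.
apply: integrableD => //; first exact: (finite_measure_integrable_cst P' 1 measurableT).
exact: (finite_measure_integrable_cst P' (A x ^+ 2) measurableT).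
Qed.

Let dominated (f : T * T' -> R) (D : R) : measurable_fun [set: T * T'] f ->
  (forall z, `|f z| <= env D z) ->
  [/\ PP.-integrable [set: T * T'] (fun z => (f z)%:E),
      forall y, P.-integrable [set: T] (fun x => (f (x, y))%:E)
    & forall x, P'.-integrable [set: T'] (fun y => (f (x, y))%:E)].
Proof.
move=> mf fD; split => [|y|x].
- apply: le_integrable (iEnv D) => //; first exact/measurable_EFinP.
  by move=> z _; rewrite /= lee_fin (le_trans (fD z))// ler_norm.
- apply: le_integrable (iEnv1 D y) => //.
    apply/measurable_EFinP; exact: (measurableT_comp mf (measurable_pair2 y)).
  by move=> z _; rewrite /= lee_fin (le_trans (fD (z, y)))// ler_norm.
- apply: le_integrable (iEnv2 D x) => //.
    apply/measurable_EFinP; exact: (measurableT_comp mf (measurable_pair1 x)).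
  by move=> z _; rewrite /= lee_fin (le_trans (fD (x, z)))// ler_norm.
Qed.

Let mpath th k : measurable_fun [set: T * T'] (fun z => path th z ord0 k).
Proof.
rewrite /path; under eq_fun do rewrite mxE_lincomb.
apply: measurable_funD; apply: measurable_funM => //.
  exact: (measurableT_comp (mF k) measurable_fst).
exact: (measurableT_comp (mN k) measurable_snd).
Qed.

Let mcomp (f : 'rV[R]_n -> R) th : continuous f ->
  measurable_fun [set: T * T'] (fun z => f (path th z)).
Proof. by move=> cf; apply: measurable_comp_continuous => //; exact: mpath. Qed.

Let cos1 (th : R) : `|cos th| <= 1. Proof. by rewrite ler_norml cos_geN1 cos_le1. Qed.
Let sin1 (th : R) : `|sin th| <= 1. Proof. by rewrite ler_norml sin_geN1 sin_le1. Qed.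

Let path_le th z : \sum_k `|path th z ord0 k| <= A z.1 + B z.2.
Proof.
rewrite /A /B -big_split/=; apply: ler_sum => k _; rewrite mxE_lincomb.
by rewrite (le_trans (ler_normD _ _))// lerD// normrM ler_piMl.
Qed.

Let F_le w k : `|F w ord0 k| <= A w.
Proof. by rewrite /A (bigD1 k)//= lerDl sumr_ge0. Qed.

Let N_le w k : `|N w ord0 k| <= B w.
Proof. by rewrite /B (bigD1 k)//= lerDl sumr_ge0. Qed.

Let hess_le i j z : `|partial i (partial j phi) z| <= 1.
Proof. exact: hessian_norm_le1. Qed.

Let Psi th := \int[PP]_z phi (path th z).

Let pathD th z i := - sin th * F z.1 ord0 i + cos th * N z.2 ord0 i.

Let dpsi th z := \sum_i partial i phi (path th z) * pathD th z i.

Let is_derive_path z (th : R) : is_derive th 1 (fun t => phi (path t z)) (dpsi th z).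
Proof.
apply: is_derive_C1; first exact: phi2.1.
move=> i; rewrite /path; under eq_fun do rewrite mxE_lincomb.
by apply: is_derive_eq; rewrite /GRing.scale/= /pathD; ring.
Qed.

Lemma interpolation_integrable0 (th : R) :
  [/\ PP.-integrable [set: T * T'] (fun z => (phi (path th z))%:E),
      forall y, P.-integrable [set: T] (fun x => (phi (path th (x, y)))%:E)
    & forall x, P'.-integrable [set: T'] (fun y => (phi (path th (x, y)))%:E)].
Proof.
have [C C0 hC] := C2_growth phi2 hess.
apply: (@dominated (fun z => phi (path th z)) (2 * C)) => [|z].
  by apply: mcomp; exact: phi2.1.1.
apply: (le_trans (hC _).2).
have p0 : 0 <= \sum_k `|path th z ord0 k| by apply: sumr_ge0.
have := path_le th z; have := A_ge0 z.1; have := B_ge0 z.2; rewrite /env.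
set S := \sum_k _ in p0 *; set a := A _; set b := B _ => b0 a0 Sab.
have S2 : S ^+ 2 <= 2 * (a ^+ 2 + b ^+ 2) by have := sqr_ge0 (a - b); nra.
rewrite [2 * C]mulrC -mulrA ler_wpM2l//; lra.
Qed.

Let deviation i j (x : 'I_M -> R) := (i == j)%:R - gram r al i j x.

Let measurable_deviation i j : coord_measurable (deviation i j).
Proof. by move=> e U x mx; apply: measurable_funB => //; exact: coord_measurable_gram. Qed.

Let dominated_deviation i j : poly_dominated (fun x => \sum_l `|x l|) 2 (deviation i j).
Proof.
apply: poly_dominatedD.
  by apply: (poly_dominated_le (@norm1_ge0 R M) (n := 0)) => //; exact: poly_dominated_cst.
apply: (@poly_dominated_bound _ _ _ _ _ (gram r al i j)); last exact: poly_dominated_gram.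
by move=> x; rewrite normrN.
Qed.

Let integrable_deviation i j : P.-integrable [set: T] (fun w => ((i == j)%:R - Gr i j w)%:E).
Proof. exact: (iP (m := 2) (h := deviation i j)). Qed.

Let integrable_norm_deviation i j :
  P.-integrable [set: T] (fun w => (`|(i == j)%:R - Gr i j w|)%:E).
Proof. exact: integrable_norm (integrable_deviation i j). Qed.

Lemma interpolation_integrable (th : R) : PP.-integrable [set: T * T']
  (fun z => (\sum_i \sum_j partial j (partial i phi) (path th z) * ((i == j)%:R - Gr i j z.1))%:E).
Proof.
have [phi1 phi2'] := phi2.
have ij i j : PP.-integrable [set: T * T']
    (fun z => (partial j (partial i phi) (path th z) * ((i == j)%:R - Gr i j z.1))%:E).
  apply: (le_integrable measurableT _ _ (integrable_fst P' (integrable_deviation i j))).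
    apply/measurable_EFinP; apply: measurable_funM; first by apply: mcomp; exact: ((phi2' i).2 j).2.
    apply: measurable_funB => //; apply: (measurableT_comp _ measurable_fst).
    exact: coord_measurable_gram.
  by move=> z _; rewrite /= lee_fin normrM ler_piMl.
under eq_fun do rewrite -sumEFin; apply: integrable_sum => // i _.
by under eq_fun do rewrite -sumEFin; apply: integrable_sum.
Qed.

(** Differentiating the path gives [- sin th] times the terms in [F] and [cos th] times the terms in
    [N]. Integration by parts in [F] then brings a factor [cos th] and [gram], the one in [N] a
    factor [sin th] and the diagonal second derivatives, hence the common factor [sin th cos th]. *)
Lemma interpolation_derive (th : R) : is_derive th 1 Psi
  (sin th * cos th * \int[PP]_z
    \sum_i \sum_j partial j (partial i phi) (path th z) * ((i == j)%:R - Gr i j z.1)).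
Proof.
have [C C0 hC] := C2_growth phi2 hess.
have [phi1 phi2'] := phi2; have [cphi dphi] := phi1.
(* For one coordinate, [(C + a + b)(a + b) <= 4 (C + 1)(1 + a^2 + b^2)] with [a] and [b] the norms
   of [F] and [N]. The factor [1 + n] lets one envelope bound a single coordinate as well as the sum
   of all [n]. *)
pose D := 4 * (C + 1) * (1 + n%:R).
have D0 : 0 <= D by rewrite !mulr_ge0// addr_ge0.
have env_ge (c : R) z : c <= 4 * (C + 1) * (1 + A z.1 ^+ 2 + B z.2 ^+ 2) -> c <= env D z.
  move=> h; apply: (le_trans h); rewrite /env /D ler_wpM2r//.
    by rewrite !addr_ge0// sqr_ge0.
  by rewrite ler_peMr ?lerDl// mulr_ge0// addr_ge0.
have iphi th' : PP.-integrable [set: T * T'] (fun z => (phi (path th' z))%:E).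
  by have [] := interpolation_integrable0 th'.
have parb th' z i (u : R) : `|u| <= A z.1 + B z.2 ->
    `|partial i phi (path th' z) * u| <= 4 * (C + 1) * (1 + A z.1 ^+ 2 + B z.2 ^+ 2).
  move=> ub; rewrite normrM.
  have p0 : 0 <= \sum_k `|path th' z ord0 k| by apply: sumr_ge0.
  have := (hC (path th' z)).1 i; have := path_le th' z; have := A_ge0 z.1; have := B_ge0 z.2.
  move: ub; set S := \sum_k _ in p0 *; set a := A _; set b := B _; set q := partial _ _ _.
  move=> ub b0 a0 Sab hq.
  apply: (@le_trans _ _ ((C + (a + b)) * (a + b))).
    by apply: ler_pM => //; rewrite (le_trans hq)// lerD2l.
  have S2 : (a + b) ^+ 2 <= 2 * (a ^+ 2 + b ^+ 2) by have := sqr_ge0 (a - b); nra.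
  have S1 : a + b <= 1 + a ^+ 2 + b ^+ 2 by have := sqr_ge0 (a - 1); have := sqr_ge0 (b - 1); nra.
  have CS := ler_wpM2l C0 S1.
  have a2 := sqr_ge0 a; have b2 := sqr_ge0 b.
  have Ca := mulr_ge0 C0 a2; have Cb := mulr_ge0 C0 b2.
  rewrite mulrDl -expr2; lra.
have dpsi_le th' z : `|dpsi th' z| <= env D z.
  rewrite /dpsi (le_trans (ler_norm_sum _ _ _))// /env.
  apply: (@le_trans _ _ (\sum_(i < n) 4 * (C + 1) * (1 + A z.1 ^+ 2 + B z.2 ^+ 2))).
    apply: ler_sum => i _; apply: parb; rewrite /pathD.
    rewrite (le_trans (ler_normD _ _))// !normrM normrN lerD//.
      by rewrite (le_trans _ (F_le z.1 i))// ler_piMl.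
    by rewrite (le_trans _ (N_le z.2 i))// ler_piMl.
  rewrite sumr_const card_ord -[leLHS]mulr_natl mulrA ler_wpM2r//.
    by rewrite !addr_ge0// sqr_ge0.
  by rewrite /D mulrC ler_wpM2l ?lerDr// mulr_ge0// addr_ge0.
have env0 z : 0 <= env D z by rewrite mulr_ge0// !addr_ge0// sqr_ge0.
have Ith : (`]th - 1, th + 1[)%classic th by rewrite /= in_itv/= gtrBl ltrDl ltr01.
have p1E (x : R) z : partial1of2 (fun t z => phi (path t z)) x z = dpsi x z.
  by rewrite /partial1of2 derive1E; have [] := is_derive_path z x.
have cond1 (x : R) : (`]th - 1, th + 1[)%classic x ->
    PP.-integrable [set: T * T'] (EFin \o (fun z => phi (path x z))) by move=> _; exact: iphi.
have cond2 (x : R) z : (`]th - 1, th + 1[)%classic x -> [set: T * T'] z ->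
    derivable (fun t : R => phi (path t z)) x 1.
  by move=> _ _; have [] := is_derive_path z x.
have cond3 (x : R) z : (`]th - 1, th + 1[)%classic x -> [set: T * T'] z ->
    `|partial1of2 (fun t z => phi (path t z)) x z| <= env D z.
  by move=> _ _; rewrite p1E.
have DD := derivable_under_integral measurableT Ith cond1 cond2 env0 (iEnv D) cond3.
have EE := differentiation_under_integral measurableT Ith cond1 cond2 env0 (iEnv D) cond3.
apply: DeriveDef; first exact: DD.
rewrite -derive1E EE.
transitivity (\int[PP]_z dpsi th z); first by apply: eq_Rintegral => z _; rewrite p1E.
(* Gaussian integration by parts in each factor of the product space *)
have mdphi i : measurable_fun [set: T * T'] (fun z => partial i phi (path th z)).
  by apply: mcomp; exact: (dphi i).2.
have mddphi i j : measurable_fun [set: T * T'] (fun z => partial j (partial i phi) (path th z)).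
  by apply: mcomp; exact: ((phi2' i).2 j).2.
have mF1 i : measurable_fun [set: T * T'] (fun z => F z.1 ord0 i).
  exact: (measurableT_comp (mF i) measurable_fst).
have mN2 i : measurable_fun [set: T * T'] (fun z => N z.2 ord0 i).
  exact: (measurableT_comp (mN i) measurable_snd).
have mGr i j : measurable_fun [set: T] (Gr i j) by exact: coord_measurable_gram.
have envF i z : `|partial i phi (path th z) * F z.1 ord0 i| <= env D z.
  by apply/env_ge/parb; rewrite (le_trans (F_le z.1 i))// lerDl.
have envN i z : `|partial i phi (path th z) * N z.2 ord0 i| <= env D z.
  by apply/env_ge/parb; rewrite (le_trans (N_le z.2 i))// lerDr.
have domF i := dominated (measurable_funM (mdphi i) (mF1 i)) (envF i).
have domN i := dominated (measurable_funM (mdphi i) (mN2 i)) (envN i).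
have iGr i j : P.-integrable [set: T] (fun w => (Gr i j w)%:E).
  by apply: (iP (m := 2) (h := gram r al i j)) => //; [exact: coord_measurable_gram|exact: poly_dominated_gram].
pose v i j z := partial j (partial i phi) (path th z) * Gr i j z.1.
have mv i j : measurable_fun [set: T * T'] (v i j).
  by apply: measurable_funM; [exact: mddphi|exact: (measurableT_comp (mGr i j) measurable_fst)].
have v_le i j z : `|v i j z| <= `|Gr i j z.1|.
  by rewrite /v normrM ler_piMl.
have iv i j : PP.-integrable [set: T * T'] (fun z => (v i j z)%:E).
  apply: le_integrable (integrable_fst P' (iGr i j)) => //; first exact/measurable_EFinP.
  by move=> z _; rewrite /= lee_fin.
have iv1 i j y : P.-integrable [set: T] (fun x => (v i j (x, y))%:E).
  apply: le_integrable (iGr i j) => //.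
    by apply/measurable_EFinP; exact: (measurableT_comp (mv i j) (measurable_pair2 y)).
  by move=> z _; rewrite /= lee_fin v_le.
pose V i z := \sum_j v i j z.
have iV i : PP.-integrable [set: T * T'] (fun z => (V i z)%:E).
  by rewrite /V; under eq_fun do rewrite -sumEFin; apply: integrable_sum.
have iV1 i y : P.-integrable [set: T] (fun x => (V i (x, y))%:E).
  by rewrite /V; under eq_fun do rewrite -sumEFin; apply: integrable_sum.
pose W i z := partial i (partial i phi) (path th z).
have iW i : PP.-integrable [set: T * T'] (fun z => (W i z)%:E).
  have mW : measurable_fun [set: T * T'] (fun z => (W i z)%:E) by apply/measurable_EFinP; exact: mddphi.
  have i1 := integrable_fst P' (finite_measure_integrable_cst P 1 measurableT).
  apply: (le_integrable measurableT mW _ i1) => z _.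
  by rewrite /= lee_fin normr1; exact: hess_le.
have iW2 i x : P'.-integrable [set: T'] (fun y => (W i (x, y))%:E).
  apply: (@integrable_bounded _ _ _ _ _ 1) => [|y]; last exact: hess_le.
  exact: (measurableT_comp (mddphi i i) (measurable_pair1 x)).
have sec1 (c : R) (f : T * T' -> R) : (forall y, P.-integrable [set: T] (fun x => (f (x, y))%:E)) ->
    forall y, P.-integrable [set: T] (fun x => (c * f (x, y))%:E).
  by move=> fy y; under eq_fun do rewrite EFinM; exact: integrableZl.
have sec2 (c : R) (f : T * T' -> R) : (forall x, P'.-integrable [set: T'] (fun y => (f (x, y))%:E)) ->
    forall x, P'.-integrable [set: T'] (fun y => (c * f (x, y))%:E).
  by move=> fy y; under eq_fun do rewrite EFinM; exact: integrableZl.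
have scl (c : R) (f : T * T' -> R) : PP.-integrable [set: T * T'] (fun z => (f z)%:E) ->
    PP.-integrable [set: T * T'] (fun z => (c * f z)%:E).
  by move=> fy; under eq_fun do rewrite EFinM; exact: integrableZl.
(* [N] is frozen and the inner integral runs over [F] alone. There [g] is [partial i phi] composed
   with an affine map of slope [cos th], so its partial derivatives are still bounded by 1. *)
have intF i : \int[PP]_z (partial i phi (path th z) * F z.1 ord0 i) = cos th * \int[PP]_z V i z.
  have [i1 i2 _] := domF i.
  rewrite -(RintegralZl _ measurableT (iV i)).
  rewrite (Rintegral_prod21 i1 i2) (Rintegral_prod21 (scl _ _ (iV i)) (sec1 _ _ (iV1 i))).
  apply: eq_Rintegral => y _.
  pose g (x : 'rV[R]_n) := partial i phi (cos th *: x + sin th *: N y).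
  have [g1 pg] := C1_affine (cos th) (sin th *: N y) (phi2' i).
  have gK j x : `|partial j g x| <= 1.
    by rewrite pg normrM mulr_ile1//; exact: hess_le.
  transitivity (\int[P]_x (F x ord0 i * g (F x))).
    by apply: eq_Rintegral => x _; rewrite mulrC.
  rewrite (chaos_ibp al gX r_sym r_diag i g1 gK); apply: eq_Rintegral => x _.
  rewrite /V mulr_sumr; apply: eq_bigr => j _.
  by rewrite pg /v mulrA.
have intN i : \int[PP]_z (partial i phi (path th z) * N z.2 ord0 i) = sin th * \int[PP]_z W i z.
  have [i1 _ i2] := domN i.
  rewrite -(RintegralZl _ measurableT (iW i)).
  rewrite (Rintegral_prod12 i1 i2) (Rintegral_prod12 (scl _ _ (iW i)) (sec2 _ _ (iW2 i))).
  apply: eq_Rintegral => w _.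
  pose g (x : 'rV[R]_n) := partial i phi (sin th *: x + cos th *: F w).
  have [g1 pg] := C1_affine (sin th) (cos th *: F w) (phi2' i).
  have gK j x : `|partial j g x| <= 1.
    by rewrite pg normrM mulr_ile1//; exact: hess_le.
  transitivity (\int[P']_y (N y ord0 i * g (N y))).
    by apply: eq_Rintegral => y _; rewrite mulrC /g addrC.
  rewrite (std_gaussian_ibp hN i g1 gK); apply: eq_Rintegral => y _.
  by rewrite pg /W addrC.
transitivity (\int[PP]_z \sum_i (- sin th * (partial i phi (path th z) * F z.1 ord0 i) +
    cos th * (partial i phi (path th z) * N z.2 ord0 i))).
  apply: eq_Rintegral => z _; rewrite /dpsi; apply: eq_bigr => i _.
  by rewrite /pathD; ring.
have iFs i : PP.-integrable [set: T * T'] (fun z => (- sin th * (partial i phi (path th z) * F z.1 ord0 i))%:E).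
  by apply: scl; have [] := domF i.
have iNs i : PP.-integrable [set: T * T'] (fun z => (cos th * (partial i phi (path th z) * N z.2 ord0 i))%:E).
  by apply: scl; have [] := domN i.
transitivity (sin th * cos th * \int[PP]_z \sum_i (W i z - V i z)); last first.
  congr (_ * _); apply: eq_Rintegral => z _; apply: eq_bigr => i _.
  rewrite /W /V (bigD1 i)//= [RHS](bigD1 i)//= eqxx /v.
  rewrite opprD addrA -sumrN; congr (_ + _); first by rewrite mulrBr mulr1.
  by apply: eq_bigr => j /negbTE ji; rewrite eq_sym ji sub0r mulrN.
have iWV i : PP.-integrable [set: T * T'] (fun z => (W i z - V i z)%:E).
  by under eq_fun do rewrite EFinB; exact: integrableB.
rewrite !Rintegral_sum//; last first.
  by move=> i; under eq_fun do rewrite EFinD; exact: integrableD.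
rewrite mulr_sumr; apply: eq_bigr => i _.
have [i1 _ _] := domF i; have [i2 _ _] := domN i.
rewrite (RintegralD measurableT (iFs i) (iNs i)) (RintegralB measurableT (iW i) (iV i)).
rewrite (RintegralZl _ measurableT i1) (RintegralZl _ measurableT i2) intF intN.
by ring.
Qed.

(** The path goes from [F] at angle 0 to [N] at angle [pi / 2], and the derivative of [Psi] is at
    most [D] in absolute value. The factor 2 bounds the length [pi / 2] of the interval in the mean
    value theorem. *)
Lemma interpolation_bound :
  `|\int[P]_w phi (F w) - \int[P']_w phi (N w)| <=
  2 * \sum_i \sum_j \int[P]_w `|(i == j)%:R - Gr i j w|.
Proof.
set D := \sum_i \sum_j _.
have D0 : 0 <= D by apply: sumr_ge0 => i _; apply: sumr_ge0 => j _; exact: Rintegral_ge0.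
have dle (th : R) : `|sin th * cos th * \int[PP]_z
    \sum_i \sum_j partial j (partial i phi) (path th z) * ((i == j)%:R - Gr i j z.1)| <= D.
  rewrite !normrM -[leRHS]mul1r ler_pM//; first by rewrite mulr_ile1.
  have := interpolation_integrable th; set f := fun z => _ => fi.
  apply: (le_trans (le_normr_Rintegral measurableT fi)).
  have ig i j : PP.-integrable [set: T * T'] (fun z => (`|(i == j)%:R - Gr i j z.1|)%:E).
    exact: (integrable_fst P' (integrable_norm_deviation i j)).
  have ig2 i : PP.-integrable [set: T * T'] (fun z => (\sum_j `|(i == j)%:R - Gr i j z.1|)%:E).
    by under eq_fun do rewrite -sumEFin; apply: integrable_sum.
  have ig3 : PP.-integrable [set: T * T'] (fun z => (\sum_i \sum_j `|(i == j)%:R - Gr i j z.1|)%:E).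
    by under eq_fun do rewrite -sumEFin; apply: integrable_sum.
  have -> : D = \int[PP]_z \sum_i \sum_j `|(i == j)%:R - Gr i j z.1|.
    rewrite Rintegral_sum//; apply: eq_bigr => i _.
    rewrite Rintegral_sum//; apply: eq_bigr => j _.
    rewrite (Rintegral_prod12 (ig i j)).
      by apply: eq_Rintegral => w _; rewrite /= Rintegral_cst_prob.
    by move=> w; exact: (finite_measure_integrable_cst P' (`|(i == j)%:R - Gr i j w|) measurableT).
  apply: le_Rintegral => //; first by have := integrable_norm fi.
  move=> z _; rewrite /f (le_trans (ler_norm_sum _ _ _))//; apply: ler_sum => i _.
  rewrite (le_trans (ler_norm_sum _ _ _))//; apply: ler_sum => j _.
  by rewrite normrM ler_piMl.
have cPsi : {within `[0, pi / 2 : R], continuous Psi}.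
  apply: continuous_subspaceT => th; apply: differentiable_continuous.
  by apply/derivable1_diffP; have [] := interpolation_derive th.
have [iphi _ sphi] := interpolation_integrable0 0.
have [iphi' sphi' _] := interpolation_integrable0 (pi / 2).
have Psi0 : Psi 0 = \int[P]_w phi (F w).
  rewrite /Psi (Rintegral_prod12 iphi sphi); apply: eq_Rintegral => w _.
  rewrite /path cos0 sin0 /=; under eq_Rintegral do rewrite scale1r scale0r addr0.
  by rewrite Rintegral_cst_prob.
have Psi1 : Psi (pi / 2) = \int[P']_w phi (N w).
  rewrite /Psi (Rintegral_prod21 iphi' sphi'); apply: eq_Rintegral => w _.
  rewrite /path cos_pihalf sin_pihalf /=; under eq_Rintegral do rewrite scale1r scale0r add0r.
  by rewrite Rintegral_cst_prob.
have pih : 0 <= pi / 2 :> R by rewrite divr_ge0 ?pi_ge0.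
have [xi _ E] := MVT_segment pih (fun x _ => interpolation_derive x) cPsi.
rewrite -Psi0 -Psi1 distrC E subr0 normrM mulrC ler_pM//.
by rewrite ger0_norm// ltW// pihalf_lt2.
Qed.

Lemma integrable_interpolation_ends :
  P.-integrable [set: T] (fun w => (phi (F w))%:E) /\
  P'.-integrable [set: T'] (fun w => (phi (N w))%:E).
Proof.
have [_ iF _] := interpolation_integrable0 0.
have [_ _ iN] := interpolation_integrable0 (pi / 2).
split.
  have := iF point; congr (P.-integrable _ _); apply/funext => w.
  by rewrite /path cos0 sin0 /= scale1r scale0r addr0.
have := iN point; congr (P'.-integrable _ _); apply/funext => w.
by rewrite /path cos_pihalf sin_pihalf /= scale1r scale0r add0r.
Qed.

(** [e] bounds the bias and [q] the standard deviation, so the second moment is at most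
    [e^2 + q^2 <= (e + q)^2]. *)
Lemma gram_deviation i j (e q : R) : 0 <= e -> 0 <= q ->
  `|(i == j)%:R - \sum_k \sum_l gram_coef r al i j k l * r k l| <= e ->
  \sum_k \sum_l \sum_k' \sum_l' gram_coef r al i j k l * gram_coef r al i j k' l' *
    (r k k' * r l l' + r k l' * r l k') <= q ^+ 2 ->
  \int[P]_w `|(i == j)%:R - Gr i j w| <= e + q.
Proof.
move=> e0 q0 he hq.
have i1 := integrable_norm_deviation i j.
have i2 : P.-integrable [set: T] (fun w => (((i == j)%:R - Gr i j w) ^+ 2)%:E).
  apply: (iP (m := 4) (h := fun x => deviation i j x ^+ 2)) => //.
    by move=> d0 U x mx; apply: measurable_funX; exact: measurable_deviation.
  exact: poly_dominatedM (dominated_deviation i j) (dominated_deviation i j).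
have E2 : \int[P]_w ((i == j)%:R - Gr i j w) ^+ 2 <= (e + q) ^+ 2.
  rewrite (quadratic_deviation gX r_sym r_diag (gram_coef r al i j) (i == j)%:R).
  rewrite (le_trans (lerD (_ : _ <= e ^+ 2) hq))//; last by nra.
  by rewrite -real_normK ?num_real// lerXn2r ?nnegrE.
(* [e + q] may be 0; the slack [x] provides a positive [S] to divide by. *)
apply/ler_addgt0Pl => x x0; rewrite addrC.
set S := e + q + x.
have S0 : 0 < S by rewrite /S ltr_wpDl// addr_ge0.
have E3 : \int[P]_w ((i == j)%:R - Gr i j w) ^+ 2 <= S ^+ 2.
  have eS : e + q <= S by rewrite /S lerDl ltW.
  have eq0 : 0 <= e + q by rewrite addr_ge0.
  by rewrite (le_trans E2)// lerXn2r// nnegrE ltW.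
have i3 : P.-integrable [set: T]
    (fun w => (S / 2 + (2 * S)^-1 * ((i == j)%:R - Gr i j w) ^+ 2)%:E).
  under eq_fun do rewrite EFinD [((2 * S)^-1 * _)%:E]EFinM.
  apply: integrableD => //; last exact: integrableZl.
  exact: finite_measure_integrable_cst.
(* Cauchy-Schwarz in the form [|Y| <= S / 2 + Y ^ 2 / (2 S)] *)
apply: (@le_trans _ _ (\int[P]_w (S / 2 + (2 * S)^-1 * ((i == j)%:R - Gr i j w) ^+ 2))).
  apply: le_Rintegral => // w _; set y := _ - _.
  have -> : S / 2 + (2 * S)^-1 * y ^+ 2 = (2 * S)^-1 * (S ^+ 2 + y ^+ 2).
    by field; rewrite gt_eqF.
  rewrite ler_pdivlMl ?mulr_gt0// -[y ^+ 2]real_normK ?num_real//.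
  by have := sqr_ge0 (S - `|y|); nra.
have i4 : P.-integrable [set: T] (fun w => ((2 * S)^-1 * ((i == j)%:R - Gr i j w) ^+ 2)%:E).
  by under eq_fun do rewrite EFinM; exact: integrableZl.
have i5 : P.-integrable [set: T] (fun=> (S / 2)%:E) by exact: finite_measure_integrable_cst.
rewrite (RintegralD measurableT i5 i4) (RintegralZl _ measurableT i2).
rewrite Rintegral_cst_prob -lerBrDl ler_pdivrMl ?mulr_gt0// (le_trans E3)//.
by rewrite le_eqVlt; apply/orP; left; apply/eqP; field.
Qed.

End interpolation.

(** * Covariance sums of fractional Brownian increments *)

Section bernoulli.
Context (R : realType).
Implicit Types a e x y : R.

Lemma bernoulli_le e y : 0 <= e -> e <= 1 -> 0 <= 1 + y -> (1 + y) `^ e <= 1 + e * y.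
Proof.
move=> e0 e1; rewrite le_eqVlt => /predU1P[y0|y0].
  have -> : y = -1 by lra.
  rewrite subrr mulrN1; have [->|en] := eqVneq e 0; first by rewrite powRr0 subr0.
  by rewrite powR0// subr_ge0.
have z0 : 0 < 1 + e * y.
  have := mulr_ge0 e0 (ltW y0); move: (e1); rewrite le_eqVlt => /predU1P[->|]; lra.
set z := 1 + e * y in z0 *.
have l (u : R) : 0 < u -> ln u <= u - 1.
  by move=> u0; have := expR_ge1Dx (ln u); rewrite lnK ?posrE//; lra.
(* Concavity of [ln]: the tangent bound at [z], averaged with weights [e] and [1 - e]. *)
have h1 := l _ (divr_gt0 y0 z0); have h2 : ln z^-1 <= z^-1 - 1 by apply: l; rewrite invr_gt0.
rewrite ln_div ?posrE// in h1; rewrite lnV ?posrE// in h2.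
have h3 : e * ln (1 + y) <= ln z.
  have e' : 0 <= 1 - e by lra.
  have := lerD (ler_wpM2l e0 h1) (ler_wpM2l e' h2).
  have -> : e * ((1 + y) / z - 1) + (1 - e) * (z^-1 - 1) = (1 + e * y) / z - 1.
    by field; rewrite gt_eqF.
  by rewrite divff ?gt_eqF// subrr; lra.
have -> : (1 + y) `^ e = expR (e * ln (1 + y)) by rewrite /powR gt_eqF.
by rewrite -[leRHS](@lnK _ z) ?posrE// ler_expR.
Qed.

(** This is [bernoulli_le] with the exponent [1 / a], taken at [(1 + y)^a - 1]. *)
Lemma bernoulli_ge a y : 1 <= a -> 0 <= 1 + y -> 1 + a * y <= (1 + y) `^ a.
Proof.
move=> a1 y0; have a0 : 0 < a by apply: lt_le_trans a1.
have ai : a^-1 <= 1 by rewrite invf_le1.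
have := @bernoulli_le a^-1 ((1 + y) `^ a - 1).
rewrite invr_ge0 (ltW a0) ai addrC subrK powR_ge0 => /(_ isT isT isT).
rewrite -powRrM divff ?gt_eqF// powRr1// -lerBlDl ler_pdivlMl//.
by lra.
Qed.

(** Symmetric second difference of [t^a] at 1 with step [x]: the form that [rho] takes once [m^a] is
    factored out. *)
Definition second_diff a x := (1 + x) `^ a + (1 - x) `^ a - 2.

Lemma second_diff_ge0 a x : 1 <= a -> 0 <= x -> x <= 1 -> 0 <= second_diff a x.
Proof.
move=> a1 x0 x1; have p0 : 0 <= 1 + x by lra.
have m0 : 0 <= 1 + - x by lra.
have := bernoulli_ge a1 p0; have := bernoulli_ge a1 m0.
by rewrite /second_diff mulrN; lra.
Qed.

Lemma second_diff_le0 a x : 0 < a -> a <= 1 -> 0 <= x -> x <= 1 -> second_diff a x <= 0.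
Proof.
move=> a0 a1 x0 x1; have p0 : 0 <= 1 + x by lra.
have m0 : 0 <= 1 + - x by lra.
have := bernoulli_le (ltW a0) a1 p0; have := bernoulli_le (ltW a0) a1 m0.
by rewrite /second_diff mulrN; lra.
Qed.

(** For [a >= 1], Bernoulli at the exponent [a - 1] in [(1 + x)(1 + x)^(a - 1)], and likewise at
    [- x], gives [2 (a - 1) x^2], at most [x^2] because [a <= 3/2]. For [a < 1],
    [(1 + x)^a = (1 + x) / (1 + x)^b] with [b = 1 - a], and Bernoulli in the denominator reduces the
    claim to [2 b (1 - b) <= 1 - b^2], that is [(1 - b)^2 >= 0]. *)
Lemma norm_second_diff a x : 0 < a -> a <= 3 / 2 -> 0 <= x -> x <= 1 ->
  `|second_diff a x| <= x ^+ 2.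
Proof.
move=> a0 a32 x0 x1; have p0 : 0 <= 1 + x by lra.
have m0 : 0 <= 1 + - x by lra.
have [a1|/ltW a1] := leP 1 a.
  rewrite ger0_norm ?second_diff_ge0// /second_diff.
  have b0 : 0 <= a - 1 by lra. have b1 : a - 1 <= 1 by lra.
  have := ler_wpM2l p0 (bernoulli_le b0 b1 p0).
  have := ler_wpM2l m0 (bernoulli_le b0 b1 m0).
  rewrite !mulr_powRB1//; nra.
rewrite ler0_norm ?second_diff_le0// /second_diff.
pose b := 1 - a; have b0 : 0 <= b by rewrite /b; lra. have b1 : b < 1 by rewrite /b; lra.
have inv y : 0 <= 1 + y -> 0 < 1 + b * y -> (1 + y) / (1 + b * y) <= (1 + y) `^ a.
  move=> y0 by0; rewrite ler_pdivrMr//.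
  have := ler_wpM2l (powR_ge0 (1 + y) a) (bernoulli_le b0 (ltW b1) y0).
  rewrite -powRD; last by rewrite /b; apply/implyP => /eqP; lra.
  by have -> : a + b = 1; [rewrite /b; ring|rewrite powRr1].
have bx : b * x < 1 by nra.
have d1 : 0 < 1 + b * x by nra.
have d2 : 0 < 1 + b * - x by rewrite mulrN; lra.
have := lerD (inv x p0 d1) (inv (- x) m0 d2).
have -> : (1 + x) / (1 + b * x) + (1 + - x) / (1 + b * - x) =
    2 - 2 * b * (1 - b) * x ^+ 2 / (1 - (b * x) ^+ 2).
  by field; rewrite !gt_eqF//; nra.
have d3 : 0 < 1 - (b * x) ^+ 2 by nra.
suff : 2 * b * (1 - b) * x ^+ 2 / (1 - (b * x) ^+ 2) <= x ^+ 2 by lra.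
rewrite ler_pdivrMr// [leRHS]mulrC ler_wpM2r ?sqr_ge0//.
have : (b * x) ^+ 2 <= b ^+ 2 by rewrite exprMn ler_piMr ?sqr_ge0// expr_le1.
have := sqr_ge0 (1 - b); nra.
Qed.

(** Squaring removes the fractional powers: with [u], [v] the square roots of [1 + x], [1 - x] and
    [p = u v], [(u^3 + v^3)^2 = 2 + 6 x^2 + 2 p^3]. As [p^3 >= p^4 = (1 - x^2)^2], this is at least
    [4 + 2 x^2 + 2 x^4], which exceeds [(2 + 2 x^2 / 5)^2] with room to spare. *)
Lemma second_diff_critical x : 0 <= x -> x <= 1 ->
  2 / 5 * x ^+ 2 <= second_diff (3 / 2) x.
Proof.
move=> x0 x1; have p0 : 0 <= 1 + x by lra.
have m0 : 0 <= 1 - x by lra.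
have cube (y : R) : 0 <= y -> (y `^ (3 / 2)) = Num.sqrt y ^+ 3.
  move=> y0; rewrite mulrC powRrM powR12_sqrt// powR_mulrn// sqrtr_ge0.
rewrite /second_diff !cube//.
set u := Num.sqrt (1 + x); set v := Num.sqrt (1 - x).
have u0 : 0 <= u by exact: sqrtr_ge0.
have v0 : 0 <= v by exact: sqrtr_ge0.
have u2 : u ^+ 2 = 1 + x by exact: sqr_sqrtr.
have v2 : v ^+ 2 = 1 - x by exact: sqr_sqrtr.
pose p := u * v; have pp : 0 <= p by exact: mulr_ge0.
have p2 : p ^+ 2 = 1 - x ^+ 2 by rewrite exprMn u2 v2; ring.
have p1 : p <= 1 by nra.
have p34 : p ^+ 4 <= p ^+ 3 by rewrite exprS ler_piMl// exprn_ge0.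
have sq : (u ^+ 3 + v ^+ 3) ^+ 2 = 2 + 6 * x ^+ 2 + 2 * p ^+ 3.
  have -> : (u ^+ 3 + v ^+ 3) ^+ 2 = (u ^+ 2) ^+ 3 + (v ^+ 2) ^+ 3 + 2 * p ^+ 3 by rewrite /p; ring.
  by rewrite u2 v2; ring.
have p4 : p ^+ 4 = (1 - x ^+ 2) ^+ 2 by rewrite (exprM p 2 2) p2.
have s0 : 0 <= u ^+ 3 + v ^+ 3 by rewrite addr_ge0// exprn_ge0.
have : (2 + 2 / 5 * x ^+ 2) ^+ 2 <= (u ^+ 3 + v ^+ 3) ^+ 2.
  rewrite sq; have := sqr_ge0 x; have := sqr_ge0 (x ^+ 2); move: (x ^+ 2) p34 p4 => y; nra.
have x2 := sqr_ge0 x.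
rewrite ler_pXn2r// ?nnegrE//; last by nra.
by lra.
Qed.

End bernoulli.

(** * The covariance sequence of unit increments *)

Section increment_covariance.
Context (R : realType).
Implicit Types a : R.

(* Covariance of two unit increments at distance [m] when [a = 2H]. *)
Definition rho a (m : nat) : R :=
  2^-1 * (m.+1%:R `^ a + `|m%:R - 1| `^ a - 2 * m%:R `^ a).

Lemma rho0 a : 0 < a -> rho a 0 = 1.
Proof.
by move=> a0; rewrite /rho sub0r normrN normr1 !powR1 powR0 ?gt_eqF//; lra.
Qed.

Lemma rhoS a m : rho a m.+1 = 2^-1 * (m.+2%:R `^ a + m%:R `^ a - 2 * m.+1%:R `^ a).
Proof. by rewrite /rho -[X in `|X - 1|]natr1 addrK ger0_norm. Qed.

Lemma rhoE a m : (0 < m)%N -> rho a m = 2^-1 * m%:R `^ a * second_diff a m%:R^-1.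
Proof.
case: m => // m _; rewrite rhoS /second_diff.
have m0 : 0 < m.+1%:R :> R by rewrite ltr0n.
have i0 : 0 <= m.+1%:R^-1 :> R by rewrite invr_ge0 ltW.
have i1 : m.+1%:R^-1 <= 1 :> R by rewrite invf_le1// ler1n.
have -> : m.+2%:R `^ a = m.+1%:R `^ a * (1 + m.+1%:R^-1) `^ a.
  rewrite -powRM ?(ltW m0) ?addr_ge0//; congr (_ `^ _).
  by rewrite mulrDr divff ?gt_eqF// mulr1 -natr1.
have -> : m%:R `^ a = m.+1%:R `^ a * (1 - m.+1%:R^-1) `^ a.
  rewrite -powRM ?(ltW m0) ?subr_ge0//; congr (_ `^ _).
  by rewrite mulrBr divff ?gt_eqF// mulr1 -natr1 addrK.
by ring.
Qed.

Lemma mul_norm_rho a m : 0 < a -> a <= 3 / 2 -> (0 < m)%N ->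
  m%:R * `|rho a m| <= 2^-1 * m%:R `^ (a - 1).
Proof.
move=> a0 a32 m0; rewrite rhoE//.
have mr : 0 < m%:R :> R by rewrite ltr0n.
have i1 : m%:R^-1 <= 1 :> R by rewrite invf_le1// ler1n.
have i0 : 0 <= m%:R^-1 :> R by rewrite invr_ge0.
rewrite normrM ger0_norm ?mulr_ge0 ?powR_ge0//.
rewrite mulrA.
have := ler_wpM2l (powR_ge0 m%:R a) (norm_second_diff a0 a32 i0 i1).
set s := `|_| => h.
apply: (@le_trans _ _ (2^-1 * m%:R * (m%:R `^ a * m%:R^-1 ^+ 2))).
  have -> : m%:R * (2^-1 * m%:R `^ a) * s = 2^-1 * m%:R * (m%:R `^ a * s) by ring.
  by rewrite ler_wpM2l// mulr_ge0// ltW.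
have -> : m%:R `^ a = m%:R * m%:R `^ (a - 1) :> R by rewrite mulr_powRB1// ltW.
by rewrite le_eqVlt; apply/orP; left; apply/eqP; field; rewrite gt_eqF.
Qed.

Lemma rho_ge0 a m : 1 <= a -> (0 < m)%N -> 0 <= rho a m.
Proof.
move=> a1 m0; rewrite rhoE// !mulr_ge0 ?powR_ge0 ?second_diff_ge0//.
by rewrite invf_le1 ?ler1n ?ltr0n.
Qed.

Lemma rho_le0 a m : 0 < a -> a <= 1 -> (0 < m)%N -> rho a m <= 0.
Proof.
move=> a0 a1 m0; rewrite rhoE// mulr_ge0_le0 ?mulr_ge0 ?powR_ge0 ?second_diff_le0//.
by rewrite invf_le1 ?ler1n ?ltr0n.
Qed.

(** 25 is the inverse square of [1/2] times [2/5], and [m^3 m^(-4)] leaves [1 / m]. *)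
Lemma rho_critical m : (0 < m)%N -> (25 * m%:R)^-1 <= rho (3 / 2) m ^+ 2.
Proof.
move=> m0; rewrite rhoE//.
have mr : 0 < m%:R :> R by rewrite ltr0n.
have i1 : m%:R^-1 <= 1 :> R by rewrite invf_le1// ler1n.
have i0 : 0 <= m%:R^-1 :> R by rewrite invr_ge0.
have h := second_diff_critical i0 i1.
have -> : (25 * m%:R)^-1 = (2^-1 * m%:R `^ (3 / 2) * (2 / 5 * m%:R^-1 ^+ 2)) ^+ 2 :> R.
  rewrite !exprMn -[(_ `^ _) ^+ 2]powR_mulrn ?powR_ge0// -powRrM.
  have -> : 3 / 2 * 2%:R = 3%:R :> R by field.
  by rewrite powR_mulrn//; field; rewrite gt_eqF.
rewrite lerXn2r ?nnegrE ?mulr_ge0 ?powR_ge0 ?exprn_ge0//.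
  by rewrite (le_trans _ h)// mulr_ge0// exprn_ge0.
by rewrite ler_wpM2l// mulr_ge0// powR_ge0.
Qed.

Lemma sum_rho a M : 0 < a ->
  \sum_(1 <= m < M.+1) rho a m = 2^-1 * (M.+1%:R `^ a - M%:R `^ a - 1).
Proof.
move=> a0; elim: M => [|M IH].
  by rewrite big_nil powR1 powR0 ?gt_eqF// subr0 subrr mulr0.
by rewrite big_nat_recr//= IH rhoS; ring.
Qed.

(** Away from 0, [rho] has a constant sign, that of [a - 1], so the absolute values come out and the
    sum telescopes. For [a >= 1] Bernoulli bounds [(M + 1)^a - M^a] by [a (M + 1)^(a - 1)], where
    [a / 2 <= 1]; for [a <= 1] the total is at most [1/2]. *)
Lemma sum_norm_rho a M : 0 < a -> a <= 3 / 2 -> (0 < M)%N ->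
  \sum_(1 <= m < M) `|rho a m| <= M%:R `^ Num.max (a - 1) 0.
Proof.
case: M => // M a0 a32 _; have MR : 0 < M.+1%:R :> R by rewrite ltr0n.
have [a1|/ltW a1] := leP 1 a.
  rewrite max_l ?subr_ge0//.
  rewrite big_nat (eq_bigr (rho a)); last by move=> m /andP[m0 _]; rewrite ger0_norm// rho_ge0.
  rewrite -big_nat sum_rho//.
  have -> : M.+1%:R `^ a = M.+1%:R * M.+1%:R `^ (a - 1) :> R by rewrite mulr_powRB1// ltW.
  have p : 0 <= 1 + - M.+1%:R^-1 :> R by rewrite subr_ge0 invf_le1// ler1n.
  have := ler_wpM2l (powR_ge0 M.+1%:R a) (bernoulli_ge a1 p).
  rewrite -powRM ?(ltW MR)//.
  have -> : M.+1%:R * (1 + - M.+1%:R^-1) = M%:R :> R.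
    by rewrite mulrDr mulrN divff ?gt_eqF// mulr1 -natr1 addrK.
  have -> : M.+1%:R `^ a * (1 + a * - M.+1%:R^-1) = M.+1%:R `^ a - a * M.+1%:R `^ (a - 1) :> R.
    by rewrite -[M.+1%:R `^ a]mulr_powRB1 ?(ltW MR)//; field; rewrite gt_eqF.
  rewrite -[M.+1%:R `^ a]mulr_powRB1 ?(ltW MR)//.
  have := powR_ge0 (M.+1%:R : R) (a - 1).
  by set y := _ `^ (a - 1); nra.
rewrite max_r ?subr_le0// powRr0.
rewrite big_nat (eq_bigr (fun m => - rho a m)); last by move=> m /andP[m0 _]; rewrite ler0_norm// rho_le0.
rewrite -big_nat sumrN sum_rho//.
have : M%:R `^ a <= M.+1%:R `^ a :> R by rewrite ge0_ler_powR ?(ltW a0) ?nnegrE ?ler_nat.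
by lra.
Qed.

Lemma mul_norm_rho_le a m M : 0 < a -> a <= 3 / 2 -> (0 < m)%N -> (m <= M)%N ->
  m%:R * `|rho a m| <= M%:R `^ Num.max (a - 1) 0.
Proof.
move=> a0 a32 m0 mM; apply: (le_trans (mul_norm_rho a0 a32 m0)).
have m1 : 1 <= m%:R :> R by rewrite ler1n.
apply: (@le_trans _ _ (m%:R `^ Num.max (a - 1) 0)).
  have : m%:R `^ (a - 1) <= m%:R `^ Num.max (a - 1) 0 by rewrite ler_powR// le_max lexx.
  have := powR_ge0 (m%:R : R) (a - 1); lra.
by rewrite ge0_ler_powR ?nnegrE ?ler_nat// le_max lexx orbT.
Qed.

(** One factor, [m |rho|], is bounded by [M^b] throughout the range; the other, [|rho|], is summed,
    to at most [M^b] again. *)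
Lemma weighted_sum_rho a M : 0 < a -> a <= 3 / 2 -> (0 < M)%N ->
  \sum_(1 <= m < M) m%:R * rho a m ^+ 2 <= M%:R `^ (2 * Num.max (a - 1) 0).
Proof.
move=> a0 a32 M0; set b := Num.max _ _.
apply: (@le_trans _ _ (\sum_(1 <= m < M) M%:R `^ b * `|rho a m|)).
  rewrite big_nat [leRHS]big_nat; apply: ler_sum => m /andP[m0 mM].
  rewrite -real_normK ?num_real// expr2 mulrA ler_wpM2r//.
  by apply: mul_norm_rho_le => //; exact: ltnW.
rewrite -mulr_sumr mulrC [in leRHS]mulrC powRrM powR_mulrn ?powR_ge0// expr2.
by rewrite ler_wpM2r ?powR_ge0// sum_norm_rho.
Qed.

End increment_covariance.

(** * Sums of a function of the distance over blocks of indices *)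

Section toeplitz.
Context (R : realType).
Implicit Types (c : nat -> R) (m n L q k l : nat).

Definition absdiff k l := (k - l + (l - k))%N.

Lemma absdiffC k l : absdiff k l = absdiff l k.
Proof. by rewrite /absdiff addnC. Qed.

Lemma absdiff_lt k l : (k < l)%N -> absdiff k l = (l - k)%N.
Proof. by move=> kl; rewrite /absdiff (eqP (ltnW kl : (k - l == 0)%N)). Qed.

Definition toeplitz_sum c m := \sum_(0 <= k < m) \sum_(0 <= l < m) c (absdiff k l).

Lemma sum_reflect c k : \sum_(0 <= l < k) c (absdiff k l) = \sum_(1 <= r < k.+1) c r.
Proof.
rewrite big_nat_rev/= big_add1/= [LHS]big_nat [RHS]big_nat; apply: eq_bigr => l /andP[_ lk].
by rewrite add0n absdiffC absdiff_lt ?subKn// ltn_subrL ltn0Sn (leq_ltn_trans _ lk).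
Qed.

Lemma toeplitz_sumS c m :
  toeplitz_sum c m.+1 = toeplitz_sum c m + 2 * (\sum_(1 <= r < m.+1) c r) + c 0.
Proof.
rewrite /toeplitz_sum big_nat_recr//=.
have -> : \sum_(0 <= k < m) \sum_(0 <= l < m.+1) c (absdiff k l) =
    \sum_(0 <= k < m) \sum_(0 <= l < m) c (absdiff k l) + \sum_(1 <= r < m.+1) c r.
  rewrite -sum_reflect -big_split/=; apply: eq_bigr => k _.
  by rewrite big_nat_recr//= (absdiffC m k).
rewrite [X in _ + X = _]big_nat_recr//= sum_reflect [absdiff m m]addnn subnn.
by ring.
Qed.

(** Counting by diagonals: the distance [r] occurs [2 (m - r)] times. Truncated subtraction kills
    the terms [r >= m], so sums for different [m] can be compared over one range [L]. *)
Lemma toeplitz_sumE c m L : (m <= L)%N ->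
  toeplitz_sum c m = m%:R * c 0 + 2 * \sum_(1 <= r < L) (m - r)%:R * c r.
Proof.
elim: m => [_|m IH mL].
  rewrite /toeplitz_sum big_nil mul0r add0r big1 ?mulr0// => r _.
  by rewrite sub0n mul0r.
rewrite toeplitz_sumS IH; last exact: ltnW.
have -> : \sum_(1 <= r < L) (m.+1 - r)%:R * c r =
    \sum_(1 <= r < L) (m - r)%:R * c r + \sum_(1 <= r < m.+1) c r.
  have sp := big_cat_nat (isT : (1 <= m.+1)%N) mL.
  rewrite !sp/= addrAC; congr (_ + _); last first.
    rewrite [LHS]big_nat [RHS]big_nat; apply: eq_bigr => r /andP[mr _].
    have -> : (m.+1 - r = 0)%N by apply/eqP; rewrite subn_eq0.
    by have -> : (m - r = 0)%N by apply/eqP; rewrite subn_eq0 ltnW.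
  rewrite -big_split/= [LHS]big_nat [RHS]big_nat; apply: eq_bigr => r /andP[_ rm].
  by rewrite subSn// -natr1; ring.
by rewrite -natr1; ring.
Qed.

Lemma toeplitz_sum_ge c m : c 0 = 1 -> (forall r, 0 <= c r) -> m%:R <= toeplitz_sum c m.
Proof.
move=> c0 cp; rewrite (toeplitz_sumE c (leqnn m)) c0 mulr1 lerDl mulr_ge0// sumr_ge0// => r _.
by rewrite mulr_ge0.
Qed.

Definition weighted_sum c L := \sum_(1 <= r < L) r%:R * c r.

Lemma weighted_sum_ge0 c L : (forall r, 0 <= c r) -> 0 <= weighted_sum c L.
Proof. by move=> cp; apply: sumr_ge0 => r _; rewrite mulr_ge0. Qed.

Lemma natr_subn_bound m r : m%:R - r%:R <= (m - r)%:R :> R /\ (m - r)%:R <= m%:R :> R.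
Proof.
split; last by rewrite ler_nat leq_subr.
by have [rm|mr] := leqP r m; [rewrite natrB|rewrite (eqP (ltnW mr : (m - r == 0)%N)) subr_le0 ler_nat ltnW].
Qed.

(** At distance [r] the coefficient [(m - r) - D (n - r)], with truncated subtractions, differs from
    [m - D n] by at most [(1 + D) r]; the remaining error 1 is at most [r]. *)
Lemma toeplitz_deviation c m n L (D : R) : c 0 = 1 -> (forall r, 0 <= c r) -> 0 <= D ->
  (m <= L)%N -> (n <= L)%N -> `|m%:R - D * n%:R| <= 1 ->
  `|toeplitz_sum c m - D * toeplitz_sum c n| <= 1 + 2 * (2 + D) * weighted_sum c L.
Proof.
move=> c0 cp D0 mL nL mn; rewrite (toeplitz_sumE c mL) (toeplitz_sumE c nL) c0 !mulr1.
have -> : m%:R + 2 * (\sum_(1 <= r < L) (m - r)%:R * c r) -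
    D * (n%:R + 2 * (\sum_(1 <= r < L) (n - r)%:R * c r)) =
    (m%:R - D * n%:R) + 2 * \sum_(1 <= r < L) ((m - r)%:R - D * (n - r)%:R) * c r.
  have -> : \sum_(1 <= r < L) ((m - r)%:R - D * (n - r)%:R) * c r =
      \sum_(1 <= r < L) (m - r)%:R * c r - D * \sum_(1 <= r < L) (n - r)%:R * c r.
    by rewrite mulr_sumr -sumrB; apply: eq_bigr => r _; ring.
  by ring.
rewrite (le_trans (ler_normD _ _))// lerD// normrM ger0_norm// -mulrA ler_wpM2l//.
rewrite (le_trans (ler_norm_sum _ _ _))// /weighted_sum mulr_sumr.
rewrite big_nat [leRHS]big_nat; apply: ler_sum => r /andP[r1 _].
rewrite normrM [`|c r|]ger0_norm// mulrA ler_wpM2r//.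
have r1' : 1 <= r%:R :> R by rewrite ler1n.
have [h1 h2] := natr_subn_bound m r; have [h3 h4] := natr_subn_bound n r.
have h5 := ler_wpM2l D0 h3; have h6 := ler_wpM2l D0 h4.
move: mn; rewrite !ler_norml => /andP[h7 h8].
by apply/andP; split; nra.
Qed.

Lemma toeplitz_shift c a b : (a <= b)%N ->
  \sum_(a <= k < b) \sum_(a <= l < b) c (absdiff k l) = toeplitz_sum c (b - a).
Proof.
move=> ab; rewrite /toeplitz_sum -{1}[a]add0n big_addn; apply: eq_bigr => k _.
rewrite -{1}[a]add0n big_addn; apply: eq_bigr => l _.
by congr (c _); rewrite /absdiff !subnDr.
Qed.

(** Twice this block is what the sum over [L] indices has beyond the two diagonal blocks of sizes
    [q] and [L - q]. Pairs at distance [r] on either side of a cut number at most [r]. *)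
Lemma toeplitz_offdiag c q L : (forall r, 0 <= c r) -> (q <= L)%N ->
  \sum_(0 <= k < q) \sum_(q <= l < L) c (absdiff k l) <= weighted_sum c L.
Proof.
move=> cp qL.
have E : toeplitz_sum c L = toeplitz_sum c q + toeplitz_sum c (L - q) +
    2 * \sum_(0 <= k < q) \sum_(q <= l < L) c (absdiff k l).
  rewrite -toeplitz_shift// {1}/toeplitz_sum (big_cat_nat (leq0n q) qL)/=.
  have -> : \sum_(0 <= k < q) \sum_(0 <= l < L) c (absdiff k l) =
      toeplitz_sum c q + \sum_(0 <= k < q) \sum_(q <= l < L) c (absdiff k l).
    by rewrite /toeplitz_sum -big_split/=; apply: eq_bigr => k _; exact: big_cat_nat.
  have -> : \sum_(q <= k < L) \sum_(0 <= l < L) c (absdiff k l) =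
      \sum_(0 <= k < q) \sum_(q <= l < L) c (absdiff k l) +
      \sum_(q <= k < L) \sum_(q <= l < L) c (absdiff k l).
    rewrite [X in _ = X + _]exchange_big_nat/= -big_split/=; apply: eq_bigr => k _.
    rewrite (big_cat_nat (leq0n q) qL)/=; congr (_ + _).
    by apply: eq_bigr => l _; rewrite absdiffC.
  by ring.
move: E; rewrite (toeplitz_sumE c (leqnn L)) (toeplitz_sumE c qL) (toeplitz_sumE c (leq_subr q L)).
set S := \sum_(0 <= k < q) _ => E.
have -> : S = \sum_(1 <= r < L) ((L - r)%:R - (q - r)%:R - (L - q - r)%:R) * c r.
  have -> : \sum_(1 <= r < L) ((L - r)%:R - (q - r)%:R - (L - q - r)%:R) * c r =
      \sum_(1 <= r < L) (L - r)%:R * c r - \sum_(1 <= r < L) (q - r)%:R * c r -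
      \sum_(1 <= r < L) (L - q - r)%:R * c r.
    by rewrite -!sumrB; apply: eq_bigr => r _; ring.
  by move: E; rewrite natrB//; lra.
rewrite /weighted_sum big_nat [leRHS]big_nat; apply: ler_sum => r /andP[_ rL].
rewrite ler_wpM2r// natrB ?(ltnW rL)//.
have [h1 _] := natr_subn_bound q r; have [h2 _] := natr_subn_bound (L - q) r.
by move: h2; rewrite natrB//; lra.
Qed.

Lemma toeplitz_row c k M : c 0 = 1 -> (forall r, 0 <= c r) -> (k < M)%N ->
  \sum_(0 <= l < M) c (absdiff k l) <= 1 + 2 * \sum_(1 <= r < M) c r.
Proof.
move=> c0 cp kM; rewrite (big_cat_nat (leq0n k) (ltnW kM))/= sum_reflect.
rewrite big_ltn// [absdiff k k]addnn subnn c0.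
have -> : \sum_(k.+1 <= l < M) c (absdiff k l) = \sum_(1 <= r < M - k) c r.
  rewrite -{1}[k.+1]add1n big_addn [LHS]big_nat [RHS]big_nat.
  by apply: eq_bigr => r /andP[r1 _]; rewrite absdiff_lt ?addnK// -addn1 addnC leq_add2r.
have mono m : (0 < m)%N -> (m <= M)%N -> \sum_(1 <= r < m) c r <= \sum_(1 <= r < M) c r.
  by move=> m0 mM; rewrite (big_cat_nat m0 mM)/= lerDl sumr_ge0.
have h1 := mono k.+1 isT kM.
have h2 := mono (M - k)%N; rewrite subn_gt0 kM leq_subr in h2.
have := h2 isT isT; lra.
Qed.

End toeplitz.

(** Once the product of two opposite edges is replaced by the square of one of them, the two
    remaining edges are summed freely over their far ends, each sum being at most [A]. *)
Lemma four_cycle_sum (R : realType) (M : nat) (r : 'I_M -> 'I_M -> R) (A : R) :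
  (forall k l, r k l = r l k) -> (forall k, \sum_l `|r k l| <= A) -> 0 <= A ->
  \sum_k \sum_l \sum_k' \sum_l' `|r k l| * `|r k' l'| * (`|r k k'| * `|r l l'|) <=
  (\sum_k \sum_l r k l ^+ 2) * A ^+ 2.
Proof.
move=> r_sym rA A0; pose s k l := `|r k l|.
have s0 k l : 0 <= s k l by exact: normr_ge0.
have key : \sum_k \sum_l \sum_k' \sum_l' s k l ^+ 2 * (s k k' * s l l') <=
    (\sum_k \sum_l r k l ^+ 2) * A ^+ 2.
  rewrite mulr_suml; apply: ler_sum => k _; rewrite mulr_suml; apply: ler_sum => l _.
  have -> : \sum_k' \sum_l' s k l ^+ 2 * (s k k' * s l l') =
      r k l ^+ 2 * ((\sum_k' s k k') * (\sum_l' s l l')).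
    rewrite mulr_suml mulr_sumr; apply: eq_bigr => k' _.
    rewrite mulr_sumr mulr_sumr; apply: eq_bigr => l' _.
    by rewrite /s real_normK ?num_real.
  by rewrite ler_wpM2l ?sqr_ge0// expr2 ler_pM ?rA ?sumr_ge0.
have key2 : \sum_k \sum_l \sum_k' \sum_l' s k' l' ^+ 2 * (s k k' * s l l') <=
    (\sum_k \sum_l r k l ^+ 2) * A ^+ 2.
  apply: le_trans key; rewrite le_eqVlt; apply/orP; left; apply/eqP.
  transitivity (\sum_k \sum_k' \sum_l \sum_l' s k' l' ^+ 2 * (s k k' * s l l')).
    by apply: eq_bigr => k _; exact: exchange_big.
  rewrite exchange_big/=; apply: eq_bigr => k' _.
  transitivity (\sum_k \sum_l' \sum_l s k' l' ^+ 2 * (s k k' * s l l')).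
    by apply: eq_bigr => k _; exact: exchange_big.
  rewrite exchange_big/=; apply: eq_bigr => l' _.
  by apply: eq_bigr => k _; apply: eq_bigr => l _; rewrite /s (r_sym k k') (r_sym l l').
(* [s k l * s k' l'] is at most the mean of the two squares, and both halves are
   the same sum up to a renaming of the vertices of the cycle. *)
suff : \sum_k \sum_l \sum_k' \sum_l' s k l * s k' l' * (s k k' * s l l') <=
    2^-1 * (\sum_k \sum_l \sum_k' \sum_l' s k l ^+ 2 * (s k k' * s l l') +
            \sum_k \sum_l \sum_k' \sum_l' s k' l' ^+ 2 * (s k k' * s l l')).
  by rewrite /s in key key2 *; lra.
rewrite -big_split/= mulr_sumr; apply: ler_sum => k _.
rewrite -big_split/= mulr_sumr; apply: ler_sum => l _.
rewrite -big_split/= mulr_sumr; apply: ler_sum => k' _.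
rewrite -big_split/= mulr_sumr; apply: ler_sum => l' _.
rewrite -mulrDl [leRHS]mulrA ler_wpM2r ?mulr_ge0//.
by have := sqr_ge0 (s k l - s k' l'); nra.
Qed.

Lemma ln_le_harmonic (R : realType) n : (0 < n)%N ->
  ln n%:R <= \sum_(1 <= r < n) r%:R^-1 :> R.
Proof.
elim: n => // -[_ _|n IH _]; first by rewrite ln1 big_nil.
rewrite big_nat_recr//= -[leLHS](subrK (ln n.+1%:R)) addrC lerD ?IH//.
have n0 : 0 < n.+1%:R :> R by rewrite ltr0n.
rewrite -ln_div ?posrE ?ltr0n// -natr1 mulrDl divff ?gt_eqF// mul1r.
by rewrite le_ln1Dx// (@lt_trans _ _ 0)// invr_gt0.
Qed.

(** By diagonals and [rho_critical], the distance [r] contributes at least [(2/25)(n / r - 1)]. The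
    harmonic sum yields the logarithm, and the loss, at most [2 n / 25], is paid by the diagonal
    term [n]. *)
Lemma critical_toeplitz_sum_ge (R : realType) n : (0 < n)%N ->
  2 / 25 * (n%:R * ln n%:R) <= toeplitz_sum (fun r => rho (3 / 2) r ^+ 2 : R) n.
Proof.
move=> n0; rewrite (toeplitz_sumE _ (leqnn n)) rho0// expr1n mulr1.
have nR : 0 < n%:R :> R by rewrite ltr0n.
apply: (@le_trans _ _ (n%:R + 2 * \sum_(1 <= r < n) 25^-1 * (n%:R * r%:R^-1 - 1))).
  rewrite -mulr_sumr sumrB -mulr_sumr sumr_const_nat.
  have := ler_wpM2l (ltW nR) (ln_le_harmonic R n0); set h := \sum_(_ <= _ < _) _.
  have : (1 *+ (n - 1) : R) <= n%:R by rewrite ler_nat leq_subr.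
  by set y := 1 *+ _; lra.
rewrite lerD2l ler_wpM2l// big_nat [leRHS]big_nat; apply: ler_sum => r /andP[r1 rn].
have rR : 0 < r%:R :> R by rewrite ltr0n.
have nr : 0 <= (n - r)%:R :> R by [].
have := ler_wpM2l nr (rho_critical R r1); apply: le_trans.
rewrite natrB ?(ltnW rn)// le_eqVlt; apply/orP; left; apply/eqP.
by field; rewrite gt_eqF.
Qed.

(** Later estimates know the rate through these bounds alone. For [H < 3/4] the last one is
    [V(n) >= n]: the left side is 1 if [H <= 1/2], and otherwise [2 (2H - 1) = 2 (2H - 3/2) + 1]. At
    [H = 3/4] it is the logarithmic lower bound on [V(n)]. *)
Lemma rate_bound (R : realType) (H : R) : 0 < H -> H <= 3 / 4 ->
  exists2 Q : R, 0 < Q & forall n, (0 < n)%N ->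
    rate H n = +oo%E \/ exists q : R, [/\ rate H n = q%:E, 0 < q, q <= Q &
      n%:R `^ (2 * Num.max (2 * H - 1) 0) <=
        Q * q ^+ 2 * toeplitz_sum (fun r => rho (2 * H) r ^+ 2) n].
Proof.
move=> H0 H34; pose c r := rho (2 * H) r ^+ 2.
have c0 : c 0 = 1 by rewrite /c rho0 ?expr1n// mulr_gt0.
have cp r : 0 <= c r by exact: sqr_ge0.
have [H12|H12] := leP H 2^-1.
  exists 1 => // n n0; right; exists (Num.sqrt n%:R)^-1.
  have nR : 1 <= n%:R :> R by rewrite ler1n.
  have n0R : 0 < n%:R :> R by rewrite ltr0n.
  split; first by rewrite /rate H12.
  - by rewrite invr_gt0 sqrtr_gt0.
  - by rewrite invf_le1 ?sqrtr_gt0// -[leLHS]sqrtr1 ler_wsqrtr.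
  - rewrite max_r; last by lra.
    rewrite mulr0 powRr0 mul1r exprVn sqr_sqrtr// mulrC ler_pdivlMr// mul1r.
    exact: toeplitz_sum_ge.
have [H34'|H34'] := ltP H (3 / 4).
  exists 1 => // n n0; right; exists (n%:R `^ (2 * H - 3 / 2)).
  have nR : 1 <= n%:R :> R by rewrite ler1n.
  have n0R : 0 < n%:R :> R by rewrite ltr0n.
  split; first by rewrite /rate leNgt H12 H34'.
  - exact: powR_gt0.
  - by rewrite -[leRHS](powRr0 n%:R) ler_powR//; lra.
  - rewrite max_l; last by lra.
    rewrite mul1r -powR_mulrn ?powR_ge0// -powRrM.
    have -> : n%:R `^ (2 * (2 * H - 1)) = n%:R `^ ((2 * H - 3 / 2) * 2%:R) * n%:R :> R.
      rewrite -{3}[n%:R]powRr1 ?(ltW n0R)// -powRD; last by apply/implyP => _; rewrite gt_eqF.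
      by congr (_ `^ _); field.
    by rewrite ler_wpM2l ?powR_ge0//; exact: toeplitz_sum_ge.
have HE : H = 3 / 4 by apply/le_anti/andP.
have l2 : 0 < ln 2 :> R by rewrite ln_gt0// ltr1n.
(* [25/2] inverts the constant of [critical_toeplitz_sum_ge]; the other term is the rate at [n = 2],
   the largest finite one. *)
exists (Num.max (25 / 2) (Num.sqrt (ln 2))^-1) => [|n n0]; first by rewrite lt_max divr_gt0.
have rE : rate H n = if n == 1%N then +oo%E else ((Num.sqrt (ln n%:R))^-1)%:E.
  by rewrite /rate leNgt H12/= ltNge H34'.
rewrite rE; case: eqVneq => [_|n1]; [by left|right].
have n2 : (1 < n)%N by rewrite ltn_neqAle eq_sym n1.
have ln0 : 0 < ln n%:R :> R by rewrite ln_gt0// ltr1n.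
have ln2 : ln 2 <= ln n%:R :> R by rewrite ler_ln ?posrE ?ltr0n// ler_nat.
have s0 := ln0; rewrite -sqrtr_gt0 in s0.
exists (Num.sqrt (ln n%:R))^-1; split => //.
- by rewrite invr_gt0.
- by rewrite le_max lef_pV2 ?posrE ?sqrtr_gt0// ler_wsqrtr// orbT.
rewrite exprVn sqr_sqrtr ?(ltW ln0)//.
have -> : 2 * H = 3 / 2 by rewrite HE; field.
rewrite max_l; last by lra.
have -> : 2 * (3 / 2 - 1) = 1 :> R by field.
rewrite powRr1//.
have h := critical_toeplitz_sum_ge R n0.
apply: (@le_trans _ _ (25 / 2 / ln n%:R * toeplitz_sum (fun r => rho (3 / 2) r ^+ 2) n)).
  rewrite mulrAC ler_pdivlMr// -ler_pdivrMl ?divr_gt0//.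
  by apply: le_trans h; rewrite le_eqVlt; apply/orP; left; apply/eqP; field.
rewrite ler_wpM2r//.
  by apply: le_trans h; rewrite !mulr_ge0// ltW.
by rewrite ler_wpM2r ?invr_ge0 ?(ltW ln0)// le_max lexx.
Qed.

(** * Increments of fractional Brownian motion *)

Lemma dist_absdiff (R : realDomainType) (k l : nat) : `|k%:R - l%:R| = (absdiff k l)%:R :> R.
Proof.
wlog kl : k l / (k <= l)%N => [hw|].
  have [/hw//|/ltnW/hw] := leqP k l; by rewrite distrC absdiffC.
rewrite distrC ger0_norm ?subr_ge0 ?ler_nat// -natrB//.
by rewrite /absdiff (eqP kl).
Qed.

Section fBm_increments.
Context d (T : measurableType d) (R : realType) (P : probability T R).
Context (H : R) (B : R -> {RV P >-> R}).
Hypothesis hB : is_fBm H B.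

Let cov (s t : R) := 2^-1 * (t `^ (2 * H) + s `^ (2 * H) - `|t - s| `^ (2 * H)).

(** The covariance at [s = t] is a finite number, which gives square integrability; the
    integrability of [B t] and of products follows from it. *)
Let B_sq (t : R) : 0 <= t -> P.-integrable [set: T] (fun w => (B t w ^+ 2)%:E).
Proof.
move=> t0; have [_ _ _ /(_ t t t0 t0)] := hB; rewrite unlock => E.
apply/integrableP; split; first by apply/measurable_EFinP; exact: measurable_funX.
under eq_integral do rewrite /= ger0_norm ?sqr_ge0// expr2.
by rewrite E ltry.
Qed.

Let B_int (t : R) : 0 <= t -> P.-integrable [set: T] (fun w => (B t w)%:E).
Proof.
move=> t0.
have i2 : P.-integrable [set: T] (fun w => (1 + B t w ^+ 2)%:E).
  under eq_fun do rewrite EFinD; apply: integrableD => //; last exact: B_sq.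
  exact: finite_measure_integrable_cst.
apply: le_integrable i2 => //; first exact/measurable_EFinP.
move=> w _; rewrite /= lee_fin; set y := B t w.
rewrite [leRHS]ger0_norm ?addr_ge0 ?sqr_ge0// -[y ^+ 2]real_normK ?num_real//.
by have := sqr_ge0 (`|y| - 1); have := normr_ge0 y; nra.
Qed.

Let B_prod (s t : R) : 0 <= s -> 0 <= t ->
  P.-integrable [set: T] (fun w => (B s w * B t w)%:E).
Proof.
move=> s0 t0.
have i2 : P.-integrable [set: T] (fun w => (B s w ^+ 2 + B t w ^+ 2)%:E).
  by under eq_fun do rewrite EFinD; apply: integrableD => //; exact: B_sq.
apply: le_integrable i2 => //; first by apply/measurable_EFinP; exact: measurable_funM.
move=> w _; rewrite /= lee_fin; set x := B s w; set y := B t w.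
rewrite [leRHS]ger0_norm ?addr_ge0 ?sqr_ge0// normrM.
rewrite -[y ^+ 2]real_normK ?num_real// -[x ^+ 2]real_normK ?num_real//.
by have := sqr_ge0 (`|x| - `|y|); have := sqr_ge0 `|x|; have := sqr_ge0 `|y|; nra.
Qed.

Let B_mean (t : R) : 0 <= t -> \int[P]_w B t w = 0.
Proof. by move=> t0; have [_ _ /(_ t t0) + _] := hB; rewrite unlock /Rintegral => ->. Qed.

Let B_cov (s t : R) : 0 <= s -> 0 <= t -> \int[P]_w (B s w * B t w) = cov s t.
Proof. by move=> s0 t0; have [_ _ _ /(_ s t s0 t0)] := hB; rewrite unlock /Rintegral => ->. Qed.

Let X (k : nat) (w : T) := B k.+1%:R w - B k%:R w.

Let X_prodE k l w : X k w * X l w =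
  (B k.+1%:R w * B l.+1%:R w - B k.+1%:R w * B l%:R w) -
  (B k%:R w * B l.+1%:R w - B k%:R w * B l%:R w).
Proof. by rewrite /X; ring. Qed.

Let X_prod k l : P.-integrable [set: T] (fun w => (X k w * X l w)%:E).
Proof.
under eq_fun do rewrite X_prodE !EFinB.
by apply: integrableB => //; apply: integrableB => //; exact: B_prod.
Qed.

Let X_cov k l : \int[P]_w (X k w * X l w) = rho (2 * H) (absdiff k l).
Proof.
under eq_Rintegral do rewrite X_prodE.
have iB (a b c e : nat) : P.-integrable [set: T]
    (fun w => (B a%:R w * B b%:R w - B c%:R w * B e%:R w)%:E).
  by under eq_fun do rewrite EFinB; apply: integrableB => //; exact: B_prod.
rewrite (RintegralB measurableT (iB _ _ _ _) (iB _ _ _ _)).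
rewrite !(RintegralB measurableT (B_prod _ _) (B_prod _ _))// !B_cov//.
rewrite /cov /rho.
have -> : `|l.+1%:R - k.+1%:R| = (absdiff k l)%:R :> R.
  by rewrite distrC dist_absdiff /absdiff !subSS.
rewrite -[`|l%:R - k%:R|]distrC [`|k%:R - l%:R|]dist_absdiff.
suff : `|l%:R - k.+1%:R| `^ (2 * H) + `|l.+1%:R - k%:R| `^ (2 * H) =
    (absdiff k l).+1%:R `^ (2 * H) + `|(absdiff k l)%:R - 1| `^ (2 * H) :> R by lra.
wlog kl : k l / (k <= l)%N => [hw|].
  have [/hw//|/ltnW/hw] := leqP k l; rewrite absdiffC => <-.
  by rewrite addrC; congr (_ `^ _ + _ `^ _); rewrite distrC.
have -> : absdiff k l = (l - k)%N by rewrite /absdiff (eqP kl).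
have -> : `|l.+1%:R - k%:R| = (l - k).+1%:R :> R.
  by rewrite -natrB ?(leqW kl)// subSn// ger0_norm.
have -> : l%:R - k.+1%:R = (l - k)%:R - 1 :> R by rewrite natrB// -[k.+1]addn1 natrD; ring.
by rewrite addrC.
Qed.

Lemma fBm_gaussian_vector M :
  gaussian_vector P (fun k : 'I_M => X k) (fun k l => rho (2 * H) (absdiff k l)).
Proof.
move=> a; set Y := fun w => _.
have mY : measurable_fun [set: T] Y.
  by apply: measurable_sum => k; apply: measurable_funM => //; exact: measurable_funB.
have gY : gaussian_variable P Y.
  have [gB _ _ _] := hB.
  (* A form in [M] increments is a form in [2 M] values of [B]: the first half of the indices takes
     the right ends [k + 1] with weight [a k], the second half the left ends [k] with weight
     [- a k]. *)
  pose a' (i : 'I_(M + M)) := match fintype.split i with inl k => a k | inr k => - a k end.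
  pose t' (i : 'I_(M + M)) : R := match fintype.split i with inl k => (k.+1)%:R | inr k => k%:R end.
  have := gB _ a' t'; have -> : (fun w => \sum_(i < M + M) a' i * B (t' i) w) = Y.
    apply/funext => w; rewrite big_split_ord/= -big_split/=; apply: eq_bigr => k _.
    rewrite /a' /t' (unsplitK (inl k : 'I_M + 'I_M)) (unsplitK (inr k : 'I_M + 'I_M)).
    by rewrite /X mulrBr mulNr.
  by apply => i; rewrite /t'; case: fintype.split.
have iX k : P.-integrable [set: T] (fun w => (X k w)%:E).
  by under eq_fun do rewrite EFinB; apply: integrableB => //; exact: B_int.
have Y0 : \int[P]_w Y w = 0.
  rewrite /Y Rintegral_sum//; last first.
    by move=> k; under eq_fun do rewrite EFinM; exact: integrableZl.
  apply: big1 => k _; rewrite (RintegralZl _ measurableT (iX k)).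
  rewrite (RintegralB measurableT (B_int _) (B_int _))// !B_mean// subrr mulr0.
  by [].
suff <- : \int[P]_w Y w ^+ 2 = quad (fun k l : 'I_M => rho (2 * H) (absdiff k l)) a.
  exact: gaussian_stein.
have iXX k l : P.-integrable [set: T] (fun w => (a k * a l * (X k w * X l w))%:E).
  by under eq_fun do rewrite EFinM; exact: integrableZl.
transitivity (\int[P]_w \sum_k \sum_l a k * a l * (X k w * X l w)).
  apply: eq_Rintegral => w _; rewrite expr2 /Y mulr_suml; apply: eq_bigr => k _.
  by rewrite mulr_sumr; apply: eq_bigr => l _; ring.
rewrite Rintegral_sum; last first.
  by move=> k; under eq_fun do rewrite -sumEFin; exact: integrable_sum.
apply: eq_bigr => k _; rewrite Rintegral_sum//.
by apply: eq_bigr => l _; rewrite (RintegralZl _ measurableT (X_prod k l)) X_cov.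
Qed.

End fBm_increments.

Lemma sum_interval (R : pzRingType) (f : nat -> R) (a b M : nat) : (b <= M)%N ->
  \sum_(k < M) (a <= k < b)%:R * f k = \sum_(a <= k < b) f k.
Proof.
move=> bM; rewrite -(big_mkord xpredT (fun k => (a <= k < b)%:R * f k)).
rewrite (big_nat_widenl a 0 b)// (big_nat_widen 0 b M)// [RHS]big_mkcond/=.
by apply: eq_bigr => k _; case: (a <= k < b)%N; rewrite ?mul1r ?mul0r.
Qed.

Lemma toeplitz_sum_ord (R : realType) (c : nat -> R) M :
  \sum_(k < M) \sum_(l < M) c (absdiff k l) = toeplitz_sum c M.
Proof.
rewrite /toeplitz_sum big_mkord; apply: eq_bigr => k _.
by rewrite big_mkord.
Qed.

(** Coefficients enter through [|gram_coef| <= 2 x^2 |r|]. The two crossed pairings have equal sums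
    after exchanging [k'] and [l'], and [(2 x^2)^2] doubled is [8 x^4]. *)
Lemma gram_variance_bound (R : realType) (M n : nat) (r : 'I_M -> 'I_M -> R)
    (al : 'I_n -> 'I_M -> R) (x A : R) i j :
  (forall k l, r k l = r l k) -> (forall k, \sum_l `|r k l| <= A) -> 0 <= A ->
  (forall i k, `|al i k| <= x) ->
  \sum_k \sum_l \sum_k' \sum_l' gram_coef r al i j k l * gram_coef r al i j k' l' *
    (r k k' * r l l' + r k l' * r l k') <=
  8 * x ^+ 4 * ((\sum_k \sum_l r k l ^+ 2) * A ^+ 2).
Proof.
move=> r_sym rA A0 alx.
pose s k l k' l' := `|r k l| * `|r k' l'| * (`|r k k'| * `|r l l'|).
have swap k l : \sum_k' \sum_l' s k l k' l' = \sum_k' \sum_l' s k l l' k'.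
  by rewrite exchange_big.
apply: (@le_trans _ _ (4 * x ^+ 4 *
    \sum_k \sum_l \sum_k' \sum_l' (s k l k' l' + s k l l' k'))); last first.
  have -> : \sum_k \sum_l \sum_k' \sum_l' (s k l k' l' + s k l l' k') =
      2 * \sum_k \sum_l \sum_k' \sum_l' s k l k' l'.
    rewrite mulr_sumr; apply: eq_bigr => k _; rewrite mulr_sumr; apply: eq_bigr => l _.
    rewrite (_ : 2 * _ = \sum_k' \sum_l' s k l k' l' + \sum_k' \sum_l' s k l l' k').
      by rewrite -big_split; apply: eq_bigr => k' _; rewrite -big_split.
    by rewrite -swap; ring.
  have -> : 8 * x ^+ 4 = 4 * x ^+ 4 * 2 by ring.
  have x4 : 0 <= 4 * x ^+ 4 * 2 by rewrite mulr_ge0// mulr_ge0// exprn_even_ge0.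
  by rewrite [leLHS]mulrA ler_wpM2l//; exact: four_cycle_sum.
rewrite mulr_sumr; apply: ler_sum => k _; rewrite mulr_sumr; apply: ler_sum => l _.
rewrite mulr_sumr; apply: ler_sum => k' _; rewrite mulr_sumr; apply: ler_sum => l' _.
have gc k0 l0 : `|gram_coef r al i j k0 l0| <= 2 * x ^+ 2 * `|r k0 l0|.
  rewrite /gram_coef !normrM ger0_norm// ler_wpM2r// -!mulrA ler_wpM2l// expr2.
  by rewrite ler_pM.
apply: (le_trans (ler_norm _)).
rewrite normrM [`|gram_coef _ _ _ _ _ _ * _|]normrM.
have x2 : 0 <= 2 * x ^+ 2 by rewrite mulr_ge0// sqr_ge0.
apply: (@le_trans _ _ ((2 * x ^+ 2 * `|r k l|) * (2 * x ^+ 2 * `|r k' l'|) *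
    (`|r k k'| * `|r l l'| + `|r k l'| * `|r l k'|))).
  apply: ler_pM => //; first by apply: ler_pM.
  by rewrite (le_trans (ler_normD _ _))// !normrM.
by rewrite /s (r_sym l' k') le_eqVlt; apply/orP; left; apply/eqP; ring.
Qed.

Section fBm_chaos.
Context d (T : measurableType d) (R : realType) (P : probability T R).
Context (H : R) (B : R -> {RV P >-> R}) (sigma : nat -> R).
Hypothesis H0 : 0 < H.
Hypothesis hB : is_fBm H B.

(** [sigma n] times Z_n(1) is the quadratic form with identity coefficients minus its mean [n]. So
    [quadratic_deviation] has zero bias, and each of its two pairings gives the Toeplitz sum of
    [rho^2]. *)
Lemma fBm_normalization n : sigma n != 0 ->
  'E_P[fun w => (Zn B sigma n 1 w ^+ 2)%R]%E = 1%E ->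
  sigma n ^+ 2 = 2 * toeplitz_sum (fun r => rho (2 * H) r ^+ 2) n.
Proof.
move=> s0; rewrite unlock => E.
have E1 : \int[P]_w Zn B sigma n 1 w ^+ 2 = 1 by rewrite /Rintegral E.
pose X (k : 'I_n) w := B k.+1%:R w - B k%:R w.
pose r (k l : 'I_n) := rho (2 * H) (absdiff k l).
have gX : gaussian_vector P X r by exact: fBm_gaussian_vector.
have r_sym k l : r k l = r l k by rewrite /r absdiffC.
have r_diag k : r k k = 1 by rewrite /r /absdiff subnn rho0// mulr_gt0.
have := quadratic_deviation gX r_sym r_diag (fun k l => (k == l)%:R) n%:R.
have diag (g : 'I_n -> 'I_n -> R) : \sum_k \sum_l (k == l)%:R * g k l = \sum_k g k k.
  apply: eq_bigr => k _; rewrite (bigD1 k)//= eqxx mul1r big1 ?addr0// => l lk.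
  by rewrite eq_sym (negbTE lk) mul0r.
rewrite diag.
have -> : n%:R - \sum_k r k k = 0.
  by rewrite (eq_bigr (fun=> 1)) ?sumr_const ?card_ord ?subrr.
have -> : \sum_k \sum_l \sum_k' \sum_l' (k == l)%:R * (k' == l')%:R *
    (r k k' * r l l' + r k l' * r l k') = 2 * toeplitz_sum (fun r => rho (2 * H) r ^+ 2) n.
  transitivity (\sum_k \sum_l (k == l)%:R *
      \sum_k' \sum_l' (k' == l')%:R * (r k k' * r l l' + r k l' * r l k')).
    apply: eq_bigr => k _; apply: eq_bigr => l _; rewrite mulr_sumr; apply: eq_bigr => k' _.
    by rewrite mulr_sumr; apply: eq_bigr => l' _; rewrite mulrA.
  rewrite diag -toeplitz_sum_ord mulr_sumr; apply: eq_bigr => k _.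
  by rewrite diag mulr_sumr; apply: eq_bigr => k' _; rewrite /r; ring.
rewrite expr0n/= add0r => <-; rewrite -[LHS]mulr1 -[X in _ * X = _]E1.
have ZE w : Zn B sigma n 1 w = (sigma n)^-1 * \sum_(k < n) (X k w ^+ 2 - 1).
  by rewrite /Zn mulr1 natrK big_mkord.
have dE w : (n%:R - \sum_k \sum_l (k == l)%:R * (X k w * X l w)) ^+ 2 =
    sigma n ^+ 2 * Zn B sigma n 1 w ^+ 2.
  rewrite diag ZE exprMn mulrA -exprMn mulfV// expr1n mul1r sumrB sumr_const card_ord.
  by rewrite -sqrrN opprB; congr ((_ - _) ^+ 2); apply: eq_bigr => k _; rewrite expr2.
have iZ : P.-integrable [set: T] (fun w => (Zn B sigma n 1 w ^+ 2)%:E).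
  apply/integrableP; split.
    apply/measurable_EFinP; apply: measurable_funX; rewrite (funext ZE).
    apply: measurable_funM => //; apply: measurable_sum => k.
    by apply: measurable_funB => //; apply: measurable_funX; exact: measurable_funB.
  by under eq_integral do rewrite /= ger0_norm ?sqr_ge0//; rewrite E ltry.
rewrite -(RintegralZl _ measurableT iZ).
by apply: eq_Rintegral => w _; rewrite -dE.
Qed.

(** All components are read off one vector of [p ord_max] increments, an indicator selecting the
    block of each, so that a single Gaussian vector carries the whole chaos. *)
Lemma Zn_increments_chaos dim (t : 'I_dim.+1 -> R) n w :
  (forall i, t i <= t ord_max) -> (forall i j : 'I_dim.+1, (i <= j)%N -> t i <= t j) ->
  let p i := Num.truncn (n%:R * t i) in
  Zn_increments B sigma t n w =
  chaos (fun i (k : 'I_(p ord_max)) =>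
      (p (widen_ord (leqnSn dim) i) <= k < p (lift ord0 i))%:R *
      (sigma n * Num.sqrt (t (lift ord0 i) - t (widen_ord (leqnSn dim) i)))^-1)
    (fun k => B k.+1%:R w - B k%:R w).
Proof.
move=> tmax tle p; apply/rowP => i; rewrite chaosE mxE.
have ple i0 j0 : t i0 <= t j0 -> (p i0 <= p j0)%N.
  by move=> ij; rewrite /p le_truncn// ler_wpM2l.
set f := fun k : nat => (B k.+1%:R w - B k%:R w) ^+ 2 - 1.
set x := (sigma n * _)^-1.
transitivity (x * \sum_(p (widen_ord (leqnSn dim) i) <= k < p (lift ord0 i)) f k); last first.
  rewrite -(sum_interval f _ (ple _ _ (tmax (lift ord0 i)))) mulr_sumr.
  by apply: eq_bigr => k _; rewrite /f; ring.
rewrite /Zn -mulrBr.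
have ii : (p (widen_ord (leqnSn dim) i) <= p (lift ord0 i))%N.
  by apply/ple/tle; rewrite /= leqW.
rewrite (big_cat_nat (leq0n _) ii)/= addrAC subrr add0r.
by rewrite /x invfM; ring.
Qed.

End fBm_chaos.

Lemma ler_sum_interval (R : numDomainType) (f : nat -> R) a b a' b' :
  (forall k, 0 <= f k) -> (a' <= a)%N -> (b <= b')%N ->
  \sum_(a <= k < b) f k <= \sum_(a' <= k < b') f k.
Proof.
move=> f0 aa bb; rewrite (big_nat_widenl a a' b)// (big_nat_widen a' b b')//.
rewrite big_mkcond/=; apply: ler_sum => k _; by case: ifP.
Qed.

(** * Bias and variance of the Gram matrix in terms of the rate *)

Section increment_estimates.
Context (R : realType) (H : R) (d : nat) (t : 'I_d.+1 -> R).
Hypotheses (H0 : 0 < H) (H34 : H <= 3 / 4).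
Hypothesis t0 : t ord0 = 0.
Hypothesis t_incr : forall i j : 'I_d.+1, (i < j)%N -> t i < t j.

Let lo (i : 'I_d) := widen_ord (leqnSn d) i.
Let hi (i : 'I_d) : 'I_d.+1 := lift ord0 i.
Let De i := t (hi i) - t (lo i).
Let p n i := Num.truncn (n%:R * t i).
Let c r := rho (2 * H) r ^+ 2.
Let V := toeplitz_sum c.
Let b := Num.max (2 * H - 1) 0.
(** An integer above every [t i], so that every index [p n i] is at most [K n]. *)
Let K := (Num.truncn (t ord_max)).+1.
Let G n : R := n%:R `^ (2 * b).
Let iD := 1 + \sum_i (De i)^-1.
(** Comes from [toeplitz_deviation] with [D <= K], a weighted sum of at most [K G n], and
    [1 <= G n]. *)
Let C1 : R := 1 + 2 * (2 + K%:R) * K%:R.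

Lemma partition_le (i j : 'I_d.+1) : (i <= j)%N -> t i <= t j.
Proof.
rewrite leq_eqVlt => /predU1P[/val_inj-> //|ij]; exact/ltW/t_incr.
Qed.

Let t_ge0 i : 0 <= t i. Proof. by rewrite -t0 partition_le. Qed.

Let t_max i : t i <= t ord_max. Proof. by rewrite partition_le// -ltnS. Qed.

Let tK i : t i <= K%:R.
Proof. by rewrite (le_trans (t_max i))// ltW// truncnS_gt. Qed.

Let De_gt0 i : 0 < De i. Proof. by rewrite subr_gt0 t_incr. Qed.

Let De_le i : De i <= K%:R.
Proof. by rewrite (le_trans _ (tK (hi i)))// gerBl. Qed.

Let iD_ge i : (De i)^-1 <= iD.
Proof.
rewrite /iD (bigD1 i)//= addrCA lerDl addr_ge0// sumr_ge0// => j _.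
by rewrite invr_ge0 ltW.
Qed.

Let iD_ge1 : 1 <= iD.
Proof. by rewrite lerDl sumr_ge0// => i _; rewrite invr_ge0 ltW. Qed.

Let p_le n i j : t i <= t j -> (p n i <= p n j)%N.
Proof. by move=> ij; rewrite /p le_truncn// ler_wpM2l. Qed.

Let p_itv n i : (p n i)%:R <= n%:R * t i /\ n%:R * t i < (p n i)%:R + 1.
Proof.
have /truncn_itv /andP[h1 h2] : 0 <= n%:R * t i by rewrite mulr_ge0.
by split => //; rewrite natr1.
Qed.

Let pK n i : (p n i <= K * n)%N.
Proof.
rewrite -(ler_nat R) (le_trans (p_itv n i).1)// natrM mulrC ler_wpM2r//.
Qed.

Let c0 : c 0 = 1. Proof. by rewrite /c rho0 ?expr1n// mulr_gt0. Qed.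
Let cp r : 0 <= c r. Proof. exact: sqr_ge0. Qed.
Let a0 : 0 < 2 * H. Proof. by rewrite mulr_gt0. Qed.
Let a32 : 2 * H <= 3 / 2. Proof. by have := H34; lra. Qed.

Let b0 : 0 <= b. Proof. by rewrite le_max lexx orbT. Qed.
Let b1 : 2 * b <= 1.
Proof. by have := H34; rewrite /b; case: (leP (2 * H - 1) 0) => _; lra. Qed.

Let K1 : 1 <= K%:R :> R. Proof. by rewrite ler1n. Qed.

Let G_ge1 n : (0 < n)%N -> 1 <= G n.
Proof.
move=> n0; apply: (@le_trans _ _ (1 `^ (2 * b))); first by rewrite powR1.
by rewrite ge0_ler_powR ?mulr_ge0 ?nnegrE ?ler1n.
Qed.

(** [H <= 3/4] enters in the form [2 b <= 1]: the factor [K^(2b)] is at most [K]. *)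
Let KG n : (0 < n)%N -> (K * n)%:R `^ (2 * b) <= K%:R * G n.
Proof.
move=> n0; rewrite natrM powRM// ler_wpM2r ?powR_ge0//; exact: ler1_powR.
Qed.

Let W_le n : (0 < n)%N -> weighted_sum c (K * n) <= K%:R * G n.
Proof.
move=> n0; rewrite (le_trans _ (KG n0))//.
by apply: weighted_sum_rho => //; rewrite muln_gt0.
Qed.

Let V_dev n m D : (0 < n)%N -> 0 <= D -> D <= K%:R -> (m <= K * n)%N ->
  `|m%:R - D * n%:R| <= 1 -> `|V m - D * V n| <= C1 * G n.
Proof.
move=> n0 D0 DK mK mn.
have nK : (n <= K * n)%N by rewrite leq_pmull.
apply: (le_trans (toeplitz_deviation c0 cp D0 mK nK mn)).
have g1 := G_ge1 n0; have w := W_le n0; have w0 := weighted_sum_ge0 (K * n) cp.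
have h : (2 + D) * weighted_sum c (K * n) <= (2 + K%:R) * (K%:R * G n).
  by rewrite ler_pM// ?lerD2l// addr_ge0.
by rewrite /C1; lra.
Qed.

Let block n i j : \sum_(p n (lo i) <= k < p n (hi i)) \sum_(p n (lo j) <= l < p n (hi j)) c (absdiff k l)
  = if i == j then V (p n (hi i) - p n (lo i)) else
  \sum_(p n (lo i) <= k < p n (hi i)) \sum_(p n (lo j) <= l < p n (hi j)) c (absdiff k l).
Proof.
case: eqVneq => [->|//]; apply: toeplitz_shift; apply: p_le.
by rewrite partition_le//= leqW.
Qed.

Let block_lt n (i j : 'I_d) : (0 < n)%N -> (i < j)%N ->
  \sum_(p n (lo i) <= k < p n (hi i)) \sum_(p n (lo j) <= l < p n (hi j)) c (absdiff k l)
  <= K%:R * G n.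
Proof.
move=> n0 ij; apply: le_trans (W_le n0).
apply: le_trans (toeplitz_offdiag cp (pK n (hi i))).
apply: (@le_trans _ _ (\sum_(0 <= k < p n (hi i)) \sum_(p n (lo j) <= l < p n (hi j)) c (absdiff k l))).
  by apply: ler_sum_interval => // k; apply: sumr_ge0.
apply: ler_sum => k _; apply: ler_sum_interval => //.
by apply/p_le/partition_le.
Qed.

Let block_neq n (i j : 'I_d) : (0 < n)%N -> i != j ->
  \sum_(p n (lo i) <= k < p n (hi i)) \sum_(p n (lo j) <= l < p n (hi j)) c (absdiff k l)
  <= K%:R * G n.
Proof.
move=> n0; rewrite neq_ltn => /orP[|] ij; first exact: block_lt.
rewrite exchange_big_nat/=; under eq_bigr do under eq_bigr do rewrite absdiffC.
exact: block_lt.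
Qed.

(** The squares of the entries of [al] are of order [1 / V n], which makes bias and variance both of
    order [G n / V n <= Q q^2]. The variance is compared with a square as it stands; the bias,
    quadratic in [q], becomes linear through [q <= Q]. *)
Lemma increment_estimates (Q : R) : 0 < Q -> exists2 C : R, 0 < C &
  forall n (s q : R), (0 < n)%N -> 0 < s -> s ^+ 2 = 2 * V n -> 0 < q -> q <= Q ->
    G n <= Q * q ^+ 2 * V n ->
    let r (k l : 'I_(p n ord_max)) := rho (2 * H) (absdiff k l) in
    let al i (k : 'I_(p n ord_max)) :=
      (p n (lo i) <= k < p n (hi i))%:R * (s * Num.sqrt (De i))^-1 in
    forall i j,
    `|(i == j)%:R - \sum_k \sum_l gram_coef r al i j k l * r k l| <= C * q /\
    \sum_k \sum_l \sum_k' \sum_l' gram_coef r al i j k l * gram_coef r al i j k' l' *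
      (r k k' * r l l' + r k l' * r l k') <= (C * q) ^+ 2.
Proof.
move=> Q0.
(* [E] is for the bias: [C1 G n iD / V n <= C1 iD Q q^2] and [Q q^2 <= Q^2 q]. [F2] is for the
   variance [8 ka^4 V(p) A^2], with [p = p n ord_max], [ka^4 = iD^2 / (4 (V n)^2)],
   [A^2 <= 9 K Q q^2 V n] and [V(p) <= (K + C1 Q^3) V n]; 18 is 8 times 9 divided by 4. *)
pose E := C1 * iD * Q ^+ 2.
pose F2 := 18 * iD ^+ 2 * K%:R * Q * (K%:R + C1 * Q ^+ 3).
have C10 : 0 < C1 by rewrite /C1; have := K1; nra.
have iD0 : 0 < iD by apply: lt_le_trans iD_ge1.
have K0 : 0 < K%:R :> R by rewrite ltr0n.
have E0 : 0 < E by rewrite !mulr_gt0// exprn_gt0.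
have F0 : 0 < F2 by rewrite !mulr_gt0 ?exprn_gt0// addr_gt0// mulr_gt0// exprn_gt0.
exists (E + Num.sqrt F2) => [|n s q n0 s0 sV q0 qQ hG r al i j].
  by rewrite ltr_pwDl// sqrtr_ge0.
have V0 : 0 < V n.
  by apply: lt_le_trans (toeplitz_sum_ge n c0 cp); rewrite ltr0n.
have GV : G n / V n <= Q * q ^+ 2 by rewrite ler_pdivrMr.
have GV' : C1 * G n * iD / V n <= E * q.
  have -> : C1 * G n * iD / V n = C1 * iD * (G n / V n) by ring.
  apply: (@le_trans _ _ (C1 * iD * (Q * q ^+ 2))).
    by rewrite ler_wpM2l// mulr_ge0 ?ltW.
  have h : Q * q ^+ 2 <= Q ^+ 2 * q.
    have : 0 <= Q * q * (Q - q) by rewrite !mulr_ge0 ?subr_ge0// ltW.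
    by lra.
  by rewrite /E -[leRHS]mulrA ler_wpM2l// mulr_ge0// ltW.
pose x i := (s * Num.sqrt (De i))^-1.
have x0 i' : 0 <= x i' by rewrite invr_ge0 mulr_ge0 ?sqrtr_ge0 ?ltW.
have x2 i' : x i' ^+ 2 = (2 * V n * De i')^-1.
  by rewrite exprVn exprMn sV sqr_sqrtr// ltW.
pose ka := Num.sqrt (iD / (2 * V n)).
have ka2 : ka ^+ 2 = iD / (2 * V n) by rewrite sqr_sqrtr// divr_ge0 ?mulr_ge0 ?ltW.
have xka i' : x i' <= ka.
  rewrite -(@ler_pXn2r _ 2) ?nnegrE ?sqrtr_ge0// x2 ka2 invfM mulrC ler_wpM2r//.
  by rewrite invr_ge0 mulr_ge0// ltW.
have CE : E * q <= (E + Num.sqrt F2) * q by rewrite ler_wpM2r ?(ltW q0)// lerDl sqrtr_ge0.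
split.
  apply: le_trans CE; apply: le_trans GV'.
  have -> : \sum_k \sum_l gram_coef r al i j k l * r k l = 2 * x i * x j *
     \sum_(p n (lo i) <= k < p n (hi i)) \sum_(p n (lo j) <= l < p n (hi j)) c (absdiff k l).
    rewrite -(sum_interval _ _ (p_le n (t_max (hi i)))) mulr_sumr; apply: eq_bigr => k _.
    rewrite -(sum_interval (fun l => c (absdiff k l)) _ (p_le n (t_max (hi j)))) !mulr_sumr.
    by apply: eq_bigr => l _; rewrite /gram_coef /al /x /c /r; ring.
  have C1K : K%:R <= C1 by rewrite /C1; have := K1; nra.
  rewrite block; case: eqVneq => [<-|ij].
    (* Since [s^2 = 2 V n], the diagonal entry is the Toeplitz sum of the block over [De i V n]. The
       block has [De i n] indices up to a rounding error of at most 1, which is the setting of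
       [V_dev]. *)
    have -> : 1 - 2 * x i * x i * V (p n (hi i) - p n (lo i)) =
        - (De i)^-1 / V n * (V (p n (hi i) - p n (lo i)) - De i * V n).
      rewrite -[2 * x i * x i]mulrA -expr2 x2; field.
      by rewrite !gt_eqF ?De_gt0.
    have hp := p_itv n (hi i); have lp := p_itv n (lo i).
    have lh : (p n (lo i) <= p n (hi i))%N by apply/p_le/ltW; rewrite -subr_gt0 De_gt0.
    have dev := @V_dev n (p n (hi i) - p n (lo i)) (De i) n0 (ltW (De_gt0 i)) (De_le i).
    have DV0 : 0 <= (De i)^-1 / V n by rewrite divr_ge0 ?invr_ge0 ?(ltW (De_gt0 i)) ?(ltW V0).
    rewrite normrM mulNr normrN [`|_ / V n|]ger0_norm//.
    have -> : C1 * G n * iD / V n = iD / V n * (C1 * G n) by ring.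
    apply: ler_pM => //.
      by rewrite ler_wpM2r ?invr_ge0 ?(ltW V0).
    apply: dev; first by rewrite (leq_trans (leq_subr _ _)).
    rewrite natrB// /De mulrC mulrBr; move: hp lp => [h1 h2] [h3 h4].
    by rewrite ler_norml; apply/andP; split; lra.
  rewrite sub0r normrN.
  have S0 : 0 <= \sum_(p n (lo i) <= k < p n (hi i)) \sum_(p n (lo j) <= l < p n (hi j)) c (absdiff k l).
    by apply: sumr_ge0 => k _; exact: sumr_ge0.
  have ka0 : 0 <= ka by exact: sqrtr_ge0.
  have g0 : 0 <= G n by exact: powR_ge0.
  rewrite ger0_norm; last by rewrite !mulr_ge0.
  apply: (@le_trans _ _ (2 * ka ^+ 2 * (K%:R * G n))).
    apply: ler_pM; [by rewrite !mulr_ge0|by []| |exact: block_neq].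
    by rewrite -mulrA ler_wpM2l// expr2 ler_pM.
  have -> : 2 * ka ^+ 2 * (K%:R * G n) = K%:R * (G n * iD / V n).
    by rewrite ka2; field; rewrite gt_eqF.
  have -> : C1 * G n * iD / V n = C1 * (G n * iD / V n) by ring.
  by rewrite ler_wpM2r// divr_ge0 ?(ltW V0)// mulr_ge0// ltW.
(* A row has one diagonal entry 1 and at most two entries at each positive distance, whence
   [1 + 2 (K n)^b <= 3 (K n)^b]. *)
pose A : R := 3 * (K * n)%:R `^ b.
have Kn0 : (0 < K * n)%N by rewrite muln_gt0.
have Knb : 1 <= (K * n)%:R `^ b :> R.
  apply: (@le_trans _ _ (1 `^ b)); first by rewrite powR1.
  by rewrite ge0_ler_powR ?nnegrE ?ler1n.
have A0 : 0 <= A by rewrite mulr_ge0// powR_ge0.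
have r_sym k l : r k l = r l k by rewrite /r absdiffC.
have rA k : \sum_l `|r k l| <= A.
  rewrite -(big_mkord xpredT (fun l => `|rho (2 * H) (absdiff k l)|)).
  have r0 : `|rho (2 * H) 0| = 1 by rewrite rho0// normr1.
  apply: (le_trans (toeplitz_row (c := fun m => `|rho (2 * H) m|) r0 _ (ltn_ord k))) => //.
  have h : \sum_(1 <= m < p n ord_max) `|rho (2 * H) m| <= (K * n)%:R `^ b.
    apply: le_trans (sum_norm_rho a0 a32 Kn0).
    by apply: ler_sum_interval => //; exact: pK.
  by rewrite /A; lra.
have alx i' k : `|al i' k| <= ka.
  rewrite /al normrM [`|(_ * _)^-1|]ger0_norm ?x0//.
  case: (_ && _); rewrite ?normr1 ?mul1r ?xka// normr0 mul0r; exact: sqrtr_ge0.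
apply: (le_trans (gram_variance_bound i j r_sym rA A0 alx)).
have -> : \sum_k \sum_l r k l ^+ 2 = V (p n ord_max) by rewrite /V -toeplitz_sum_ord.
have A2 : A ^+ 2 <= 9 * (K%:R * (Q * q ^+ 2 * V n)).
  have -> : A ^+ 2 = 9 * (K * n)%:R `^ (2 * b).
    by rewrite /A exprMn -[in LHS](powR_mulrn 2 (powR_ge0 _ b)) -powRrM [b * _]mulrC; ring.
  by rewrite ler_wpM2l// (le_trans (KG n0))// ler_wpM2l.
(* [V_dev] with [D = t ord_max] compares the whole range with [V n]; its error [C1 G n] is absorbed
   by [G n <= Q q^2 V n <= Q^3 V n]. *)
have VM : V (p n ord_max) <= (K%:R + C1 * Q ^+ 3) * V n.
  have := @V_dev n (p n ord_max) (t ord_max) n0 (t_ge0 _) (tK _) (pK _ _).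
  have [h1 h2] := p_itv n ord_max.
  have -> : `|(p n ord_max)%:R - t ord_max * n%:R| <= 1.
    by rewrite ler_norml; apply/andP; split; lra.
  move=> /(_ isT) /(le_trans (ler_norm _)) h.
  have h5 : C1 * G n <= C1 * Q ^+ 3 * V n.
    rewrite -mulrA ler_wpM2l ?(ltW C10)// (le_trans hG)// ler_wpM2r ?(ltW V0)//.
    by rewrite [Q ^+ 3]exprS ler_wpM2l ?(ltW Q0)// lerXn2r// nnegrE ltW.
  have h6 : t ord_max * V n <= K%:R * V n by rewrite ler_wpM2r ?(ltW V0).
  by lra.
apply: (@le_trans _ _ (F2 * q ^+ 2)); last first.
  rewrite exprMn ler_wpM2r ?sqr_ge0// -[leLHS](sqr_sqrtr (ltW F0)).
  by rewrite lerXn2r ?nnegrE ?addr_ge0 ?sqrtr_ge0 ?(ltW E0)// lerDr ltW.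
apply: (@le_trans _ _ (8 * ka ^+ 4 * (((K%:R + C1 * Q ^+ 3) * V n) *
    (9 * (K%:R * (Q * q ^+ 2 * V n)))))).
  rewrite ler_wpM2l; first by [].
    by rewrite mulr_ge0// exprn_ge0// sqrtr_ge0.
  apply: ler_pM => //; last exact: sqr_ge0.
  by apply: sumr_ge0 => k _; apply: sumr_ge0 => l _.
rewrite (exprM ka 2 2) ka2 /F2 le_eqVlt; apply/orP; left; apply/eqP.
by field; rewrite gt_eqF.
Qed.

End increment_estimates.

Theorem theorem4p6 (R : realType) (H : R) (H_gt0 : 0 < H) (H_le : H <= 3 / 4)
    (d : nat) (d_ge1 : (1 <= d)%N) (t : 'I_d.+1 -> R) (t_0 : t ord0 = 0)
    (t_incr : forall i j : 'I_d.+1, (i < j)%N -> t i < t j) :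
  exists c : R, 0 < c /\
    forall (disp disp' : measure_display)
      (T : measurableType disp) (P : probability T R)
      (B : R -> {RV P >-> R}) (sigma : nat -> R)
      (T' : measurableType disp') (P' : probability T' R) (N : T' -> 'rV[R]_d),
    is_fBm H B ->
    (forall n, (1 <= n)%N -> 0 < sigma n) ->
    (forall n, (1 <= n)%N -> ('E_P[fun w => (Zn B sigma n 1 w ^+ 2)%R] = 1)%E) ->
    std_gaussian_vector P' N ->
    forall n, (1 <= n)%N ->
    (ereal_sup
       [set `| 'E_P[fun w => phi (Zn_increments B sigma t n w)]
               - 'E_P'[fun w => phi (N w)] |
         | phi in [set phi : 'rV[R]_d -> R | C2 phi /\ hessian_norm phi <= 1]]
     <= c%:E * rate H n)%E.
Proof.
have [Q Q0 hQ] := rate_bound H_gt0 H_le.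
have [C C0 hC] := increment_estimates H_gt0 H_le t_0 t_incr Q0.
have d0 : 0 < d%:R :> R by rewrite ltr0n.
(* The interpolation gives a factor 2, there are [d^2] pairs, and each costs [C q] for the bias and
   [C q] for the standard deviation. The witness is fixed before the probability spaces are
   introduced. *)
exists (4 * d%:R ^+ 2 * C); split; first by rewrite !mulr_gt0.
move=> disp disp' T P B sigma T' P' N hB s0 sE hN n n1.
have [->|[q [-> q0 qQ hG]]] := hQ n n1.
  (* The infinite rate, at [H = 3/4] and [n = 1]: the constant is positive, so the product is
     [+oo]. *)
  by rewrite gt0_muley ?leey// lte_fin !mulr_gt0.
apply: ub_ereal_sup => _ [phi [phi2 hess] <-].
pose p i := Num.truncn (n%:R * t i).
pose X (k : 'I_(p ord_max)) w := B k.+1%:R w - B k%:R w.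
pose r (k l : 'I_(p ord_max)) := rho (2 * H) (absdiff k l).
pose al (i : 'I_d) (k : 'I_(p ord_max)) :=
  (p (widen_ord (leqnSn d) i) <= k < p (lift ord0 i))%:R *
  (sigma n * Num.sqrt (t (lift ord0 i) - t (widen_ord (leqnSn d) i)))^-1.
have gX : gaussian_vector P X r by exact: fBm_gaussian_vector.
have r_sym k l : r k l = r l k by rewrite /r absdiffC.
have r_diag k : r k k = 1 by rewrite /r /absdiff subnn rho0// mulr_gt0.
have sn : sigma n ^+ 2 = 2 * toeplitz_sum (fun r => rho (2 * H) r ^+ 2) n.
  by apply: (fBm_normalization H_gt0 hB); [rewrite gt_eqF ?s0|exact: sE].
have tle := partition_le t_incr.
have -> : (fun w => phi (Zn_increments B sigma t n w)) = (fun w => phi (chaos al (X^~ w))).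
  apply/funext => w; congr phi; apply: Zn_increments_chaos => // i.
  by apply: tle; rewrite -ltnS.
have [iF iN] := integrable_interpolation_ends al gX r_diag hN phi2 hess.
rewrite unlock -[X in `|X - _|%E]fineK ?integrable_fin_num//.
rewrite -[X in `|_ - X|%E]fineK ?integrable_fin_num// lee_fin.
apply: (le_trans (interpolation_bound al gX r_sym r_diag hN phi2 hess)).
have Cq0 : 0 <= C * q by rewrite mulr_ge0// ltW.
apply: (@le_trans _ _ (2 * \sum_(i < d) \sum_(j < d) (C * q + C * q))).
  rewrite ler_wpM2l//; apply: ler_sum => i _; apply: ler_sum => j _.
  have [h1 h2] := hC n (sigma n) q n1 (s0 n n1) sn q0 qQ hG i j.
  exact: (gram_deviation gX r_sym r_diag Cq0 Cq0 h1 h2).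
rewrite !sumr_const !card_ord -mulrnA -[X in 2 * X]mulr_natr natrM.
by rewrite le_eqVlt; apply/orP; left; apply/eqP; ring.
Qed.
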